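(* Let $\Phi$ be a finite sequence of nonzero vectors generating $V$ and lying in an open half-space. Let $W$ be a wall of $\Phi$ and let $E\in U$ be a vector with $W=\{a\in V:\langle a,E\rangle=0\}$. Let $\mathfrak{c}_1,\mathfrak{c}_2$ be chambers of $\Phi$, on the two sides of $W$ and adjacent along $W$, with $\langle E,\mathfrak{c}_1\rangle>0$. Let $\Phi_0=\Phi\cap W$, let $\mathfrak{c}_{12}$ be the chamber of $\Phi_0$ in $W$ whose closure contains $\overline{\mathfrak{c}_1}\cap\overline{\mathfrak{c}_2}$, and let $v_{12}=v(\Phi_0,dw,\mathfrak{c}_{12})$ be the polynomial function on $W$ associated to $\mathfrak{c}_{12}$. Then $$v(\Phi,dx,\mathfrak{c}_1)-v(\Phi,dx,\mathfrak{c}_2)=\mathrm{Pol}(v_{12},\Phi\setminus\Phi_0,E).$$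
   Context: Setting. $U$ is an $r$-dimensional real vector space, $V=U^*$; $dx$ is a Lebesgue measure on $U$ and $da$ the dual Lebesgue measure on $V$. $dw$ is the Lebesgue measure on $W$ such that $da=dw\,dt$ with $t=\langle a,E\rangle$. Volume. For $\Phi=[\phi_1,\dots,\phi_N]$, $P(\Phi,a)=\{t\in\mathbb{R}_{\ge0}^N:\sum_it_i\phi_i=a\}$; $\mathrm{vol}(\Phi,dx)(a)$ is the volume of $P(\Phi,a)$ in the affine space $\{t\in\mathbb{R}^N:\sum t_i\phi_i=a\}$ for the quotient measure $dt/da$ ($dt$ Lebesgue measure on $\mathbb{R}^N$). For $\Phi_0$ (which spans $W$) the volume is defined in the same way using $dw$ on $W$ in place of $da$. Chambers. $C(\nu)$ is the closed convex cone generated by $\nu$; $C(\Phi)_{\mathrm{sing}}$ is the union of the $C(\nu)$ over subsets $\nu\subset\Phi$ of cardinality $<\dim V$; chambers are the connected components of $V\setminus C(\Phi)_{\mathrm{sing}}$. The exterior of $C(\Phi)$ is a chamber $\mathfrak{c}_{\mathrm{ext}}$; the others are interior (contained in $C(\Phi)$). Same for $\Phi_0$ in $W$. A wall is a hyperplane generated by $r-1$ linearly independent elements of $\Phi$. ''On the two sides of $W$ and adjacent, with $\langle E,\mathfrak{c}_1\rangle>0$'' means: $\langle a,E\rangle>0$ for $a\in\mathfrak{c}_1$; either $\langle a,E\rangle<0$ for all $a\in\mathfrak{c}_2$, or $\mathfrak{c}_2=\mathfrak{c}_{\mathrm{ext}}$; and $\overline{\mathfrak{c}_1}\cap\overline{\mathfrak{c}_2}\cap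 W$ has non-empty interior in $W$ (when $\mathfrak{c}_2=\mathfrak{c}_{\mathrm{ext}}$, read $\overline{\mathfrak{c}_1}\cap\overline{\mathfrak{c}_2}$ as $\overline{\mathfrak{c}_1}\cap\overline{\mathfrak{c}_2}\cap W$). For an interior chamber $\mathfrak{c}$, $v(\Phi,dx,\mathfrak{c})$ is the unique polynomial function on $V$ equal to $\mathrm{vol}(\Phi,dx)$ on $\overline{\mathfrak{c}}$; $v(\Phi,dx,\mathfrak{c}_{\mathrm{ext}})=0$. Similarly $v(\Phi_0,dw,\mathfrak{c}_{12})$ is a polynomial on $W$. Pol. For a polynomial $P$ on $V$, $P(\partial_x)$ is the constant coefficient differential operator in $x\in U$ with $P(\partial_x)e^{\langle a,x\rangle}=P(a)e^{\langle a,x\rangle}$. For a polynomial $p$ on $W$ and a finite sequence $\Psi$ of vectors of $V$ not in $W$, with $P$ any polynomial on $V$ extending $p$ (the result is independent of $P$), $$\mathrm{Pol}(p,\Psi,E)(a)=\mathrm{Res}_{z=0}\left(P(\partial_x)\cdot\frac{e^{\langle a,x+zE\rangle}}{\prod_{\psi\in\Psi}\langle\psi,x+zE\rangle}\right)_{x=0},\quad a\in V,$$ where $\mathrm{Res}_{z=0}$ is the coefficient of $z^{-1}$ in the Laurent expansion at $0$. *)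

(* Defs.v *)
From HB Require Import structures.
From mathcomp Require Import all_boot all_order all_algebra.
From mathcomp Require Import all_classical all_reals all_analysis.
From mathcomp Require mpoly.
Import Order.TTheory GRing.Theory Num.Theory.
Import numFieldNormedType.Exports.

Set Implicit Arguments.
Unset Strict Implicit.
Unset Printing Implicit Defensive.

Local Open Scope classical_set_scope.
Local Open Scope ring_scope.

(* Coordinates are fixed on U, so that U is the space of columns 'cV[R]_r and  *)
(* V = U^* the space of rows 'rV[R]_r. Measures are set functions with values  *)
(* in \bar R; only their values on closed sets matter.                         *)

Definition pairing (R : realType) (r : nat) (a : 'rV[R]_r) (x : 'cV[R]_r) : R :=
  (a *m x) 0 0.

Section LinearMeasures.
Variable R : realType.

(* Lebesgue measure on R^n by iterated integration (Tonelli), correct on Borel *)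
(* sets; on the one-point space R^0 it is the unit mass.                       *)
Fixpoint leb (n : nat) : set 'rV[R]_n -> \bar R :=
  match n with
  | 0 => fun A => (\1_A (0 : 'rV[R]_0))%:E
  | n'.+1 => fun A => (\int[@lebesgue_measure R]_t
      leb [set y : 'rV[R]_n' | A (row_mx (t%:M : 'M[R]_1) y)])%E
  end.

Definition comb (vT : vectType R) (X : seq vT) (y : 'rV[R]_(size X)) : vT :=
  \sum_(i < size X) y 0 i *: X`_i.

Definition paral (vT : vectType R) (X : seq vT) : set vT :=
  @comb vT X @` [set y : 'rV[R]_(size X) | forall i, 0 <= y 0 i <= 1].

(* For X free: the Lebesgue measure on <<X>> with paral X of volume 1.         *)
Definition leb_basis (vT : vectType R) (X : seq vT) (A : set vT) : \bar R :=
  leb [set y : 'rV[R]_(size X) | A (comb y)].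

(* The quotient mu/nu of Lebesgue measures mu on vT and nu on limg f: the      *)
(* Lebesgue measure on lker f such that                                        *)
(*   mu (paral (K ++ S)) = (mu/nu) (paral K) * nu (paral (f S))                *)
(* for K a basis of lker f and S a lift of a basis of limg f. By the change of *)
(* variables formula it does not depend on K and S, so they are taken          *)
(* canonical.                                                                  *)
Definition quot_measure (vT wT : vectType R) (f : 'Hom(vT, wT))
    (mu : set vT -> \bar R) (nu : set wT -> \bar R) (A : set vT) : \bar R :=
  let K := (vbasis (lker f) : seq vT) in
  let B := (vbasis (limg f) : seq wT) in
  let S := map (f^-1)%VF B in
  ((fine (mu (paral (K ++ S))) / fine (nu (paral B)))%:E * leb_basis K A)%E.

End LinearMeasures.

Section Volume.
Variables (R : realType) (r : nat).
Implicit Types (Phi : seq 'rV[R]_r) (F W : {vspace 'rV[R]_r}).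
Implicit Types (c : set 'rV[R]_r) (E : 'cV[R]_r).

Definition is_lebesgue (dx : set 'cV[R]_r -> \bar R) : Prop :=
  exists2 k : R, 0 < k &
    forall A, dx A = (k%:E * leb [set y : 'rV[R]_r | A y^T])%E.

(* Parallelepipeds on dual bases have inverse volumes for dx and da.           *)
Definition dual_measure (dx : set 'cV[R]_r -> \bar R) (A : set 'rV[R]_r) :
    \bar R :=
  ((fine (dx [set x : 'cV[R]_r | forall i, 0 <= x i 0 <= 1]))^-1%:E * leb A)%E.

(* The measure dw on the hyperplane W = {a | <a, E> = 0} with da = dw dt,      *)
(* t = <a, E>.                                                                 *)
Definition wall_measure (da : set 'rV[R]_r -> \bar R) E :
    set 'rV[R]_r -> \bar R :=
  quot_measure (linfun ((fun a => pairing a E) : 'rV[R]_r -> R^o)) da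
    (@lebesgue_measure R).

Definition polytope Phi (a : 'rV[R]_r) : set 'rV[R]_(size Phi) :=
  [set t : 'rV[R]_(size Phi) | (forall i, 0 <= t 0 i) /\ comb t = a].

(* mu is a Lebesgue measure on <<Phi>> and a \in <<Phi>>. The measure dt/mu    *)
(* lives on the kernel of t |-> \sum_i t_i phi_i and is carried to the fibre   *)
(* over a by translation by a point of this fibre.                             *)
Definition vol Phi (mu : set 'rV[R]_r -> \bar R) (a : 'rV[R]_r) : \bar R :=
  let f := linfun (@comb R _ Phi) in
  quot_measure f (@leb R (size Phi)) mu
    [set k | polytope a ((f^-1)%VF a + k)].

Definition cone (nu : seq 'rV[R]_r) : set 'rV[R]_r :=
  @comb R _ nu @` [set t : 'rV[R]_(size nu) | forall i, 0 <= t 0 i].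

(* In what follows F is the span of Phi: it is V itself, or a wall.            *)

Definition sing F Phi : set 'rV[R]_r :=
  [set a | exists nu, [/\ subseq nu Phi, (size nu < \dim F)%N & cone nu a]].

Definition is_chamber F Phi c : Prop :=
  exists2 a, ([set` F] `\` sing F Phi) a &
    c = connected_component ([set` F] `\` sing F Phi) a.

Definition exterior F Phi : set 'rV[R]_r := [set` F] `\` cone Phi.

Definition peval (P : mpoly.mpoly r R) (a : 'rV[R]_r) : R :=
  mpoly.meval (fun i => a 0 i) P.

(* The polynomial functions on F are the restrictions of those on V; values    *)
(* outside F are irrelevant.                                                   *)
Definition is_polynomial_on F (v : 'rV[R]_r -> R) : Prop :=
  exists P, forall a, a \in F -> v a = peval P a.

(* v = v(Phi, mu, c).                                                          *)
Definition is_chamber_poly F Phi (mu : set 'rV[R]_r -> \bar R) c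
    (v : 'rV[R]_r -> R) : Prop :=
  [/\ is_polynomial_on F v,
      c = exterior F Phi -> forall a, a \in F -> v a = 0 &
      c <> exterior F Phi -> forall a, closure c a -> vol Phi mu a = (v a)%:E].

Definition is_wall Phi W : Prop :=
  exists nu, [/\ {subset nu <= Phi}, (size nu).+1 = r, free nu & W = <<nu>>%VS].

(* c1 <> c2 is implied by the other clauses except for r = 1, when c1 and c2   *)
(* could both be the exterior half-line.                                       *)
Definition adjacent_along Phi W E (c1 c2 : set 'rV[R]_r) : Prop :=
  [/\ c1 <> c2,
      forall a, c1 a -> 0 < pairing a E,
      (forall a, c2 a -> pairing a E < 0) \/ c2 = exterior fullv Phi &
      exists2 a, a \in W &
        \forall b \near a, b \in W -> (closure c1 `&` closure c2) b].

End Volume.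

Section WallCrossing.
Variables (R : realType) (r : nat).

(* The i-th coordinate a_i = <a, e_i> on V corresponds to the derivative along *)
(* the i-th basis vector e_i of U, so that                                     *)
(* P(d_x) e^<a, x> = P(a) e^<a, x>.                                            *)
Definition diff_op (P : mpoly.mpoly r R) (f : 'cV[R]_r -> R) :
    'cV[R]_r -> R := fun x =>
  \sum_(m <- mpoly.msupp P) mpoly.mcoeff m P *
    foldr (fun (i : 'I_r) (g : 'cV[R]_r -> R) =>
             iter (mpoly.fun_of_multinom m i)
               (fun h : 'cV[R]_r -> R => 'D_(delta_mx i 0) h) g)
          f (enum 'I_r) x.

(* The coefficient of z^-1 in g(z) = \sum_n (u n) z^(n - m - 1), 0 < |z| small *)
Definition residue (g : R -> R) : R :=
  get [set c | exists m (u : nat -> R), u m = c /\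
    \forall z \near 0^',
      (fun N => \sum_(0 <= n < N) u n * z ^+ n) @ \oo --> z ^+ m.+1 * g z].

(* P is a polynomial on V extending the polynomial p on W.                     *)
Definition Pol (P : mpoly.mpoly r R) (Psi : seq 'rV[R]_r) (E : 'cV[R]_r)
    (a : 'rV[R]_r) : R :=
  residue (fun z => diff_op P
    (fun x => expR (pairing a (x + z *: E)) /
              \prod_(psi <- Psi) pairing psi (x + z *: E)) 0).

End WallCrossing.

(* Main.v *)
From HB Require Import structures.
Require Import Defs.
From mathcomp Require Import all_boot all_order perm all_algebra.
From mathcomp Require Import all_classical all_reals all_analysis.
From mathcomp Require Import measurable_realfun.
From mathcomp Require mpoly.
From mathcomp Require Import ring lra.
Import Order.TTheory GRing.Theory Num.Theory.
Import numFieldNormedType.Exports.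
Set Implicit Arguments.
Unset Strict Implicit.
Unset Printing Implicit Defensive.
Local Open Scope classical_set_scope.
Local Open Scope ring_scope.

(** Why the jump formula holds.

    Let Psi be the vectors of Phi outside W, s = <a, E>, and let a0 be a
    generic point of the common face of c1 and c2. Near a0 and off W, the
    volume of the polytope of Phi is v1 where s > 0 and v2 where s < 0, that
    is h = v2 + [s > 0] (v1 - v2) (local_structure, chamber_poly_vol). Put
    F = Pol(v12, Psi, E). The point is to compare h with [s > 0] F.

    For a small eps > 0, consider the volume B(a) of the part of the fibre
    over a where the coordinates along Psi lie in [0, eps[ and the others are
    nonnegative. It is computed in two ways.

    Removing the points whose coordinate along psi is at least eps amounts to
    subtracting the same volume over a - eps psi. Hence B is the iterated
    difference of h along Psi, the difference along psi being
    h(a) - h(a - eps psi) (fvol_boxset).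

    On the other hand the fibre can be sliced along one vector of Psi after
    the other. As long as another vector of Psi remains, this is an integral
    over [0, eps[ (fvol_cons_in_span); for the last one, psi, the slice is a
    single fibre over a point of W, with volume v12 up to the factor
    1 / |<psi, E>| which compares da with dw (fvol_cons_off_wall). The residue
    polynomials F_M = Pol(v12, M, E) follow the same steps: for psi outside W
    the derivative of F_(psi :: M) along psi is F_M (op_residue_line), on W
    they vanish if M has at least two elements (op_residue_wall), and are
    v12 / <psi, E> if M consists of psi (op_residue_wall1). By the
    fundamental theorem of calculus, B is therefore the iterated difference
    of [s > 0] F (fvol_box).

    So the iterated difference of v2 + [s > 0] (v1 - v2 - F) vanishes near a0.
    It is an alternating sum over the points a - eps (psi_1 + ... + psi_k),
    for the subfamilies of Psi. Where all these vertices have s < 0, only v2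
    contributes: its iterated difference vanishes on an open set, hence
    everywhere, being a polynomial. Next to W on the positive side, there are
    positions where exactly one vertex has s > 0; then v1 - v2 - F vanishes at
    this vertex (fdiff_upper_isolated). These vertices fill an open set, so
    v1 - v2 = F everywhere (wall_jump).

    Two computations support this. The measure leb scales by determinants
    (leb_scales_unit), so that quotient measures may be computed in arbitrary
    bases (quot_of_change); and differentiating
    exp<a, x + zE> / prod <psi, x + zE> leads to a recursion which the
    residue at z = 0 inherits (PolE). *)

(** * Lebesgue measure on rows *)

Arguments leb : simpl never.

Definition rV_display : measure_display. Proof. exact: default_measure_display. Qed.

Section RowBorel.
Variables (R : realType) (n : nat).

Let coor (i : 'I_n) (x : 'rV[R]_n) : measurableTypeR R := x 0 i.

Let rV_set0 : g_sigma_preimage coor set0.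
Proof. exact: sigma_algebra0. Qed.

Let rV_setC A : g_sigma_preimage coor A -> g_sigma_preimage coor (~` A).
Proof. exact: sigma_algebraC. Qed.

Let rV_bigcup (F : _^nat) : (forall i, g_sigma_preimage coor (F i)) ->
  g_sigma_preimage coor (\bigcup_i (F i)).
Proof. exact: sigma_algebra_bigcup. Qed.

(** The Borel sets: leb is defined on all sets, but is a measure on these only. *)
HB.instance Definition _ := @isMeasurable.Build rV_display
  'rV[R]_n (g_sigma_preimage coor) rV_set0 rV_setC rV_bigcup.

Lemma measurable_coord (i : 'I_n) :
  measurable_fun [set: 'rV[R]_n] (fun x : 'rV[R]_n => x 0 i).
Proof.
move=> _ Y mY; rewrite setTI; apply: sub_sigma_algebra => /=.
rewrite -bigcup_seq/=; exists i => /=; first by rewrite mem_index_enum.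
by exists Y => //; rewrite setTI.
Qed.

Lemma measurable_fun_rowP d (T : measurableType d) (f : T -> 'rV[R]_n) :
  (forall i, measurable_fun [set: T] (fun x => f x 0 i)) ->
  measurable_fun [set: T] f.
Proof.
move=> mf.
suff : g_sigma_preimage (fun i (x : T) => f x 0 i : measurableTypeR R) `<=` measurable.
  rewrite (g_sigma_preimage_comp coor) => prefS.
  by move=> _ A mA; apply: prefS; exists A.
apply: smallest_sub; first exact: sigma_algebra_measurable.
case: n f coor mf => [|m] f coor' mf; first by rewrite big_ord0.
rewrite -bigcup_mkord_ord; apply: bigcup_sub => i Ii.
by move=> A [B mB <-]; exact: mf.
Qed.
End RowBorel.

Section Leb.
Variable R : realType.
Local Notation mu := (@lebesgue_measure R).

Definition rvcons n (t : R) (y : 'rV[R]_n) : 'rV[R]_n.+1 :=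
  row_mx (t%:M : 'M[R]_1) y.

Definition rvbehead n (x : 'rV[R]_n.+1) : 'rV[R]_n := \row_i x 0 (lift 0 i).

Lemma rvcons0 n t (y : 'rV[R]_n) : rvcons t y 0 0 = t.
Proof.
transitivity ((row_mx (t%:M : 'M[R]_1) y) 0 (lshift n (0 : 'I_1))).
  by congr (row_mx _ _ _ _); exact: ord_inj.
by rewrite row_mxEl mxE eqxx mulr1n.
Qed.

Lemma rvconsS n t (y : 'rV[R]_n) i : rvcons t y 0 (lift 0 i) = y 0 i.
Proof.
rewrite -(row_mxEr (t%:M : 'M[R]_1) y 0 i).
congr (row_mx _ _ _ _); exact: ord_inj.
Qed.

Lemma rvcons_behead n (x : 'rV[R]_n.+1) : rvcons (x 0 0) (rvbehead x) = x.
Proof.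
apply/rowP => i; case: (unliftP 0 i) => [j ->|->]; last by rewrite rvcons0.
by rewrite rvconsS mxE.
Qed.

Lemma rvbeheadK n t (y : 'rV[R]_n) : rvbehead (rvcons t y) = y.
Proof. by apply/rowP => i; rewrite mxE rvconsS. Qed.

Lemma rvconsD n s t (y z : 'rV[R]_n) :
  rvcons s y + rvcons t z = rvcons (s + t) (y + z).
Proof.
by apply/rowP => i; rewrite mxE; case: (unliftP 0 i) => [j ->|->];
  rewrite ?rvconsS ?rvcons0 ?mxE.
Qed.

Lemma rvcons_mul_block n t (y : 'rV[R]_n) (a : R) (v : 'rV[R]_n) (M : 'M[R]_n) :
  rvcons t y *m (block_mx a%:M v 0 M : 'M[R]_n.+1) = rvcons (t * a) (t *: v + y *m M).
Proof.
have := mul_row_block (t%:M : 'M[R]_1) y (a%:M : 'M[R]_1) v 0 M.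
by rewrite mulmx0 addr0 -scalar_mxM mul_scalar_mx.
Qed.

Lemma measurable_rvcons n :
  measurable_fun [set: measurableTypeR R * 'rV[R]_n] (fun p => rvcons p.1 p.2).
Proof.
apply: measurable_fun_rowP => i; case: (unliftP 0 i) => [j ->|->].
  under eq_fun do rewrite rvconsS.
  exact: (measurableT_comp (measurable_coord j) measurable_snd).
under eq_fun do rewrite rvcons0.
exact: measurable_fst.
Qed.

Lemma measurable_rvbehead n :
  measurable_fun [set: 'rV[R]_n.+1]
    (fun x => (x 0 0, rvbehead x) : measurableTypeR R * 'rV[R]_n).
Proof.
apply: measurable_fun_pair; first exact: measurable_coord.
apply: measurable_fun_rowP => i.
under eq_fun do rewrite mxE.
exact: measurable_coord.
Qed.

Lemma measurable_rvcons_section n (A : set 'rV[R]_n.+1) (t : R) : measurable A ->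
  measurable [set y : 'rV[R]_n | A (rvcons t y)].
Proof.
move=> mA; have mB : measurable ((fun p : measurableTypeR R * 'rV[R]_n => rvcons p.1 p.2) @^-1` A).
  by rewrite -[X in measurable X]setTI; apply: measurable_rvcons.
have := measurable_xsection (t : measurableTypeR R) mB.
by congr measurable; apply/seteqP; split => y; rewrite /xsection /= inE.
Qed.

Definition sigma_finite_measurelike n (m : set 'rV[R]_n -> \bar R) :=
  [/\ m set0 = 0%E, forall A, (0 <= m A)%E, semi_sigma_additive m &
    sigma_finite setT m].

Lemma lebS n (A : set 'rV[R]_n.+1) :
  (leb A = \int[mu]_t leb [set y : 'rV[R]_n | A (rvcons t y)])%E.
Proof. by []. Qed.

Lemma lebE n (A : set 'rV[R]_n.+1) : leb A = product_measure1 mu (@leb R n)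
  ((fun p : measurableTypeR R * 'rV[R]_n => rvcons p.1 p.2) @^-1` A).
Proof.
rewrite /product_measure1 /=; apply: eq_integral => t _ /=; congr leb.
by apply/seteqP; split => y; rewrite /xsection /= inE.
Qed.

(** By induction on n: leb in dimension n + 1 is the product of the Lebesgue
    measure with leb in dimension n. The properties are gathered in a
    proposition because the induction step needs the measure structure of the
    previous dimension. *)
Lemma leb_measurelike n : sigma_finite_measurelike (@leb R n).
Proof.
elim: n => [|n [IH0 IHge IHadd IHfin]].
  have E : @leb R 0 = dirac (0 : 'rV[R]_0) by apply/funext => A /=; rewrite /dirac.
  split.
  - by rewrite E measure0.
  - by move=> A; rewrite E.
  - by rewrite E; exact: measure_semi_sigma_additive.
  - by rewrite E; exact: sigma_finiteT.
pose m1 := isMeasure.Build _ _ _ (@leb R n) IH0 IHge IHadd.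
pose M1 : {measure set 'rV[R]_n -> \bar R} := HB.pack (@leb R n) m1.
pose m2 := Measure_isSigmaFinite.Build _ _ _ M1 IHfin.
pose m : {sigma_finite_measure set 'rV[R]_n -> \bar R} := HB.pack (@leb R n) m1 m2.
pose c := fun p : measurableTypeR R * 'rV[R]_n => rvcons p.1 p.2.
have E A : leb A = product_measure1 mu m (c @^-1` A) by rewrite lebE.
have mpre (A : set 'rV[R]_n.+1) : measurable A -> measurable (c @^-1` A).
  by move=> mA; rewrite -[X in measurable X]setTI; apply: measurable_rvcons.
split.
- by rewrite E preimage_set0 measure0.
- by move=> A; rewrite E.
- move=> F mF tF mUF; rewrite E preimage_bigcup.
  rewrite (_ : (fun k => _) = (fun k => \sum_(0 <= i < k) product_measure1 mu m (c @^-1` (F i)))%E); last first.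
    by apply/funext => k; apply: eq_bigr => i _; rewrite E.
  apply: measure_semi_sigma_additive.
  + by move=> i; exact: mpre.
  + apply/trivIsetP => /= i j _ _ ij; rewrite -preimage_setI.
    by move/trivIsetP : tF => /(_ _ _ _ _ ij) ->//; rewrite preimage_set0.
  + by rewrite -preimage_bigcup; exact: mpre.
- pose g (x : 'rV[R]_n.+1) : measurableTypeR R * 'rV[R]_n := (x 0 0, rvbehead x).
  have /sigma_finiteP[F [TF ndF Foo]] := sigma_finiteT mu.
  have /sigma_finiteP[G [TG ndG Goo]] := sigma_finiteT m.
  exists (fun i => g @^-1` (F i `*` G i)).
    rewrite -preimage_bigcup -(@preimage_setT _ _ g); congr (_ @^-1` _).
    apply/seteqP; split => // -[x y] _.
    have [i _ Fix] : (\bigcup_i F i) x by rewrite -TF.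
    have [j _ Gjy] : (\bigcup_i G i) y by rewrite -TG.
    exists (maxn i j) => //; split => /=.
    + by move: x Fix; exact/subsetPset/ndF/leq_maxl.
    + by move: y Gjy; exact/subsetPset/ndG/leq_maxr.
  move=> i; have [mF fF] := Foo i; have [mG fG] := Goo i.
  split.
    rewrite -[X in measurable X]setTI; apply: measurable_rvbehead => //.
    exact: measurableX.
  rewrite E (_ : c @^-1` _ = F i `*` G i).
    by rewrite product_measure1E// lte_mul_pinfty// ge0_fin_numE.
  by apply/seteqP; split => -[t y] /=; rewrite /g /c /= rvcons0 rvbeheadK.
Qed.

HB.instance Definition _ n := let: And4 h0 hge hadd _ := leb_measurelike n in
  isMeasure.Build _ _ _ (@leb R n) h0 hge hadd.
HB.instance Definition _ n := Measure_isSigmaFinite.Build _ _ _ (@leb R n)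
  (let: And4 _ _ _ h := leb_measurelike n in h).

Lemma measurable_leb_section n (A : set 'rV[R]_n.+1) : measurable A ->
  measurable_fun [set: R] (fun t : R => leb [set y : 'rV[R]_n | A (rvcons t y)] : \bar R).
Proof.
move=> mA; have mB : measurable ((fun p : measurableTypeR R * 'rV[R]_n => rvcons p.1 p.2) @^-1` A).
  by rewrite -[X in measurable X]setTI; apply: measurable_rvcons.
have := measurable_fun_xsection (@leb R n) mB.
congr measurable_fun; apply/funext => t /=; congr leb.
by apply/seteqP; split => y; rewrite /xsection /= inE.
Qed.

(** After multiplication by |a| the left-hand side is a measure of A which
    agrees with the Lebesgue measure on intervals. *)
Lemma lebesgue_affine (a b : R) (A : set R) : a != 0 -> measurable A ->
  mu [set t : R | A (t * a + b)] = (`|a|^-1%:E * mu A)%E.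
Proof.
move=> a0 mA; pose f (t : measurableTypeR R) : measurableTypeR R := t * a + b.
have mf : measurable_fun setT f.
  by apply: measurable_funD => //; apply: measurable_funM.
pose k : {nonneg R} := NngNum (normr_ge0 a).
pose pf : {measure set (measurableTypeR R) -> \bar R} :=
  measure_function_pushforward__canonical__measure_function_Measure mu mf.
suff : mu A = mscale k pf A.
  move=> ->; rewrite /mscale /= /pushforward muleA -EFinM mulVf ?normr_eq0//.
  by rewrite mul1e.
apply: lebesgue_measure_unique mA => _ [[x y]] _ <- /=.
rewrite /mscale /= /pushforward /f /=.
have [a_gt0|a_lt0|] := ltgtP 0 a; last by move/esym/eqP; rewrite (negbTE a0).
  rewrite (_ : _ @^-1` _ = `](x - b) / a, (y - b) / a]%classic); last first.
    apply/seteqP; split => t /=; rewrite !in_itv /=.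
      by rewrite ltr_pdivrMr// ler_pdivlMr// ltrBlDr lerBrDr.
    by rewrite ltr_pdivrMr// ler_pdivlMr// ltrBlDr lerBrDr.
  rewrite !lebesgue_measure_itv /= !lte_fin ltr_pM2r ?invr_gt0// ltrD2r.
  case: ifP => xy; last by rewrite mule0.
  rewrite -!EFinD -EFinM gtr0_norm//; congr (_%:E).
  by field; rewrite gt_eqF.
rewrite (_ : _ @^-1` _ = `[(y - b) / a, (x - b) / a[%classic); last first.
  apply/seteqP; split => t /=; rewrite !in_itv /=.
    by rewrite ler_ndivrMr// ltr_ndivlMr// ltrBlDr lerBrDr andbC.
  by rewrite ler_ndivrMr// ltr_ndivlMr// ltrBlDr lerBrDr andbC.
rewrite !lebesgue_measure_itv /= !lte_fin ltr_nM2r ?invr_lt0// ltrD2r.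
case: ifP => xy; last by rewrite mule0.
rewrite -!EFinD -EFinM ltr0_norm//; congr (_%:E).
by field; rewrite lt_eqF.
Qed.

Lemma integral_affine (a b : R) (f : R -> \bar R) : a != 0 ->
  measurable_fun setT f -> (forall t, 0 <= f t)%E ->
  (\int[mu]_t f (t * a + b)%R = `|a|^-1%:E * \int[mu]_t f t)%E.
Proof.
move=> a0 mf f0; pose g (t : measurableTypeR R) : measurableTypeR R := t * a + b.
have mg : measurable_fun setT g.
  by apply: measurable_funD => //; apply: measurable_funM.
have := @ge0_integral_pushforward _ _ _ _ R g mg mu setT f measurableT mf (fun t _ => f0 t).
rewrite preimage_setT /= => <-.
have k0 : 0 <= `|a|^-1 by rewrite invr_ge0.
rewrite -(@ge0_integral_mscale _ _ _ mu setT measurableT (NngNum k0)) //.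
apply: eq_measure_integral => B mB _.
by rewrite /mscale /= /pushforward; exact: lebesgue_affine.
Qed.

Lemma leb_translate n (v : 'rV[R]_n) (A : set 'rV[R]_n) : measurable A ->
  leb [set y | A (y + v)] = leb A.
Proof.
elim: n v A => [|n IH] v A mA.
  by congr leb; apply/seteqP; split => y /=; rewrite !thinmx0 // [y + _]thinmx0.
rewrite -(rvcons_behead v); set s := v 0 0; set w := rvbehead v.
rewrite lebS.
transitivity (\int[mu]_t leb [set y | A (rvcons (t * 1 + s) y)])%E.
  apply: eq_integral => t _.
  rewrite -[RHS](IH w); last exact: measurable_rvcons_section.
  by congr leb; apply/seteqP; split => y /=; rewrite mulr1 rvconsD.
rewrite (integral_affine s (oner_neq0 _) (measurable_leb_section mA)); last first.
  by move=> t; exact: measure_ge0.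
by rewrite normr1 invr1 mul1e.
Qed.

Lemma measurable_mulmx m n (M : 'M[R]_(m, n)) :
  measurable_fun [set: 'rV[R]_m] (fun y : 'rV[R]_m => y *m M).
Proof.
apply: measurable_fun_rowP => i.
under eq_fun do rewrite mxE.
apply: measurable_sum => j; apply: measurable_funM => //.
exact: measurable_coord.
Qed.

Lemma measurable_addmx n (v : 'rV[R]_n) :
  measurable_fun [set: 'rV[R]_n] (fun y : 'rV[R]_n => v + y).
Proof.
apply: measurable_fun_rowP => i.
under eq_fun do rewrite mxE.
by apply: measurable_funD => //; exact: measurable_coord.
Qed.

Lemma measurable_preimage_affine m n (M : 'M[R]_(m, n)) v (A : set 'rV[R]_n) :
  measurable A -> measurable [set y | A (v + y *m M)].
Proof.
move=> mA; have := measurableT_comp (measurable_addmx v) (measurable_mulmx M).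
by move=> /(_ measurableT _ mA); rewrite setTI.
Qed.

Lemma measurable_preimage_add n (v : 'rV[R]_n) (A : set 'rV[R]_n) :
  measurable A -> measurable [set y | A (y + v)].
Proof.
move=> mA; have := measurable_preimage_affine 1%:M v mA.
by under eq_set do rewrite mulmx1 addrC.
Qed.

Lemma measurable_preimage_mulmx m n (M : 'M[R]_(m, n)) (A : set 'rV[R]_n) :
  measurable A -> measurable [set y | A (y *m M)].
Proof.
by move=> mA; have := measurable_preimage_affine M 0 mA; under eq_set do rewrite add0r.
Qed.

Definition leb_scales n (M : 'M[R]_n) := forall A : set 'rV[R]_n, measurable A ->
  leb [set y | A (y *m M)] = (`|\det M|^-1%:E * leb A)%E.

Lemma leb_scales_mul n (M N : 'M[R]_n) :
  leb_scales M -> leb_scales N -> leb_scales (M *m N).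
Proof.
move=> cM cN A mA; rewrite (_ : [set y | _] = [set y | [set z | A (z *m N)] (y *m M)]).
  rewrite cM ?cN//; last exact: measurable_preimage_mulmx.
  by rewrite muleA -EFinM det_mulmx normrM invfM.
by apply/seteqP; split => y /=; rewrite mulmxA.
Qed.

(** In the first coordinate the map is multiplication by a; on each slice it
    is M followed by a translation. *)
Lemma leb_scales_block n (a : R) (v : 'rV[R]_n) (M : 'M[R]_n) :
  a != 0 -> leb_scales M -> leb_scales (block_mx a%:M v 0 M : 'M[R]_n.+1).
Proof.
move=> a0 cM A mA; rewrite lebS.
transitivity (\int[mu]_t (`|\det M|^-1%:E * leb [set y | A (rvcons (t * a + 0) y)]))%E.
  apply: eq_integral => t _.
  have mB := measurable_rvcons_section (t * a + 0) mA.
  rewrite -(leb_translate (t *: v) mB) -cM; last first.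
    exact: measurable_preimage_add.
  by congr leb; apply/seteqP; split => y /=;
    rewrite rvcons_mul_block addr0 [t *: v + _]addrC.
rewrite ge0_integralZl//; last first.
  have mg : measurable_fun [set: R] (fun t : R => t * a + 0).
    by apply: measurable_funD => //; apply: measurable_funM.
  exact: (measurableT_comp (measurable_leb_section mA) mg).
rewrite (integral_affine 0 a0 (measurable_leb_section mA)); last first.
  by move=> t; exact: measure_ge0.
by rewrite muleA -EFinM (det_ublock (a%:M : 'M[R]_1)) det_scalar1 normrM invfM mulrC.
Qed.

End Leb.

Section LebUnitmx.
Variable R : realType.
Local Notation mu := (@lebesgue_measure R).

(** Tonelli for the first two coordinates. *)
Lemma leb_scales_swap n : leb_scales (tperm_mx 0 1 : 'M[R]_n.+2).
Proof.
move=> A mA; rewrite det_perm odd_tperm normr_sign invr1 mul1e.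
pose f (p : measurableTypeR R * measurableTypeR R) : \bar R :=
  leb [set y : 'rV[R]_n | A (rvcons p.1 (rvcons p.2 y))].
have mf : measurable_fun setT f.
  pose c (p : (measurableTypeR R * measurableTypeR R) * 'rV[R]_n) :=
    rvcons p.1.1 (rvcons p.1.2 p.2).
  have mc : measurable_fun setT c.
    have m1 : measurable_fun setT (fun p : (measurableTypeR R * measurableTypeR R) * 'rV[R]_n =>
        (p.1.1, rvcons p.1.2 p.2)).
      apply: measurable_fun_pair.
        exact: (measurableT_comp measurable_fst measurable_fst).
      have m2 : measurable_fun setT (fun p : (measurableTypeR R * measurableTypeR R) * 'rV[R]_n =>
        (p.1.2, p.2)).
        apply: measurable_fun_pair; last exact: measurable_snd.
        exact: (measurableT_comp measurable_snd measurable_fst).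
      exact: (measurableT_comp (@measurable_rvcons R n) m2).
    exact: (measurableT_comp (@measurable_rvcons R n.+1) m1).
  have mB : measurable (c @^-1` A).
    by rewrite -[X in measurable X]setTI; exact: mc.
  have := measurable_fun_xsection (@leb R n) mB.
  congr measurable_fun; apply/funext => p /=; congr leb.
  by apply/seteqP; split => y; rewrite /xsection /= inE.
have := @fubini_tonelli _ _ _ _ R mu mu f mf (fun p => measure_ge0 _ _) => /= E.
transitivity (\int[mu]_s \int[mu]_t f (t, s))%E; last exact: esym E.
rewrite lebS; apply: eq_integral => s _; rewrite lebS.
apply: eq_integral => t _; congr leb.
have e1 : lift 0 0 = 1 :> 'I_n.+2 by exact: ord_inj.
have r1 u (z : 'rV[R]_n.+1) : rvcons u z 0 1 = z 0 0 by rewrite -e1 rvconsS.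
have tE (y : 'rV[R]_n) : rvcons s (rvcons t y) *m tperm_mx 0 1 = rvcons t (rvcons s y).
  rewrite -xcolE; apply/rowP => i; rewrite mxE.
  case: (unliftP 0 i) => [j ->|->]; last by rewrite tpermL r1 !rvcons0.
  case: (unliftP 0 j) => [k ->|->].
    by rewrite tpermD ?rvconsS // -e1 (inj_eq lift_inj).
  by rewrite e1 tpermR rvcons0 r1 rvcons0.
by apply/seteqP; split => y; rewrite /= /f /= tE.
Qed.

Lemma leb_scales1 n : leb_scales (1%:M : 'M[R]_n).
Proof.
by move=> A mA; rewrite det1 normr1 invr1 mul1e; under eq_set do rewrite mulmx1.
Qed.

(** Every invertible matrix is a product of block triangular matrices with a
    smaller invertible block, covered by leb_scales_block and induction, and
    of swaps of the first two coordinates. *)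
Lemma leb_scales_unit n (M : 'M[R]_n) : M \in unitmx -> leb_scales M.
Proof.
elim: n M => [|n IH] M uM.
  suff -> : M = 1%:M by exact: leb_scales1.
  by apply/matrixP => -[].
(* A first column supported on its first entry: the matrix is block
   triangular. *)
have block (N : 'M[R]_n.+1) : N \in unitmx -> (forall i, N (lift 0 i) 0 = 0) ->
    leb_scales N.
  move=> uN N0.
  have NE : N = block_mx (N 0 0)%:M (\row_j N 0 (lift 0 j)) 0
    (\matrix_(i, j) N (lift 0 i) (lift 0 j)) :> 'M[R]_(1 + n).
    have -> : (N 0 0)%:M = ulsubmx (N : 'M[R]_(1 + n)).
      by apply/matrixP => i j; rewrite !ord1 !mxE eqxx mulr1n; congr (N _ _); exact: val_inj.
    have -> : \row_j N 0 (lift 0 j) = ursubmx (N : 'M[R]_(1 + n)).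
      by apply/matrixP => i j; rewrite !ord1 !mxE; congr (N _ _); exact: val_inj.
    have -> : \matrix_(i, j) N (lift 0 i) (lift 0 j) = drsubmx (N : 'M[R]_(1 + n)).
      by apply/matrixP => i j; rewrite !mxE; congr (N _ _); exact: val_inj.
    have -> : 0 = dlsubmx (N : 'M[R]_(1 + n)).
      apply/matrixP => i j; rewrite !ord1 !mxE -(N0 i); congr (N _ _); exact: val_inj.
    by rewrite submxK.
  pose N' : 'M[R]_n := \matrix_(i, j) N (lift 0 i) (lift 0 j); rewrite -/N' in NE.
  have dN : \det N = N 0 0 * \det N'.
    rewrite {1}NE; have := det_ublock (N 0 0)%:M (\row_j N 0 (lift 0 j)) N'.
    by rewrite det_scalar1.
  move: uN; rewrite unitmxE dN unitrM => /andP[u1 u2].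
  rewrite NE; apply: leb_scales_block; first by rewrite -unitfE.
  by apply: IH; rewrite unitmxE.
have [u0|] := eqVneq (\col_i M (lift 0 i) 0) 0.
  by apply: block => // i; have /colP/(_ i) := u0; rewrite !mxE.
case: n => [|n] in M IH uM block *; first by rewrite flatmx0 eqxx.
(* The lower part u of the first column is not 0, so it is B *m (c *: delta_mx
   0 0) with B invertible. G undoes B, N clears the first entry a, and S moves
   the pivot c to the first row: this reduces M to the block triangular L. *)
set u : 'cV[R]_n.+1 := \col_i _ => u0; set a := M 0 0.
have rk1 : \rank u = 1%N.
  by apply/eqP; rewrite eqn_leq rank_leq_col lt0n mxrank_eq0.
set B := col_ebase u; have uB : B \in unitmx by exact: col_ebase_unit.
set c := row_ebase u 0 0.
have c0 : c != 0.
  by have := row_ebase_unit u; rewrite unitmxE [row_ebase u]mx11_scalar det_scalar1 unitfE.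
have uE : u = B *m (c *: delta_mx 0 0).
  rewrite -[LHS]mulmx_ebase rk1 -/B -mulmxA; congr (_ *m _).
  rewrite [row_ebase u]mx11_scalar -/c mul_mx_scalar; congr (_ *: _).
  by apply/matrixP => i j; rewrite (ord1 j) !mxE eqxx andbT; case: i => -[|i] hi.
pose G : 'M[R]_n.+2 := @block_mx R 1 n.+1 1 n.+1 1%:M 0 0 B.
pose N : 'M[R]_n.+2 := @block_mx R 1 n.+1 1 n.+1 1%:M ((a / c) *: delta_mx 0 0) 0 1%:M.
pose S : 'M[R]_n.+2 := tperm_mx 0 1.
have uG : G \in unitmx by rewrite unitmxE (@det_ublock _ 1) det1 mul1r -unitmxE.
have uN : N \in unitmx by rewrite unitmxE (@det_ublock _ 1) !det1 mul1r unitr1.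
have SS : S *m S = 1%:M by rewrite -perm_mxM tperm2 perm_mx1.
have uS : S \in unitmx by case: (mulmx1_unit SS).
pose L := S *m invmx N *m invmx G *m M.
have -> : M = G *m N *m S *m L.
  by rewrite /L !mulmxA -(mulmxA _ S S) SS mulmx1 -(mulmxA _ N) mulmxV// mulmx1 mulmxV// mul1mx.
have sG : leb_scales G by apply: leb_scales_block; rewrite ?oner_neq0//; exact: IH.
have sN : leb_scales N.
  by apply: leb_scales_block; rewrite ?oner_neq0//; exact: leb_scales1.
apply: leb_scales_mul; first by apply: leb_scales_mul; [exact: leb_scales_mul sG sN|exact: leb_scales_swap].
apply: block; first by rewrite /L !unitmx_mul uS !unitmx_inv uN uG uM.
pose w2 : 'cV[R]_n.+2 := c *: delta_mx 0 0.
pose w1 : 'cV[R]_n.+2 := @col_mx _ 1 n.+1 1 0 (c *: delta_mx 0 0).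
pose w0 : 'cV[R]_n.+2 := @col_mx _ 1 n.+1 1 a%:M (c *: delta_mx 0 0).
have cm0 (x : 'cV[R]_1) (y : 'cV[R]_n.+1) :
    (@col_mx R 1 n.+1 1 x y : 'cV[R]_n.+2) 0 0 = x 0 0.
  by rewrite -(col_mxEu x y); congr (col_mx _ _ _ _); exact: ord_inj.
have cmS (x : 'cV[R]_1) (y : 'cV[R]_n.+1) i :
    (@col_mx R 1 n.+1 1 x y : 'cV[R]_n.+2) (lift 0 i) 0 = y i 0.
  by rewrite -(col_mxEd x y); congr (col_mx _ _ _ _); exact: ord_inj.
have e1 : lift 0 0 = 1 :> 'I_n.+2 by exact: ord_inj.
have Sw2 : S *m w2 = w1.
  rewrite -xrowE; apply/colP => i; rewrite mxE.
  case: (unliftP 0 i) => [j ->|->]; last by rewrite tpermL cm0 !mxE mulr0.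
  rewrite cmS; case: (unliftP 0 j) => [k ->|->].
    by rewrite tpermD ?mxE ?mulr0 // -e1 (inj_eq lift_inj).
  by rewrite e1 tpermR !mxE.
have Nw1 : N *m w1 = w0.
  rewrite (@mul_block_col _ 1 n.+1 1 n.+1) /w0; congr (@col_mx R 1 n.+1 1 _ _).
    rewrite mulmx0 add0r -scalemxAl -scalemxAr mul_delta_mx scalerA divfK//.
    by apply/matrixP => i j; rewrite !ord1 !mxE !eqxx mulr1 mulr1n.
  by rewrite mul0mx add0r mul1mx.
have Gw0 : G *m w0 = col 0 M.
  rewrite (@mul_block_col _ 1 n.+1 1 n.+1) mul1mx mul0mx addr0 mul0mx add0r -uE.
  apply/colP => i; case: (unliftP 0 i) => [j ->|->]; first by rewrite cmS !mxE.
  by rewrite cm0 !mxE eqxx mulr1n.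
move=> i; have -> : L (lift 0 i) 0 = col 0 L (lift 0 i) 0 by rewrite [RHS]mxE.
have -> : col 0 L = w2.
  rewrite colE /L -mulmxA -colE -Gw0 -Nw1 -Sw2 -!mulmxA.
  by rewrite mulKmx // mulKmx // mulmxA SS mul1mx.
by rewrite !mxE mulr0.
Qed.

End LebUnitmx.

(** * Parallelepipeds and quotient measures *)

Section Paral.
Variable R : realType.
Local Notation mu := (@lebesgue_measure R).

Lemma measurable_box n (I : 'I_n -> set R) : (forall i, measurable (I i)) ->
  measurable [set y : 'rV[R]_n | forall i, I i (y 0 i)].
Proof.
move=> mI; rewrite (_ : [set y | _] =
    \bigcap_(i in [set: 'I_n]) ((fun y : 'rV[R]_n => y 0 i) @^-1` I i)).
  apply: fin_bigcap_measurable => // i _.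
  by rewrite -[X in measurable X]setTI; apply: measurable_coord.
by apply/seteqP; split => y /= h i; [move=> _; exact: h|exact: h].
Qed.

Definition cube n : set 'rV[R]_n := [set y | forall i, 0 <= y 0 i <= 1].

Lemma measurable_cube n : measurable (@cube n).
Proof.
rewrite (_ : @cube n = [set y : 'rV[R]_n | forall i, `[0, 1]%classic (y 0 i)]).
  by apply: (@measurable_box n (fun=> `[0, 1]%classic)) => i; exact: measurable_itv.
by apply/seteqP; split => y h i; have := h i; rewrite /= in_itv.
Qed.

Lemma rvcons_forall n (P : R -> Prop) t (y : 'rV[R]_n) :
  (forall i, P (rvcons t y 0 i)) <-> P t /\ forall i, P (y 0 i).
Proof.
split=> [h|[Pt Py] i].
  by split=> [|i]; [have := h 0; rewrite rvcons0|have := h (lift 0 i); rewrite rvconsS].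
by case: (unliftP 0 i) => [j ->|->]; rewrite ?rvcons0 ?rvconsS.
Qed.

Lemma integral_unit_itv (k : \bar R) :
  (0 <= k)%E -> (\int[mu]_(t in `[0%R, 1%R]%classic) k = k)%E.
Proof.
move=> k0; rewrite integral_cst //= lebesgue_measure_itv /= lte_fin ltr01.
by rewrite oppr0 addr0 mule1.
Qed.

(** Evaluates parallelepipeds one direction at a time. *)
Lemma leb_unit_fibred n (A : set 'rV[R]_n.+1) (k : \bar R) : (0 <= k)%E ->
  (forall t, 0 <= t <= 1 -> leb [set y | A (rvcons t y)] = k) ->
  (forall t, ~~ (0 <= t <= 1) -> forall y, ~ A (rvcons t y)) ->
  leb A = k.
Proof.
move=> k0 h1 h2; rewrite lebS -[RHS]integral_unit_itv// [RHS]integral_mkcond.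
apply: eq_integral => t _; rewrite patchE; case: ifPn => [|].
  by rewrite inE /= in_itv /= => /h1.
rewrite notin_setE /= in_itv /= => /negP /h2 nA.
by rewrite (_ : [set y | _] = set0) ?measure0 //; apply/seteqP; split => y // /nA.
Qed.

Lemma leb_cube n : leb (@cube n) = 1%E.
Proof.
elim: n => [|n IH].
  by rewrite /leb /= indicE mem_set// => -[].
apply: leb_unit_fibred => // t ht.
  rewrite -IH; congr leb; apply/seteqP; split => y /=.
    by move=> /(rvcons_forall (fun x => 0 <= x <= 1))[].
  by move=> h; apply/(rvcons_forall (fun x => 0 <= x <= 1)).
by move=> y /(rvcons_forall (fun x => 0 <= x <= 1))[]; rewrite (negbTE ht).
Qed.

Definition paralmx m n (M : 'M[R]_(m, n)) : set 'rV[R]_n :=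
  [set y *m M | y in @cube m].

Lemma paralmx_unitE n (M : 'M[R]_n) : M \in unitmx ->
  paralmx M = [set y | @cube n (y *m invmx M)].
Proof.
move=> uM; apply/seteqP; split => [_ [y hy <-]|y hy] /=; first by rewrite mulmxK.
by exists (y *m invmx M) => //; rewrite mulmxKV.
Qed.

Lemma measurable_paralmx n (M : 'M[R]_n) : M \in unitmx -> measurable (paralmx M).
Proof.
move=> uM; rewrite paralmx_unitE //.
exact: (measurable_preimage_mulmx (invmx M) (@measurable_cube n)).
Qed.

Lemma leb_paralmx n (M : 'M[R]_n) : M \in unitmx -> leb (paralmx M) = `|\det M|%:E.
Proof.
move=> uM; rewrite paralmx_unitE // leb_scales_unit ?unitmx_inv//; last exact: measurable_cube.
by rewrite leb_cube mule1 det_inv normfV invrK.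
Qed.

Lemma leb_paralmx_mul m n (L : 'M[R]_m) (M : 'M[R]_(m, n)) : m = n ->
  row_free M -> L \in unitmx ->
  leb (paralmx (L *m M)) = (`|\det L|%:E * leb (paralmx M))%E.
Proof.
move=> mn; case: _ / mn in M * => fM uL; rewrite row_free_unit in fM.
by rewrite !leb_paralmx ?unitmx_mul ?uL // det_mulmx normrM EFinM.
Qed.

Lemma leb_paralmx_fin m n (M : 'M[R]_(m, n)) : m = n -> row_free M ->
  exists2 k : R, 0 < k & leb (paralmx M) = k%:E.
Proof.
move=> mn; case: _ / mn in M * => fM; rewrite row_free_unit in fM.
exists `|\det M|; last exact: leb_paralmx.
by rewrite normr_gt0 -unitfE -unitmxE.
Qed.

Lemma measurable_paralmx_free m n (M : 'M[R]_(m, n)) : m = n -> row_free M ->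
  measurable (paralmx M).
Proof.
by move=> mn; case: _ / mn in M * => fM; apply: measurable_paralmx; rewrite -row_free_unit.
Qed.

End Paral.

Section Quotient.
Variables (R : realType) (N : nat) (wT : vectType R) (f : 'Hom('rV[R]_N, wT)).

(** K is a basis of the kernel of f and S lifts a basis of its image. They are
    matrices, so that changes of bases are matrix products. *)
Definition adapted d e (K : 'M[R]_(d, N)) (S : 'M[R]_(e, N)) :=
  [/\ row_free K, (forall x : 'rV_N, (x <= K)%MS = (f x == 0)),
    (forall x, exists z : 'rV_e, f x = f (z *m S)) &
    (forall z : 'rV_e, f (z *m S) = 0 -> z = 0)].

Lemma adapted_row_free d e (K : 'M[R]_(d, N)) (S : 'M[R]_(e, N)) :
  adapted K S -> row_free (col_mx K S).
Proof.
move=> [fK kerK _ injS]; apply: inj_row_free => v.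
rewrite -(hsubmxK v) mul_row_col => e0.
have r0 : rsubmx v = 0.
  apply: injS; have : f (lsubmx v *m K + rsubmx v *m S) = 0 by rewrite e0 linear0.
  rewrite linearD /= [f (_ *m K)](_ : _ = 0) ?add0r//.
  by apply/eqP; rewrite -kerK submxMl.
rewrite r0; move: e0; rewrite r0 mul0mx addr0 -(mul0mx _ K) => /(row_free_inj fK) ->.
by rewrite row_mx0.
Qed.

Lemma adapted_dim d e (K : 'M[R]_(d, N)) (S : 'M[R]_(e, N)) : adapted K S -> (d + e = N)%N.
Proof.
move=> a; have := adapted_row_free a => /eqP rk.
apply/eqP; rewrite eqn_leq -{1}rk rank_leq_col /=.
have [fK kerK spanS injS] := a.
have /mxrankS : (1%:M <= col_mx K S)%MS; last by rewrite mxrank1 rk.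
apply/row_subP => i; set x := row i _; have [z fz] := spanS x.
have /submxP[y xy] : (x - z *m S <= K)%MS by rewrite kerK linearB /= fz subrr.
by apply/submxP; exists (row_mx y z); rewrite mul_row_col -xy subrK.
Qed.

Lemma adapted_change d e (K K' : 'M[R]_(d, N)) (S S' : 'M[R]_(e, N)) :
  adapted K S -> adapted K' S' ->
  exists M1 M2 M3, [/\ M1 \in unitmx, M2 \in unitmx, K' = M1 *m K &
    S' = M3 *m K + M2 *m S].
Proof.
move=> [fK kerK spanS injS] [fK' kerK' spanS' injS'].
have /submxP[M1 K'E] : (K' <= K)%MS.
  by apply/row_subP => i; rewrite kerK -kerK' row_sub.
have /boolp.choice[z zE] : forall i : 'I_e, exists z, f (row i S') = f (z *m S) by move=> i; exact: spanS.
pose M2 := \matrix_i z i.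
have /submxP[M3 M3E] : (S' - M2 *m S <= K)%MS.
  by apply/row_subP => i; rewrite kerK !linearB /= row_mul rowK zE subrr.
exists M1, M2, M3; split => //; last by rewrite -M3E subrK.
  rewrite -row_free_unit; apply: inj_row_free => v v0.
  by apply: (row_free_inj fK'); rewrite /= K'E mulmxA v0 !mul0mx.
rewrite -row_free_unit; apply: inj_row_free => v v0.
apply: injS'; rewrite -(subrK (M2 *m S) S') M3E mulmxDr [v *m (M2 *m S)]mulmxA v0 mul0mx addr0.
by apply/eqP; rewrite -kerK mulmxA submxMl.
Qed.

Lemma adapted_dimK d d' e e' (K : 'M[R]_(d, N)) (K' : 'M[R]_(d', N))
    (S : 'M[R]_(e, N)) (S' : 'M[R]_(e', N)) :
  adapted K S -> adapted K' S' -> (d = d' /\ e = e')%N.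
Proof.
move=> a a'; have := adapted_dim a; have := adapted_dim a'.
have [fK kerK _ _] := a; have [fK' kerK' _ _] := a'.
have dd : d = d'.
  rewrite -(eqP fK) -(eqP fK'); apply/eqP; rewrite eqn_leq; apply/andP; split; apply: mxrankS.
    by apply/row_subP => i; rewrite kerK' -kerK row_sub.
  by apply/row_subP => i; rewrite kerK -kerK' row_sub.
rewrite dd => <- /eqP; rewrite eqn_add2l => /eqP ->; by [].
Qed.

Lemma image_paralmx_mod d e (K : 'M[R]_(d, N)) (S S' : 'M[R]_(e, N)) (M3 : 'M[R]_(e, d)) :
  adapted K S -> f @` paralmx (M3 *m K + S') = f @` paralmx S'.
Proof.
move=> [_ kerK _ _].
have E y : f (y *m (M3 *m K + S')) = f (y *m S').
  rewrite mulmxDr linearD /= [f (_ *m (_ *m _))](_ : _ = 0) ?add0r//.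
  by apply/eqP; rewrite -kerK mulmxA submxMl.
apply/seteqP; split => _ [_ [y hy <-] <-].
  by rewrite E; exists (y *m S') => //; exists y.
by rewrite -E; exists (y *m (M3 *m K + S')) => //; exists y.
Qed.

(** What makes nu a Lebesgue measure on the image of f, as far as quotients by
    nu are concerned: parallelepipeds have positive volume, and scale by
    determinants. They are given by lifts, since nu lives on the whole of wT.
    *)
Definition image_scales (nu : set wT -> \bar R) :=
  forall d e (K : 'M[R]_(d, N)) (S : 'M[R]_(e, N)) (L : 'M[R]_e),
  adapted K S -> L \in unitmx ->
  0 < fine (nu (f @` paralmx S)) /\
  fine (nu (f @` paralmx (L *m S))) = `|\det L| * fine (nu (f @` paralmx S)).

(** The factor by which the quotient measure leb / nu rescales leb in the
    coordinates given by K. *)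
Definition quot_of d e (nu : set wT -> \bar R) (K : 'M[R]_(d, N)) (S : 'M[R]_(e, N)) : R :=
  fine (leb (paralmx (col_mx K S))) / fine (nu (f @` paralmx S)).

(** The change of bases is block triangular. The determinant of its block on
    the kernel cancels against the scaling of leb in the coordinates of the
    kernel, and that of its block on the image cancels against the scaling of
    nu. *)
Lemma quot_of_change d e d' e' nu (K : 'M[R]_(d, N)) (K' : 'M[R]_(d', N))
   (S : 'M[R]_(e, N)) (S' : 'M[R]_(e', N)) A :
  image_scales nu -> adapted K S -> adapted K' S' ->
  measurable [set y : 'rV_d | A (y *m K)] ->
  ((quot_of nu K S)%:E * leb [set y : 'rV_d | A (y *m K)] =
   (quot_of nu K' S')%:E * leb [set y : 'rV_d' | A (y *m K')])%E.
Proof.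
move=> hnu a a' mA; have [dd ee] := adapted_dimK a a'.
case: _ / dd in K' a' *; case: _ / ee in S' a' *.
have [M1 [M2 [M3 [u1 u2 K'E S'E]]]] := adapted_change a a'.
have dN := adapted_dim a; have fKS := adapted_row_free a.
have E : col_mx K' S' = block_mx M1 0 M3 M2 *m col_mx K S.
  by rewrite mul_block_col mul0mx addr0 -K'E -S'E.
rewrite /quot_of E leb_paralmx_mul //; last first.
  by rewrite unitmxE det_lblock unitrM -!unitmxE u1 u2.
have [k k0 ->] := leb_paralmx_fin dN fKS; rewrite -EFinM /= det_lblock.
rewrite S'E (image_paralmx_mod _ _ a).
have [n0 ->] := hnu _ _ _ _ _ a u2.
have -> : [set y : 'rV_d | A (y *m K')] = [set y | [set z | A (z *m K)] (y *m M1)].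
  by apply/seteqP; split => y /=; rewrite K'E mulmxA.
rewrite leb_scales_unit // muleA -EFinM; congr (_%:E * _)%E.
have d1 : `|\det M1| != 0 by rewrite normr_eq0 -unitfE -unitmxE.
have d2 : `|\det M2| != 0 by rewrite normr_eq0 -unitfE -unitmxE.
by rewrite normrM; field; rewrite d1 d2 gt_eqF.
Qed.

End Quotient.

Section Seqmx.
Variable R : realType.

Definition seqmx m n (X : seq 'rV[R]_n) : 'M[R]_(m, n) := \matrix_(i < m) X`_i.

Lemma mul_seqmx m n (X : seq 'rV[R]_n) (y : 'rV[R]_m) :
  y *m seqmx m X = \sum_(i < m) y 0 i *: X`_i.
Proof. by rewrite mulmx_sum_row; apply: eq_bigr => i _; rewrite rowK. Qed.

Lemma comb_seqmx n (X : seq 'rV[R]_n) y : comb y = y *m seqmx (size X) X.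
Proof. by rewrite mul_seqmx. Qed.

Lemma paralE (vT : vectType R) m (X : seq vT) : size X = m ->
  paral X = [set \sum_(i < m) y 0 i *: X`_i | y in @cube R m].
Proof. by move=> <-. Qed.

Lemma paral_seqmx m n (X : seq 'rV[R]_n) : size X = m -> paral X = paralmx (seqmx m X).
Proof.
move=> /paralE ->; rewrite /paralmx; congr image; apply/funext => y.
by rewrite mul_seqmx.
Qed.

Lemma leb_basis_seqmx m n (X : seq 'rV[R]_n) A : size X = m ->
  leb_basis X A = leb [set y : 'rV[R]_m | A (y *m seqmx m X)].
Proof.
move=> <-; rewrite /leb_basis; congr leb.
by apply/seteqP; split => y /=; rewrite comb_seqmx.
Qed.

Lemma seqmx_cat d e n (X Y : seq 'rV[R]_n) : size X = d ->
  seqmx (d + e) (X ++ Y) = col_mx (seqmx d X) (seqmx e Y).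
Proof.
move=> sX; apply/row_matrixP => i; rewrite rowK -(splitK i).
case: (fintype.split i) => j /=.
  by rewrite rowKu rowK nth_cat sX ltn_ord.
by rewrite rowKd rowK nth_cat sX ltnNge leq_addr /= addKn.
Qed.

Variables (N : nat) (wT : vectType R) (f : 'Hom('rV[R]_N, wT)).
Let d := \dim (lker f).
Let e := \dim (limg f).

Lemma map_seqmx (S : seq 'rV[R]_N) m (y : 'rV[R]_m) : (m <= size S)%N ->
  f (y *m seqmx m S) = \sum_(i < m) y 0 i *: (map f S)`_i.
Proof.
move=> sS; rewrite mul_seqmx linear_sum; apply: eq_bigr => i _.
by rewrite linearZ (nth_map 0) // (leq_trans _ sS).
Qed.

Lemma paral_map (S : seq 'rV[R]_N) m : size S = m ->
  paral (map f S) = f @` paralmx (seqmx m S).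
Proof.
move=> sS; rewrite (@paralE _ m) ?size_map//.
apply/seteqP; split => [_ [y hy <-]|_ [_ [y hy <-] <-]].
  by exists (y *m seqmx m S); [exists y|rewrite map_seqmx // sS].
by exists y => //; rewrite map_seqmx ?sS.
Qed.

Lemma tuple_freeP (vT : vectType R) m (X : m.-tuple vT) (z : 'rV[R]_m) : free X ->
  \sum_(i < m) z 0 i *: X`_i = 0 -> z = 0.
Proof. by move/freeP => h /h z0; apply/rowP => i; rewrite mxE z0. Qed.

Lemma map_inv_vbasis : map f (map (f^-1)%VF (vbasis (limg f))) = vbasis (limg f).
Proof.
rewrite -map_comp map_id_in // => x /vbasis_mem xf /=; exact: limg_lfunVK.
Qed.

(** These are the bases used by quot_measure. *)
Lemma canonical_adapted :
  adapted f (seqmx d (vbasis (lker f))) (seqmx e (map (f^-1)%VF (vbasis (limg f)))).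
Proof.
have sS : size (map (f^-1)%VF (vbasis (limg f))) = e by rewrite size_map size_tuple.
split.
- apply: inj_row_free => v; rewrite mul_seqmx; apply: tuple_freeP.
  exact: basis_free (vbasisP _).
- move=> x; apply/idP/idP => [/submxP[y ->]|].
    rewrite -memv_ker mul_seqmx; apply: memv_suml => i _; apply: memvZ.
    by apply: vbasis_mem; rewrite mem_nth // size_tuple.
  rewrite -memv_ker => /coord_vbasis {1}->; apply/submxP.
  exists (\row_i coord (vbasis (lker f)) i x); rewrite mul_seqmx.
  by apply: eq_bigr => i _; rewrite mxE.
- move=> x; exists (\row_i coord (vbasis (limg f)) i (f x)).
  rewrite map_seqmx ?sS// map_inv_vbasis [LHS](coord_vbasis (memv_img _ (memvf x))).
  by apply: eq_bigr => i _; rewrite mxE.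
- move=> z; rewrite map_seqmx ?sS// map_inv_vbasis; apply: tuple_freeP.
  exact: basis_free (vbasisP _).
Qed.

Lemma exists_adapted : exists d e (K : 'M[R]_(d, N)) (S : 'M[R]_(e, N)), adapted f K S.
Proof. by exists d, e; do 2 eexists; exact: canonical_adapted. Qed.

Lemma quot_measureE (c : R) (mu : set 'rV[R]_N -> \bar R) nu d' e'
    (K : 'M[R]_(d', N)) (S : 'M[R]_(e', N)) A :
  (forall B, mu B = (c%:E * leb B)%E) ->
  image_scales f nu -> adapted f K S -> measurable [set y : 'rV_d' | A (y *m K)] ->
  quot_measure f mu nu A =
    ((c * quot_of f nu K S)%:E * leb [set y : 'rV_d' | A (y *m K)])%E.
Proof.
move=> muE hnu a mA; have ca := canonical_adapted.
have sK : size (vbasis (lker f)) = d by rewrite size_tuple.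
have sS : size (map (f^-1)%VF (vbasis (limg f))) = e by rewrite size_map size_tuple.
rewrite EFinM -muleA (quot_of_change hnu a ca mA) muleA -EFinM.
rewrite /quot_measure (leb_basis_seqmx _ sK); congr (_%:E * _)%E.
rewrite -{2}map_inv_vbasis (paral_map sS) /quot_of mulrA; congr (_ / _).
rewrite (@paral_seqmx (d + e)) ?size_cat ?sK ?sS//.
rewrite seqmx_cat // muE.
have [k k0 ->] := leb_paralmx_fin (adapted_dim ca) (adapted_row_free ca).
by rewrite -EFinM.
Qed.

End Seqmx.

Section FibreVolume.
Variables (R : realType) (N : nat) (wT : vectType R) (f : 'Hom('rV[R]_N, wT)).

(** The polytopes cut by boxes, whose volumes are compared below, are of this
    form with f the linear combination map; A is the cut orthant. *)
Definition fibre_vol (nu : set wT -> \bar R) a (A : set 'rV[R]_N) :=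
  quot_measure f (@leb R N) nu [set k | A (f^-1%VF a + k)].

(** The chosen point of the fibre may be replaced by any other one, by
    translation invariance. *)
Lemma fibre_volE nu a (A : set 'rV[R]_N) d e (K : 'M[R]_(d, N)) (S : 'M[R]_(e, N)) x0 :
  image_scales f nu -> adapted f K S -> measurable A -> f x0 = a ->
  fibre_vol nu a A =
    ((quot_of f nu K S)%:E * leb [set y : 'rV_d | A (x0 + y *m K)%R])%E.
Proof.
move=> hnu ad mA <-; rewrite /fibre_vol.
rewrite (@quot_measureE _ _ _ _ 1 (@leb R N) nu _ _ K S) //; last 2 first.
- by move=> B; rewrite mul1e.
- exact: (measurable_preimage_affine K (f^-1%VF (f x0)) mA).
rewrite mul1r; congr (_ * _)%E.
set x1 := _^-1%VF _; have : (x1 - x0 <= K)%MS.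
  have [_ -> _ _] := ad; rewrite linearB /= limg_lfunVK ?subrr//.
  by rewrite memv_img // memvf.
move=> /submxP[y0 y0E]; rewrite -(leb_translate (- y0)); last first.
  exact: (measurable_preimage_affine K x1 mA).
congr leb; apply/seteqP; split => y /=; rewrite mulmxBl -y0E opprB addrCA;
by rewrite [x1 + _]addrC subrK addrC.
Qed.

End FibreVolume.

Section CombVolume.
Variables (R : realType) (r : nat).

Lemma comb_linear (X : seq 'rV[R]_r) : linear (@comb R 'rV[R]_r X).
Proof. by move=> k x y; rewrite !comb_seqmx mulmxDl scalemxAl. Qed.

Definition combf (X : seq 'rV[R]_r) : 'Hom('rV[R]_(size X), 'rV[R]_r) :=
  linfun (@comb R 'rV[R]_r X).

Lemma combfE (X : seq 'rV[R]_r) x : combf X x = x *m seqmx (size X) X.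
Proof.
pose cl := GRing.isLinear.Build _ _ _ _ (@comb R 'rV[R]_r X) (@comb_linear X).
pose g : {linear 'rV[R]_(size X) -> 'rV[R]_r} := HB.pack (@comb R 'rV[R]_r X) cl.
by rewrite /combf (lfunE g) /= comb_seqmx.
Qed.

Definition fvol (X : seq 'rV[R]_r) (nu : set 'rV[R]_r -> \bar R) a (A : set 'rV[R]_(size X)) :=
  fibre_vol (combf X) nu a A.

Lemma fvolE X nu a (A : set 'rV[R]_(size X)) d e (K : 'M[R]_(d, size X))
    (S : 'M[R]_(e, size X)) x0 :
  image_scales (combf X) nu -> adapted (combf X) K S -> measurable A ->
  combf X x0 = a ->
  fvol nu a A = ((quot_of (combf X) nu K S)%:E * leb [set y : 'rV_d | A (x0 + y *m K)%R])%E.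
Proof. exact: fibre_volE. Qed.

End CombVolume.

(** * Removing a vector from the family *)

Section Pairing.
Variables (R : realType) (r : nat).
Implicit Types (a b : 'rV[R]_r) (E x : 'cV[R]_r).

Lemma pairingD a b E : pairing (a + b) E = pairing a E + pairing b E.
Proof. by rewrite /pairing mulmxDl mxE. Qed.

Lemma pairingZ k a E : pairing (k *: a) E = k * pairing a E.
Proof. by rewrite /pairing -scalemxAl mxE. Qed.

Lemma pairing0 E : pairing 0 E = 0.
Proof. by rewrite /pairing mul0mx mxE. Qed.

Lemma pairingN a E : pairing (- a) E = - pairing a E.
Proof. by rewrite -scaleN1r pairingZ mulN1r. Qed.

Lemma pairingB a b E : pairing (a - b) E = pairing a E - pairing b E.
Proof. by rewrite pairingD pairingN. Qed.

Definition pairf E : 'Hom('rV[R]_r, R^o) :=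
  linfun ((fun a => pairing a E) : 'rV[R]_r -> R^o).

Lemma pairfE E a : pairf E a = pairing a E.
Proof.
have pl : linear ((fun a => pairing a E) : 'rV[R]_r -> R^o).
  by move=> k x y; rewrite pairingD pairingZ.
pose cl := GRing.isLinear.Build _ _ _ _ ((fun a => pairing a E) : 'rV[R]_r -> R^o) pl.
pose g : {linear 'rV[R]_r -> R^o} :=
  HB.pack ((fun a => pairing a E) : 'rV[R]_r -> R^o) cl.
exact: (lfunE g).
Qed.

End Pairing.

Section ScaleVolumes.
Variables (R : realType) (r : nat).
Local Notation mu := (@lebesgue_measure R).

(** The parallelepiped on s in dimension one is a segment of either
    orientation. *)
Lemma lebesgue_segment (s : R) : s != 0 ->
  mu [set y * s | y in `[0, 1]%classic] = `|s|%:E.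
Proof.
move=> s0.
rewrite (_ : image _ _ = (if 0 < s then `[0, s]%classic else `[s, 0]%classic)); last first.
  have [s_gt0|s_le0] := ltP 0 s.
    apply/seteqP; split => [_ [y + <-]|t] /=; rewrite !in_itv /=.
      by move=> /andP[y0 y1]; rewrite mulr_ge0 ?(ltW s_gt0)//= ler_piMl // ltW.
    move=> /andP[t0 ts]; exists (t / s); last by rewrite divfK.
    by rewrite in_itv /= divr_ge0 ?(ltW s_gt0)//= ler_pdivrMr // mul1r.
  have s_lt0 : s < 0 by rewrite lt_neqAle s0.
  apply/seteqP; split => [_ [y + <-]|t] /=; rewrite !in_itv /=.
    by move=> /andP[y0 y1]; rewrite mulr_ge0_le0// andbT ler_niMl.
  move=> /andP[ts t0]; exists (t / s); last by rewrite divfK.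
  by rewrite in_itv /= ler_ndivrMr // ler_ndivlMr // mul1r mul0r t0 ts.
have [s_gt0|s_lt0|] := ltgtP 0 s; last by move/esym/eqP; rewrite (negbTE s0).
  by rewrite lebesgue_measure_itv /= lte_fin s_gt0 oppr0 adde0 gtr0_norm.
by rewrite lebesgue_measure_itv /= lte_fin s_lt0 add0e ltr0_norm.
Qed.

Lemma adapted_pairf d (B : 'M[R]_(d, r)) (psi : 'rV[R]_r) (E : 'cV[R]_r) :
  row_free B -> (forall x : 'rV_r, (x <= B)%MS = (pairing x E == 0)) ->
  pairing psi E != 0 -> adapted (pairf E) B psi.
Proof.
move=> fB kB e0; split => //.
- by move=> x; rewrite kB pairfE.
- move=> x; exists (pairing x E / pairing psi E)%:M.
  by rewrite !pairfE mul_scalar_mx pairingZ divfK.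
- move=> z; rewrite pairfE [z]mx11_scalar mul_scalar_mx pairingZ => /eqP.
  by rewrite mulf_eq0 (negbTE e0) orbF => /eqP ->; rewrite raddf0.
Qed.

Lemma paralmx_row (s : 'rV[R]_r) : paralmx s = [set t *: s | t in `[0, 1]%classic].
Proof.
apply/seteqP; split => [_ [y hy <-]|_ [t + <-]] /=.
  exists (y 0 0); first by rewrite /= in_itv /=; exact: hy.
  by rewrite -mul_scalar_mx -mx11_scalar.
rewrite /= in_itv /= => ht; exists t%:M; last by rewrite mul_scalar_mx.
by move=> i; rewrite ord1 mxE eqxx mulr1n.
Qed.

Lemma pairf_paralmx_row (s : 'rV[R]_r) E : pairing s E != 0 ->
  mu (pairf E @` paralmx s) = `|pairing s E|%:E.
Proof.
move=> s0; rewrite -lebesgue_segment // paralmx_row; congr mu.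
apply/seteqP; split => [_ [_ [t ht <-] <-]|_ [t ht <-]].
  by exists t => //; rewrite pairfE pairingZ.
by exists (t *: s); [exists t|rewrite pairfE pairingZ].
Qed.

Lemma image_scales_pairf d (B : 'M[R]_(d, r)) (psi : 'rV[R]_r) (E : 'cV[R]_r) :
  adapted (pairf E) B psi -> image_scales (pairf E) mu.
Proof.
move=> ad d' e K S L ad' uL; have [_ e1] := adapted_dimK ad ad'.
case: _ / e1 in S L ad' uL *.
have [_ _ _ injS] := ad'.
have s0 : pairing S E != 0.
  apply/eqP => s0; have := injS 1%:M; rewrite mul1mx pairfE => /(_ s0) /matrixP/(_ 0 0).
  by rewrite !mxE eqxx mulr1n => /eqP; rewrite oner_eq0.
rewrite [L]mx11_scalar det_scalar1 mul_scalar_mx.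
have l0 : L 0 0 != 0 by move: uL; rewrite unitmxE [L]mx11_scalar det_scalar1 unitfE mxE eqxx mulr1n.
rewrite !pairf_paralmx_row ?pairingZ ?mulf_neq0// normrM; split => //=.
by rewrite normr_gt0.
Qed.

Variables (c : R) (da : set 'rV[R]_r -> \bar R).
Hypothesis c_gt0 : 0 < c.
Hypothesis daE : forall A, da A = (c%:E * leb A)%E.

(** This is da = dw dt read on a parallelepiped, with t = <a, E>. *)
Lemma wall_measure_paral d (B : 'M[R]_(d, r)) (psi : 'rV[R]_r) (E : 'cV[R]_r) :
  adapted (pairf E) B psi ->
  fine (wall_measure da E (paralmx B)) =
  fine (da (paralmx (col_mx B psi))) / `|pairing psi E|.
Proof.
move=> ad; have [fB _ _ _] := ad.
have cE : [set y : 'rV_d | paralmx B (y *m B)] = @cube R d.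
  apply/seteqP; split => y /=; last by move=> hy; exists y.
  by move=> [z hz] /(row_free_inj fB) <-.
rewrite /wall_measure (quot_measureE daE (image_scales_pairf ad) ad); last first.
  by rewrite cE; exact: measurable_cube.
rewrite cE leb_cube mule1 /= /quot_of mulrA.
rewrite daE; have [k k0 ->] := leb_paralmx_fin (adapted_dim ad) (adapted_row_free ad).
congr (_ / _); rewrite pairf_paralmx_row //.
have [_ _ _ injS] := ad; apply/eqP => s0; have := injS 1%:M.
rewrite mul1mx pairfE => /(_ s0) /matrixP/(_ 0 0).
by rewrite !mxE eqxx mulr1n => /eqP; rewrite oner_eq0.
Qed.

Section CombImages.
Variable X : seq 'rV[R]_r.
Local Notation F := (seqmx (size X) X).

Lemma image_combf_paralmx e (S : 'M[R]_(e, size X)) :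
  combf X @` paralmx S = paralmx (S *m F).
Proof.
apply/seteqP; split => [_ [_ [y hy <-] <-]|_ [y hy <-]].
  by exists y => //; rewrite combfE mulmxA.
by exists (y *m S); [exists y|rewrite combfE mulmxA].
Qed.

Lemma adapted_image_free d e (K : 'M[R]_(d, size X)) (S : 'M[R]_(e, size X)) :
  adapted (combf X) K S -> row_free (S *m F).
Proof.
move=> [_ _ _ injS]; apply: inj_row_free => v v0; apply: injS.
by rewrite combfE -mulmxA.
Qed.

Lemma combf_spanP a : reflect (exists x, combf X x = a) (a \in <<X>>%VS).
Proof.
apply: (iffP idP) => [aX|[x <-]].
  exists (\row_i coord (in_tuple X) i a).
  rewrite combfE mul_seqmx [RHS](coord_span (X := in_tuple X) aX).
  by apply: eq_bigr => i _; rewrite mxE.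
rewrite combfE mul_seqmx; apply: memv_suml => i _; apply: memvZ.
by apply: memv_span; rewrite mem_nth.
Qed.

(** A lift of a basis of V is mapped to a square matrix, whose determinant
    computes the volume. *)
Lemma image_scales_full : <<X>>%VS = fullv -> image_scales (combf X) da.
Proof.
move=> Xfull d e K S L ad uL.
have fSF := adapted_image_free ad.
have er : e = r.
  apply/eqP; rewrite eqn_leq -{1}(eqP fSF) rank_leq_col /=.
  have /mxrankS : (1%:M <= S *m F)%MS; last by rewrite mxrank1 (eqP fSF).
  apply/row_subP => i; have [_ _ spanS _] := ad.
  have /combf_spanP[x <-] : row i (1%:M : 'M[R]_r) \in <<X>>%VS by rewrite Xfull memvf.
  by have [z ->] := spanS x; rewrite combfE -mulmxA submxMl.
rewrite !image_combf_paralmx -mulmxA !daE leb_paralmx_mul //.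
have [k k0 ->] := leb_paralmx_fin er fSF.
by rewrite -!EFinM /= mulrCA; split => //; rewrite mulr_gt0.
Qed.

Lemma adapted_wall d e (K : 'M[R]_(d, size X)) (S : 'M[R]_(e, size X))
    (E : 'cV[R]_r) (psi : 'rV[R]_r) :
  (forall a, a \in <<X>>%VS <-> pairing a E = 0) -> pairing psi E != 0 ->
  adapted (combf X) K S -> adapted (pairf E) (S *m F) psi.
Proof.
move=> XE e0 ad; apply: adapted_pairf => //; first exact: adapted_image_free ad.
move=> x; apply/idP/eqP => [/submxP[y ->]|/XE/combf_spanP[u <-]].
  by apply/XE/combf_spanP; exists (y *m S); rewrite combfE mulmxA.
by have [_ _ spanS _] := ad; have [z ->] := spanS u; rewrite combfE -mulmxA submxMl.
Qed.

(** By wall_measure_paral the change of basis L on W acts on da as the block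
    diagonal matrix with blocks L and 1. *)
Lemma image_scales_wall (E : 'cV[R]_r) (psi : 'rV[R]_r) :
  (forall a, a \in <<X>>%VS <-> pairing a E = 0) -> pairing psi E != 0 ->
  image_scales (combf X) (wall_measure da E).
Proof.
move=> XE e0 d e K S L ad uL.
have adw := adapted_wall XE e0 ad.
have adL : adapted (pairf E) (L *m (S *m F)) psi.
  have [fB kB _ _] := adw.
  have LB : (L *m (S *m F) :=: S *m F)%MS by apply: eqmxMfull; rewrite row_full_unit.
  apply: adapted_pairf => //; first by rewrite /row_free LB.
  by move=> x; rewrite LB kB pairfE.
rewrite !image_combf_paralmx -mulmxA (wall_measure_paral adw) (wall_measure_paral adL).
have -> : col_mx (L *m (S *m F)) psi =
    block_mx L 0 0 (1%:M : 'M[R]_1) *m col_mx (S *m F) psi.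
  by rewrite mul_block_col !mul0mx mul1mx addr0 add0r.
have dE := adapted_dim adw; have fE := adapted_row_free adw.
rewrite !daE leb_paralmx_mul //; last first.
  by rewrite unitmxE det_ublock det1 mulr1 -unitmxE.
have [k k0 ->] := leb_paralmx_fin dE fE.
rewrite -!EFinM /= det_ublock det1 mulr1; split; last by rewrite mulrCA !mulrA.
by rewrite divr_gt0 ?mulr_gt0 // normr_gt0.
Qed.

End CombImages.

Lemma combf_cons (X : seq 'rV[R]_r) (psi : 'rV[R]_r) t y :
  combf (psi :: X) (rvcons t y) = t *: psi + combf X y.
Proof.
rewrite !combfE !mul_seqmx big_ord_recl rvcons0 /=; congr (_ + _).
by apply: eq_bigr => i _; rewrite rvconsS.
Qed.

Lemma combf_behead (X : seq 'rV[R]_r) (psi : 'rV[R]_r) (x : 'rV[R]_(size X).+1) :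
  combf (psi :: X) x = x 0 0 *: psi + combf X (rvbehead x).
Proof. by rewrite -combf_cons rvcons_behead. Qed.

Lemma cube_row_mx m n (a : 'rV[R]_m) (b : 'rV[R]_n) :
  cube (row_mx a b) <-> cube a /\ cube b.
Proof.
split=> [h|[ha hb] i].
  by split=> i; [have := h (lshift n i)|have := h (rshift m i)]; rewrite ?row_mxEl ?row_mxEr.
by rewrite mxE; case: (fintype.split i).
Qed.

Lemma paralmx_col_mx m m' n (A : 'M[R]_(m, n)) (B : 'M[R]_(m', n)) x :
  paralmx (col_mx A B) x <-> exists2 y, cube y & exists2 z, cube z & x = y *m A + z *m B.
Proof.
split=> [[v hv <-]|[y hy [z hz ->]]].
  move: hv; rewrite -(hsubmxK v) => /cube_row_mx[hy hz].
  by rewrite mul_row_col; exists (lsubmx v) => //; exists (rsubmx v).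
by exists (row_mx y z); [exact/cube_row_mx|rewrite mul_row_col].
Qed.

Definition row0mx m n (A : 'M[R]_(m, n)) : 'M[R]_(m, n.+1) := @row_mx R m 1 n 0 A.

Definition shearmx m n (v : 'rV[R]_n) (A : 'M[R]_(m, n)) : 'M[R]_(m.+1, n.+1) :=
  @block_mx R 1 m 1 n 1%:M v 0 A.

Lemma mul_row0mx m n (A : 'M[R]_(m, n)) y :
  y *m row0mx A = rvcons 0 (y *m A).
Proof.
have := mul_mx_row y (0 : 'M[R]_(m, 1)) A; rewrite mulmx0 => E.
by rewrite /rvcons raddf0; exact: E.
Qed.

Lemma mul_rvcons_shear m n (v : 'rV[R]_n) (A : 'M[R]_(m, n)) t y :
  rvcons t y *m shearmx v A = rvcons t (t *: v + y *m A).
Proof.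
have := mul_row_block (t%:M : 'M[R]_1) y (1%:M : 'M[R]_1) v 0 A.
by rewrite mulmx0 addr0 mulmx1 mul_scalar_mx.
Qed.

Section ConsVolume.
Variables (X : seq 'rV[R]_r) (psi : 'rV[R]_r).

Section ConsInSpan.
Variable sigma : 'rV[R]_(size X).
Hypothesis sigmaE : combf X sigma = psi.

(** The image does not grow, and the kernel gains the relation psi = combf X
    sigma. *)
Lemma adapted_cons_in_span d e (K : 'M[R]_(d, size X)) (S : 'M[R]_(e, size X)) :
  adapted (combf X) K S ->
  adapted (combf (psi :: X)) (shearmx (- sigma) K)
    (row0mx S).
Proof.
move=> [fK kK spanS injS]; split.
- apply: inj_row_free => v; rewrite -(rvcons_behead v) mul_rvcons_shear => v0.
  have t0 : v 0 0 = 0 by have /rowP/(_ 0) := v0; rewrite rvcons0 mxE.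
  have y0 : rvbehead v = 0.
    apply: (row_free_inj fK); rewrite /= mul0mx; apply/rowP => i.
    have /rowP/(_ (lift 0 i)) := v0; rewrite rvconsS t0 scale0r add0r => ->.
    by rewrite !mxE.
  by apply/rowP => i; case: (unliftP 0 i) => [j ->|->]; rewrite t0 y0 ?rvconsS ?rvcons0 !mxE.
- move=> x; rewrite combf_behead -sigmaE -linearZ -linearD /= -kK.
  apply/idP/idP => /submxP[v vE]; last first.
    apply/submxP; exists (rvcons (x 0 0) v); rewrite mul_rvcons_shear -vE.
    by rewrite scalerN addrA addNr add0r rvcons_behead.
  apply/submxP; exists (rvbehead v); rewrite vE.
  rewrite -(rvcons_behead v) mul_rvcons_shear rvcons0 !rvbeheadK.
  by rewrite scalerN addrA addrN add0r.
- move=> x; have [z zE] := spanS (x 0 0 *: sigma + rvbehead x).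
  exists z; rewrite mul_row0mx combf_cons combf_behead scale0r add0r -zE.
  by rewrite linearD linearZ /= sigmaE.
- move=> z; rewrite mul_row0mx combf_cons scale0r add0r; exact: injS.
Qed.

(** The slices of the new parallelepiped are translates, by multiples of
    sigma, of the old one. *)
Lemma quot_of_cons_in_span d e (K : 'M[R]_(d, size X)) (S : 'M[R]_(e, size X)) nu :
  adapted (combf X) K S ->
  quot_of (combf (psi :: X)) nu (shearmx (- sigma) K)
    (row0mx S) = quot_of (combf X) nu K S.
Proof.
move=> ad; congr (fine _ / fine (nu _)); last first.
  apply/seteqP; split => [_ [_ [y hy <-] <-]|_ [_ [y hy <-] <-]].
    by exists (y *m S); [exists y|rewrite mul_row0mx combf_cons scale0r add0r].
  by exists (rvcons 0 (y *m S)); [exists y => //; rewrite mul_row0mx|rewrite combf_cons scale0r add0r].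
have dE := adapted_dim ad; have fE := adapted_row_free ad.
have mP := measurable_paralmx_free dE fE.
have sec t y : paralmx (col_mx (shearmx (- sigma) K)
    (row0mx S)) (rvcons t y) <->
    0 <= t <= 1 /\ paralmx (col_mx K S) (y + t *: sigma).
  split.
    move=> /paralmx_col_mx[u hu [z hz]]; move: hu.
    rewrite -(rvcons_behead u) => /(rvcons_forall (fun x => 0 <= x <= 1))[ht hu].
    rewrite mul_rvcons_shear mul_row0mx rvconsD addr0 => E.
    have tE : t = u 0 0 by have /rowP/(_ 0) := E; rewrite !rvcons0.
    have := congr1 (@rvbehead R _) E; rewrite !rvbeheadK => ->; rewrite tE; split => //.
    apply/paralmx_col_mx; exists (rvbehead u) => //; exists z => //.
    by rewrite scalerN addrC !addrA subrr add0r.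
  move=> [ht /paralmx_col_mx[u hu [z hz E]]]; apply/paralmx_col_mx.
  exists (rvcons t u); first exact/(rvcons_forall (fun x => 0 <= x <= 1)).
  exists z => //; rewrite mul_rvcons_shear mul_row0mx rvconsD addr0.
  by rewrite -addrA -E scalerN addrC addrK.
apply: leb_unit_fibred => //.
  move=> t ht; rewrite -(leb_translate (t *: sigma) mP); congr leb.
  by apply/seteqP; split => y /=; rewrite sec // => -[].
by move=> t ht y; rewrite sec => -[]; rewrite (negbTE ht).
Qed.

End ConsInSpan.

(** Fubini for the coordinate along psi: prescribing it to be t moves the
    fibre over a to the one over a - t psi. *)
Lemma fvol_cons_in_span nu a (A : set 'rV[R]_(size X).+1) :
  psi \in <<X>>%VS -> a \in <<X>>%VS ->
  image_scales (combf X) nu -> image_scales (combf (psi :: X)) nu -> measurable A ->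
  (@fvol R r (psi :: X) nu a A =
   \int[mu]_t @fvol R r X nu (a - t *: psi)%R [set y | A (rvcons t y)])%E.
Proof.
move=> /combf_spanP[sigma sigmaE] /combf_spanP[x0 x0E] hnu hnu' mA.
have [d [e [K [S ad]]]] := exists_adapted (combf X).
have ad' := adapted_cons_in_span sigmaE ad.
rewrite (fvolE (X := psi :: X) (x0 := rvcons 0 x0) hnu' ad' mA); last by rewrite combf_cons scale0r add0r.
rewrite quot_of_cons_in_span // lebS -ge0_integralZl//; last 2 first.
- apply: measurable_leb_section.
  exact: (measurable_preimage_affine (shearmx (- sigma) K) (rvcons 0 x0) mA).
- rewrite lee_fin; apply: divr_ge0; first by rewrite fine_ge0.
  by have [] := hnu _ _ _ _ _ ad (unitmx1 _ _) => /ltW.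
apply: eq_integral => t _.
rewrite (fvolE (X := X) (x0 := x0 - t *: sigma) hnu ad); last 2 first.
- exact: measurable_rvcons_section.
- by rewrite linearB linearZ /= x0E sigmaE.
congr (_ * leb _)%E; apply/seteqP; split => y /=;
  by rewrite mul_rvcons_shear rvconsD add0r scalerN addrA.
Qed.

Section ConsOffWall.
Variable E : 'cV[R]_r.
Hypothesis XE : forall a, a \in <<X>>%VS <-> pairing a E = 0.
Hypothesis e_neq0 : pairing psi E != 0.

Let fE x : pairing (combf X x) E = 0.
Proof. by apply/XE/combf_spanP; exists x. Qed.

Lemma span_cons_full : <<psi :: X>>%VS = fullv.
Proof.
apply/eqP; rewrite eqEsubv subvf; apply/subvP => a _.
have /combf_spanP[x xE] : a - (pairing a E / pairing psi E) *: psi \in <<X>>%VS.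
  by apply/XE; rewrite pairingB pairingZ divfK // subrr.
apply/combf_spanP; exists (rvcons (pairing a E / pairing psi E) x).
by rewrite combf_cons xE addrCA subrr addr0.
Qed.

Definition liftmx e n (S : 'M[R]_(e, n)) : 'M[R]_(e + 1, n.+1) :=
  col_mx (row0mx S) (rvcons 1 0).

Lemma mul_liftmx e n (S : 'M[R]_(e, n)) (z : 'rV[R]_(e + 1)) :
  z *m liftmx S = rvcons (rsubmx z 0 0) (lsubmx z *m S).
Proof.
have zE : rsubmx z *m rvcons 1 0 = rvcons (rsubmx z 0 0) (0 : 'rV[R]_n).
  apply/rowP => i; rewrite mxE big_ord1.
  by case: (unliftP 0 i) => [j ->|->]; rewrite ?rvconsS ?rvcons0 ?mxE ?mulr0 ?mulr1.
by rewrite -{1}(hsubmxK z) mul_row_col mul_row0mx zE rvconsD add0r addr0.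
Qed.

(** The kernel stays the same, and the image gains the line of psi. *)
Lemma adapted_cons_off_wall d e (K : 'M[R]_(d, size X)) (S : 'M[R]_(e, size X)) :
  adapted (combf X) K S ->
  adapted (combf (psi :: X)) (row0mx K) (liftmx S).
Proof.
move=> [fK kK spanS injS].
have f0 t x : combf (psi :: X) (rvcons t x) = 0 -> t = 0 /\ combf X x = 0.
  rewrite combf_cons => h; have /eqP : pairing (t *: psi + combf X x) E = 0.
    by rewrite h pairing0.
  rewrite pairingD pairingZ fE addr0 mulf_eq0 (negbTE e_neq0) orbF => /eqP t0.
  by split=> //; rewrite -h t0 scale0r add0r.
split.
- apply: inj_row_free => v; rewrite mul_row0mx => v0.
  have := congr1 (@rvbehead R _) v0; rewrite rvbeheadK => vK.
  apply: (row_free_inj fK); rewrite /= mul0mx vK.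
  by apply/rowP => i; rewrite !mxE.
- move=> x; apply/idP/eqP => [/submxP[v ->]|].
    rewrite mul_row0mx combf_cons scale0r add0r; apply/eqP.
    by rewrite -kK submxMl.
  rewrite -(rvcons_behead x) => /f0[-> /eqP]; rewrite -kK => /submxP[v ->].
  by apply/submxP; exists v; rewrite mul_row0mx.
- move=> x; have [z zE] := spanS (rvbehead x).
  exists (row_mx z (x 0 0)%:M).
  by rewrite mul_liftmx row_mxKl row_mxKr combf_cons -zE combf_behead mxE eqxx mulr1n.
- move=> z; rewrite mul_liftmx => /f0[z0 /injS z1].
  by rewrite -(hsubmxK z) z1 [rsubmx z]mx11_scalar z0 raddf0 row_mx0.
Qed.

Lemma quot_of_cons_off_wall d e (K : 'M[R]_(d, size X)) (S : 'M[R]_(e, size X)) :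
  adapted (combf X) K S ->
  quot_of (combf (psi :: X)) da (row0mx K) (liftmx S) =
  `|pairing psi E|^-1 * quot_of (combf X) (wall_measure da E) K S.
Proof.
move=> ad; rewrite /quot_of !image_combf_paralmx (wall_measure_paral (adapted_wall XE e_neq0 ad)).
have -> : liftmx S *m seqmx (size (psi :: X)) (psi :: X) = col_mx (S *m seqmx (size X) X) psi.
  rewrite mul_col_mx -[rvcons 1 0 *m _](@combfE R r (psi :: X)) combf_cons scale1r linear0 addr0.
  congr col_mx; apply/row_matrixP => i.
  rewrite !rowE !mulmxA mul_row0mx -[LHS](@combfE R r (psi :: X)) combf_cons scale0r add0r.
  by rewrite combfE.
have dE := adapted_dim ad; have fE' := adapted_row_free ad.
have mP := measurable_paralmx_free dE fE'.
have sec t y : paralmx (col_mx (row0mx K) (liftmx S)) (rvcons t y) <->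
    0 <= t <= 1 /\ paralmx (col_mx K S) y.
  split.
    move=> /paralmx_col_mx[u hu [z hz]]; move: hz.
    rewrite mul_row0mx mul_liftmx rvconsD add0r -{1}(hsubmxK z).
    move=> /cube_row_mx[hz1 hz2] h; split.
      by have /rowP/(_ 0) := h; rewrite !rvcons0 => ->; exact: hz2.
    have := congr1 (@rvbehead R _) h; rewrite !rvbeheadK => ->.
    by apply/paralmx_col_mx; exists u => //; exists (lsubmx z).
  move=> [ht /paralmx_col_mx[u hu [z hz ->]]]; apply/paralmx_col_mx.
  exists u => //; exists (row_mx z t%:M).
    by apply/cube_row_mx; split => // i; rewrite ord1 mxE eqxx mulr1n.
  by rewrite mul_row0mx mul_liftmx rvconsD add0r row_mxKl row_mxKr mxE eqxx mulr1n.
have -> : leb (paralmx (col_mx (row0mx K) (liftmx S))) = leb (paralmx (col_mx K S)).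
  apply: leb_unit_fibred => //.
    by move=> t ht; congr leb; apply/seteqP; split => y /=; rewrite sec // => -[].
  by move=> t ht y; rewrite sec => -[]; rewrite (negbTE ht).
rewrite invfM invrK [RHS]mulrCA; congr (_ * _).
by rewrite mulrCA mulVf ?mulr1 // normr_eq0.
Qed.

(** Here psi is the only vector off the wall, so that the coordinate along psi
    is determined by a and the fibre is a single slice. The factor comes from
    comparing da with dw on parallelepipeds. *)
Lemma fvol_cons_off_wall a (A : set 'rV[R]_(size X).+1) : measurable A ->
  (@fvol R r (psi :: X) da a A =
   `|pairing psi E|^-1%:E * @fvol R r X (wall_measure da E)
      (a - (pairing a E / pairing psi E) *: psi)%R
      [set y | A (rvcons (pairing a E / pairing psi E)%R y)])%E.
Proof.
move=> mA; set t := (_ / _)%R.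
have [d [e [K [S ad]]]] := exists_adapted (combf X).
have ad' := adapted_cons_off_wall ad.
have /combf_spanP[x0 x0E] : a - t *: psi \in <<X>>%VS.
  by apply/XE; rewrite pairingB pairingZ divfK // subrr.
rewrite (fvolE (X := psi :: X) (x0 := rvcons t x0) (image_scales_full span_cons_full) ad' mA); last first.
  by rewrite combf_cons x0E addrCA subrr addr0.
rewrite (fvolE (X := X) (x0 := x0) (image_scales_wall XE e_neq0) ad) //; last first.
  exact: measurable_rvcons_section.
rewrite quot_of_cons_off_wall // EFinM -muleA; congr (_ * (_ * leb _))%E.
by apply/seteqP; split => y /=; rewrite mul_row0mx rvconsD addr0.
Qed.

End ConsOffWall.
End ConsVolume.

End ScaleVolumes.

(** * Fibre volumes and polytope volumes *)

Section FibreVolumeTheory.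
Variables (R : realType) (N : nat) (wT : vectType R).
Implicit Types (f g : 'Hom('rV[R]_N, wT)) (nu : set wT -> \bar R) (A B : set 'rV[R]_N).

Lemma quot_of_ge0 f nu d e (K : 'M[R]_(d, N)) (S : 'M[R]_(e, N)) :
  image_scales f nu -> adapted f K S -> 0 <= quot_of f nu K S.
Proof.
move=> hnu ad; apply: divr_ge0; first by rewrite fine_ge0.
by have [] := hnu _ _ _ _ _ ad (unitmx1 _ _) => /ltW.
Qed.

Lemma fibre_vol_mono f nu x A B : image_scales f nu -> measurable A -> measurable B ->
  A `<=` B -> (fibre_vol f nu (f x) A <= fibre_vol f nu (f x) B)%E.
Proof.
move=> hnu mA mB AB; have [d [e [K [S ad]]]] := exists_adapted f.
rewrite !(fibre_volE hnu ad _ (erefl (f x)))//; apply: lee_wpmul2l.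
  by rewrite lee_fin quot_of_ge0.
by apply: le_measure; rewrite ?inE; [exact: measurable_preimage_affine..|move=> y /AB].
Qed.

Lemma fibre_vol0 f nu a : fibre_vol f nu a set0 = 0%E.
Proof.
rewrite /fibre_vol /quot_measure (_ : leb_basis _ _ = 0%E) ?mule0//.
by rewrite /leb_basis (_ : [set y | _] = set0) ?measure0 //; apply/seteqP; split.
Qed.

Lemma fibre_vol_ge0 f nu x A : image_scales f nu -> measurable A ->
  (0 <= fibre_vol f nu (f x) A)%E.
Proof.
move=> hnu mA; have [d [e [K [S ad]]]] := exists_adapted f.
by rewrite (fibre_volE hnu ad _ (erefl (f x)))//; apply: mule_ge0 => //; rewrite lee_fin quot_of_ge0.
Qed.

Lemma fibre_volD f nu x A B : image_scales f nu -> measurable A -> measurable B ->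
  B `<=` A -> fibre_vol f nu (f x) A \is a fin_num ->
  fibre_vol f nu (f x) (A `\` B) = (fibre_vol f nu (f x) A - fibre_vol f nu (f x) B)%E.
Proof.
move=> hnu mA mB BA fA; have [d [e [K [S ad]]]] := exists_adapted f.
have mAB := measurableD mA mB.
have fB : fibre_vol f nu (f x) B \is a fin_num.
  rewrite ge0_fin_numE ?fibre_vol_ge0//; apply: le_lt_trans (fibre_vol_mono x hnu mB mA BA) _.
  by rewrite -ge0_fin_numE ?fibre_vol_ge0.
have split_vol : fibre_vol f nu (f x) A =
    (fibre_vol f nu (f x) (A `\` B) + fibre_vol f nu (f x) B)%E.
  rewrite !(fibre_volE hnu ad _ (erefl (f x)))// -ge0_muleDr //.
  rewrite -measureU; last 3 first.
  - exact: (measurable_preimage_affine K x mAB).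
  - exact: (measurable_preimage_affine K x mB).
  - by apply/seteqP; split => y //= -[[_ nB] /nB].
  congr (_ * leb _)%E; apply/seteqP; split => y /=; last by case=> [[]//|/BA].
  by move=> Ay; have [|] := pselect (B (x + y *m K)); [right|left].
by rewrite split_vol addeK.
Qed.

Lemma fibre_vol_translate f nu x v A : image_scales f nu -> measurable A ->
  fibre_vol f nu (f x) [set y | A (y + v)] = fibre_vol f nu (f (x + v)) A.
Proof.
move=> hnu mA; have [d [e [K [S ad]]]] := exists_adapted f.
rewrite (fibre_volE hnu ad (measurable_preimage_add v mA) (erefl (f x))).
rewrite (fibre_volE hnu ad mA (erefl _)).
by congr (_ * leb _)%E; apply/seteqP; split => y /=; rewrite addrAC.
Qed.

Lemma adapted_mulmx f g (Q : 'M[R]_N) d e (K : 'M[R]_(d, N)) (S : 'M[R]_(e, N)) :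
  Q \in unitmx -> (forall x, f x = g (x *m Q)) ->
  adapted f K S -> adapted g (K *m Q) (S *m Q).
Proof.
move=> uQ fg [fK kK spanS injS].
have gf x : g x = f (x *m invmx Q) by rewrite fg mulmxKV.
split.
- apply: inj_row_free => v; rewrite mulmxA => v0; apply: (row_free_inj fK).
  by rewrite /= mul0mx -(mulmxK uQ (v *m K)) v0 mul0mx.
- move=> x; rewrite gf -kK; apply/idP/idP => /submxP[y yE]; apply/submxP; exists y.
    by rewrite yE mulmxA mulmxK.
  by rewrite mulmxA -yE mulmxKV.
- by move=> x; have [z zE] := spanS (x *m invmx Q); exists z; rewrite gf zE mulmxA -fg.
- by move=> z; rewrite mulmxA -fg => /injS.
Qed.

Lemma image_paralmx_mulmx f g (Q : 'M[R]_N) e (S : 'M[R]_(e, N)) :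
  (forall x, f x = g (x *m Q)) -> g @` paralmx (S *m Q) = f @` paralmx S.
Proof.
move=> fg; apply/seteqP; split => _ [_ [y hy <-] <-].
  by exists (y *m S); [exists y|rewrite fg mulmxA].
by exists (y *m (S *m Q)); [exists y|rewrite fg mulmxA].
Qed.

Lemma image_scales_mulmx f g (Q : 'M[R]_N) nu :
  Q \in unitmx -> (forall x, f x = g (x *m Q)) ->
  image_scales g nu -> image_scales f nu.
Proof.
move=> uQ fg hnu d e K S L ad uL.
have := hnu _ _ _ _ _ (adapted_mulmx uQ fg ad) uL.
by rewrite mulmxA !(image_paralmx_mulmx _ fg).
Qed.

Lemma leb_paralmx_mulr m (T : 'M[R]_(m, N)) (Q : 'M[R]_N) : m = N -> row_free T ->
  Q \in unitmx -> leb (paralmx (T *m Q)) = (`|\det Q|%:E * leb (paralmx T))%E.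
Proof.
move=> mN; case: _ / (esym mN) in T * => fT uQ; rewrite row_free_unit in fT.
by rewrite !leb_paralmx ?unitmx_mul ?fT // det_mulmx normrM mulrC EFinM.
Qed.

(** For permutation matrices Q, this reorders the coordinates. *)
Lemma fibre_vol_mulmx f g (Q : 'M[R]_N) nu x A :
  Q \in unitmx -> `|\det Q| = 1 -> (forall x, f x = g (x *m Q)) ->
  image_scales g nu -> measurable A ->
  fibre_vol f nu (f x) [set y | A (y *m Q)] = fibre_vol g nu (f x) A.
Proof.
move=> uQ dQ fg hnu mA; have [d [e [K [S ad]]]] := exists_adapted f.
have adg := adapted_mulmx uQ fg ad.
rewrite (fibre_volE (image_scales_mulmx uQ fg hnu) ad (measurable_preimage_mulmx Q mA) (erefl _)).
rewrite (fibre_volE hnu adg mA (esym (fg x))).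
congr (_ * _)%E; last first.
  by congr leb; apply/seteqP; split => y /=; rewrite mulmxDl mulmxA.
rewrite /quot_of (image_paralmx_mulmx _ fg) -mul_col_mx.
by rewrite (leb_paralmx_mulr (adapted_dim ad) (adapted_row_free ad) uQ) dQ mul1e.
Qed.

End FibreVolumeTheory.

Section Vol.
Variables (R : realType) (r : nat).
Implicit Types (X Y : seq 'rV[R]_r) (nu : set 'rV[R]_r -> \bar R).

Definition orthant n : set 'rV[R]_n := [set y | forall i, 0 <= y 0 i].

Lemma measurable_orthant n : measurable (@orthant n).
Proof.
rewrite (_ : @orthant n = [set y : 'rV[R]_n | forall i, `[0, +oo[%classic (y 0 i)]).
  by apply: (@measurable_box R n (fun=> `[0, +oo[%classic)) => i; exact: measurable_itv.
by apply/seteqP; split => y h i; have := h i; rewrite /= in_itv /= andbT.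
Qed.

Lemma vol_out X nu a : ~ cone X a -> vol X nu a = 0%E.
Proof.
move=> Xa; rewrite /vol /quot_measure /leb_basis.
rewrite (_ : [set y | _] = set0) ?measure0 ?mule0 //.
apply/seteqP; split => y //= -[y0 ya]; apply: Xa.
by eexists; last exact: ya.
Qed.

Lemma vol_fvol X nu x : vol X nu (combf X x) = fvol nu (combf X x) (@orthant (size X)).
Proof.
rewrite /vol /fvol /fibre_vol -/(combf X) /quot_measure; congr (_ * _)%E.
rewrite /leb_basis; congr leb; apply/seteqP; split => y /=; first by case.
move=> h; split => //.
rewrite comb_seqmx -combfE linearD /= limg_lfunVK ?memv_img ?memvf//.
rewrite comb_seqmx [combf X (_ *m _)](_ : _ = 0) ?addr0//.
apply/eqP; rewrite -memv_ker mul_seqmx; apply: memv_suml => i _; apply: memvZ.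
by apply: vbasis_mem; rewrite mem_nth.
Qed.

(** combf with the length of the family as an independent parameter, so that a
    family may be replaced by a permutation of it without changing the space
    of coefficients. *)
Definition rmulf n m (F : 'M[R]_(n, m)) : 'Hom('rV[R]_n, 'rV[R]_m) :=
  linfun (mulmxr F).

Lemma rmulfE n m (F : 'M[R]_(n, m)) x : rmulf F x = x *m F.
Proof. by rewrite /rmulf lfunE. Qed.

Lemma fvol_rmulf X nu n a : size X = n ->
  fvol nu a (@orthant (size X)) = fibre_vol (rmulf (seqmx n X)) nu a (@orthant n).
Proof.
move=> <-; rewrite /fvol; congr fibre_vol.
by apply/lfunP => x; rewrite combfE rmulfE.
Qed.

Lemma image_scales_rmulf X nu n : size X = n ->
  image_scales (combf X) nu -> image_scales (rmulf (seqmx n X)) nu.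
Proof.
move=> <-; rewrite (_ : combf X = rmulf (seqmx (size X) X)) //.
by apply/lfunP => x; rewrite combfE rmulfE.
Qed.

(** A permutation matrix exchanges the two fibres, preserves the orthant, and
    has determinant 1 or -1. *)
Lemma vol_perm X Y nu a : perm_eq X Y -> image_scales (combf Y) nu -> a \in <<X>>%VS ->
  vol X nu a = vol Y nu a.
Proof.
move=> XY hnu aX; have sXY := perm_size XY.
have : a \in <<Y>>%VS by rewrite -(eq_span (perm_mem XY)).
move=> /combf_spanP[y yE]; have /combf_spanP[x xE] := aX.
rewrite -{2}yE -{1}xE !vol_fvol xE yE.
rewrite (fvol_rmulf _ _ sXY) (fvol_rmulf _ _ (erefl _)).
have /tuple_permP[p pE] : perm_eq X (in_tuple Y) by [].
have XE : seqmx (size Y) X = perm_mx p *m seqmx (size Y) Y.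
  rewrite -row_permE; apply/matrixP => i j; rewrite !mxE.
  by rewrite [in LHS]pE -tnth_nth tnth_mktuple (tnth_nth 0).
have uP : (perm_mx p : 'M[R]_(size Y)) \in unitmx by rewrite unitmx_perm.
have fg z : rmulf (seqmx (size Y) X) z = rmulf (seqmx (size Y) Y) (z *m perm_mx p).
  by rewrite !rmulfE XE mulmxA.
have dP : `|\det (perm_mx p : 'M[R]_(size Y))| = 1 by rewrite det_perm normr_sign.
have yE' : rmulf (seqmx (size Y) X) (y *m invmx (perm_mx p)) = a.
  by rewrite fg mulmxKV // rmulfE -combfE.
have := fibre_vol_mulmx (y *m invmx (perm_mx p)) uP dP fg
  (image_scales_rmulf (erefl _) hnu) (@measurable_orthant _).
have zp z i : (z *m perm_mx p) 0 i = z 0 (p^-1%g i) :> R.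
  by rewrite -[p in LHS]invgK -col_permE mxE.
rewrite yE' => <-; congr fibre_vol; apply/seteqP; split => z /= h i.
  by rewrite zp.
by have := h (p i); rewrite zp permK.
Qed.

End Vol.

(** * Polynomial functions and residue polynomials *)

Section Polyfun.
Variables (R : realType) (r : nat).
Implicit Types (f g : 'rV[R]_r -> R).

(** Polynomiality on lines is all that is needed of the polynomials involved:
    it makes sense of derivatives along vectors, and determines a function
    from its restriction to an open set. *)
Definition polyfun f := forall b d, exists p : {poly R}, forall t, f (b + t *: d) = p.[t].

Lemma polyfun_cst k : polyfun (fun=> k).
Proof. by move=> b d; exists k%:P => t; rewrite hornerC. Qed.

Lemma polyfun_coord i : polyfun (fun a => a 0 i).
Proof.
move=> b d; exists ((b 0 i)%:P + (d 0 i) *: 'X) => t.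
by rewrite !hornerE !mxE mulrC.
Qed.

Lemma polyfunD f g : polyfun f -> polyfun g -> polyfun (fun a => f a + g a).
Proof.
move=> hf hg b d; have [p pE] := hf b d; have [q qE] := hg b d.
by exists (p + q) => t; rewrite hornerD pE qE.
Qed.

Lemma polyfunM f g : polyfun f -> polyfun g -> polyfun (fun a => f a * g a).
Proof.
move=> hf hg b d; have [p pE] := hf b d; have [q qE] := hg b d.
by exists (p * q) => t; rewrite hornerM pE qE.
Qed.

Lemma polyfunB f g : polyfun f -> polyfun g -> polyfun (fun a => f a - g a).
Proof.
move=> hf hg; under eq_fun do rewrite -mulN1r.
exact: (polyfunD hf (polyfunM (polyfun_cst _) hg)).
Qed.

Lemma polyfun_sum (I : Type) (s : seq I) (F : I -> 'rV[R]_r -> R) :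
  (forall i, polyfun (F i)) -> polyfun (fun a => \sum_(i <- s) F i a).
Proof.
move=> hF; elim: s => [|i s IH].
  by under eq_fun do rewrite big_nil; exact: polyfun_cst.
by under eq_fun do rewrite big_cons; exact: (polyfunD (hF i) IH).
Qed.

Lemma polyfun_prod (I : Type) (s : seq I) (F : I -> 'rV[R]_r -> R) :
  (forall i, polyfun (F i)) -> polyfun (fun a => \prod_(i <- s) F i a).
Proof.
move=> hF; elim: s => [|i s IH].
  by under eq_fun do rewrite big_nil; exact: polyfun_cst.
by under eq_fun do rewrite big_cons; exact: (polyfunM (hF i) IH).
Qed.

Lemma polyfunX f n : polyfun f -> polyfun (fun a => f a ^+ n).
Proof.
move=> hf; elim: n => [|n IH].
  by under eq_fun do rewrite expr0; exact: polyfun_cst.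
by under eq_fun do rewrite exprS; exact: (polyfunM hf IH).
Qed.

Lemma polyfun_pairing E : polyfun (fun a => pairing a E).
Proof.
under eq_fun do rewrite /pairing mxE.
apply: (@polyfun_sum _ _ (fun j (a : 'rV[R]_r) => a 0 j * E j 0)) => i.
exact: (polyfunM (polyfun_coord _) (polyfun_cst _)).
Qed.

Lemma polyfun_peval P : polyfun (peval P).
Proof.
rewrite (_ : peval P = fun a => \sum_(m <- mpoly.msupp P)
    mpoly.mcoeff m P * \prod_(i < r) a 0 i ^+ mpoly.fun_of_multinom m i); last first.
  by apply/funext => a; rewrite /peval mpoly.mevalE.
apply: (@polyfun_sum _ _ (fun m (a : 'rV[R]_r) => mpoly.mcoeff m P *
  \prod_(i < r) a 0 i ^+ mpoly.fun_of_multinom m i)) => m.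
apply: (polyfunM (polyfun_cst _)).
apply: (@polyfun_prod _ _ (fun i (a : 'rV[R]_r) => a 0 i ^+ mpoly.fun_of_multinom m i)) => i.
exact: (polyfunX _ (polyfun_coord _)).
Qed.

Lemma polyfun_shift f v : polyfun f -> polyfun (fun a => f (a + v)).
Proof. by move=> hf b d; have [p pE] := hf (b + v) d; exists p => t; rewrite -pE addrAC. Qed.

(** On the line from b to a the polynomial has infinitely many roots near b.
    *)
Lemma polyfun_eq0 f (b : 'rV[R]_r) : polyfun f -> (\forall a \near b, f a = 0) -> forall a, f a = 0.
Proof.
move=> hf fb a; have [p pE] := hf b (a - b).
suff p0 : p = 0 by have := pE 1; rewrite scale1r addrC subrK p0 horner0.
have : \forall t \near (0 : R), f (b + t *: (a - b)) = 0.
  have ct : (fun t : R => b + t *: (a - b)) @ 0 --> b + 0 *: (a - b).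
    by apply: cvgD; [exact: cvg_cst|apply: cvgZr_tmp; exact: cvg_id].
  rewrite scale0r addr0 in ct.
  exact: (ct _ fb).
move=> /nbhs_ballP[e /= e0 be].
apply/eqP/negPn/negP => p0.
(* As many distinct roots as the size of p, one more than its degree. *)
pose s := [seq e / 2 / (i.+1)%:R | i <- iota 0 (size p)].
have := @max_poly_roots _ p s p0; rewrite size_map size_iota ltnn => H.
suff: false by []; apply: H.
  apply/allP => _ /mapP[i _ ->]; rewrite /root -pE be //=.
  rewrite /ball /= sub0r normrN ger0_norm ?divr_ge0// 1?ltW//.
  by rewrite ltr_pdivrMr // (lt_le_trans (_ : e / 2 < e)) ?ler_peMr ?ler1n ?ltW // ltr_pdivrMr // ltr_pMr // ltr1n.
have he : e / 2 != 0 by rewrite gt_eqF // divr_gt0.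
rewrite map_inj_uniq ?iota_uniq // => i j /(mulfI he) /invr_inj /eqP.
by rewrite eqr_nat => /eqP[].
Qed.

End Polyfun.

Section ResiduePolynomials.
Variables (R : realType) (r : nat) (E : 'cV[R]_r).
Implicit Types (w : seq 'I_r) (M : seq 'rV[R]_r) (a b : 'rV[R]_r).

(** For w = i_1 ... i_k, the residue at z = 0 of the derivative, along
    e_(i_1), ..., e_(i_k), of exp<a, x + zE> / prod_(psi in M) <psi, x + zE>
    at x = 0. A derivative along e_i either brings down the coefficient a_i of
    the exponent, or repeats a factor psi of the denominator, with coefficient
    - psi_i. Without derivatives the function is exp(z <a, E>) / prod <z psi,
    E>, and the residue is a coefficient of the exponential series, absent if
    the product is empty. *)
Fixpoint word_residue w M a : R :=
  match w with
  | [::] => (0 < size M)%N%:R * (pairing a E ^+ (size M).-1 / ((size M).-1)`!%:R)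
            / \prod_(psi <- M) pairing psi E
  | i :: w' => a 0 i * word_residue w' M a - \sum_(psi <- M) psi 0 i * word_residue w' (psi :: M) a
  end.

Lemma word_residue_perm w M M' a : perm_eq M M' -> word_residue w M a = word_residue w M' a.
Proof.
elim: w M M' => [|i w IH] M M' MM' /=.
  by rewrite (perm_size MM') (perm_big _ MM').
rewrite (IH _ _ MM') (perm_big _ MM') /=; congr (_ - _).
by apply: eq_bigr => psi _; rewrite (IH _ (psi :: M')) // perm_cons.
Qed.

Lemma polyfun_word_residue w M : polyfun (word_residue w M).
Proof.
elim: w M => [|i w IH] M /=.
  have h := polyfunX (size M).-1 (polyfun_pairing E).
  exact: (polyfunM (polyfunM (polyfun_cst _) (polyfunM h (polyfun_cst _))) (polyfun_cst _)).
apply: (polyfunB (polyfunM (polyfun_coord _) (IH M))).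
apply: (@polyfun_sum R r 'rV[R]_r M (fun (psi a : 'rV[R]_r) => psi 0 i * word_residue w (psi :: M) a)) => psi.
exact: (polyfunM (polyfun_cst _) (IH _)).
Qed.

(** Differentiating the exponential in the direction psi of a multiplies it by
    <psi, x + zE>, which cancels one factor of the denominator. In the
    recursion, the derivative psi_i of the coefficient a_i cancels the term of
    psi in the sum. *)
Lemma word_residue_line w M psi b : pairing psi E != 0 ->
  exists p : {poly R}, forall t, word_residue w (psi :: M) (b + t *: psi) = p.[t] /\
    word_residue w M (b + t *: psi) = p^`().[t].
Proof.
move=> e0; elim: w M => [|i w IH] M.
  exists (((size M)`!%:R * \prod_(chi <- psi :: M) pairing chi E)^-1 *:
    ((pairing b E)%:P + pairing psi E *: 'X) ^+ size M) => t.
  rewrite /= derivZ deriv_exp derivD derivC add0r derivZ derivX -[_ *+ size M]scaler_nat !hornerE.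
  rewrite !pairingD !pairingZ [t * _]mulrC big_cons; split; first by rewrite !invfM; ring.
  case: (size M) => [|n] /=; first by rewrite !(mulr0n, mul0r, mulr0).
  have n0 : n.+1%:R != 0 :> R by rewrite pnatr_eq0.
  rewrite factS natrM !invfM.
  rewrite [RHS](_ : _ = (n.+1%:R^-1 * n.+1%:R) * ((pairing psi E)^-1 * pairing psi E) *
    ((pairing b E + pairing psi E * t) ^+ n / n`!%:R / \prod_(j <- M) pairing j E)).
    by rewrite !mulVf // !mul1r.
  by rewrite /=; ring.
have [p pE] := IH M; have [q qE] := IH (psi :: M).
have /boolp.choice[h hE] := fun chi => IH (chi :: M).
have swap chi v : word_residue w (chi :: psi :: M) v = word_residue w (psi :: chi :: M) v.
  by apply: word_residue_perm; rewrite (perm_catCA [:: chi] [:: psi]).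
exists (((b 0 i)%:P + psi 0 i *: 'X) * p - psi 0 i *: q - \sum_(chi <- M) chi 0 i *: h chi) => t.
have [p1 p2] := pE t; have [q1 q2] := qE t; split => /=.
  rewrite big_cons !hornerE horner_sum -p1 -q1 !mxE opprD addrA [t * _]mulrC; congr (_ - _).
  by apply: eq_bigr => chi _; rewrite hornerZ swap (hE chi t).1.
have dS : (\sum_(chi <- M) chi 0 i *: h chi)^`() = \sum_(chi <- M) chi 0 i *: (h chi)^`().
  by rewrite linear_sum /=; apply: eq_bigr => chi _; rewrite derivZ.
rewrite !derivB dS derivM derivD derivC add0r !derivZ derivX !hornerE horner_sum.
rewrite -p2 -q2 -p1 !mxE [t * _]mulrC [X in _ = X - _]addrAC subrr add0r; congr (_ - _).
by apply: eq_bigr => chi _; rewrite hornerZ (hE chi t).2.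
Qed.

(** For a in W the exponential at x = 0 is 1, and derivatives raise the order
    of the pole, so that only powers of z with exponent at most - size M
    appear. *)
Lemma word_residue_wall w M a : pairing a E = 0 -> (1 < size M)%N -> word_residue w M a = 0.
Proof.
move=> aE; elim: w M => [|i w IH] M M1 /=.
  by case: M M1 => [|m1 [|m2 M]] // _; rewrite aE expr0n /= mul0r mulr0 mul0r.
rewrite IH // mulr0 big1 ?subr0 // => psi _.
by rewrite IH ?mulr0 //= ltnW.
Qed.

(** Only the term where all derivatives fall on the exponential has a simple
    pole. *)
Lemma word_residue_wall1 w psi a : pairing a E = 0 ->
  word_residue w [:: psi] a = (\prod_(i <- w) a 0 i) / pairing psi E.
Proof.
move=> aE; elim: w => [|i w IH] /=.
  by rewrite expr0 fact0 invr1 big_nil big_seq1 !mul1r.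
by rewrite big_seq1 (@word_residue_wall w [:: psi; psi]) // mulr0 subr0 IH big_cons mulrA.
Qed.

(** The word of the derivatives taken by diff_op. It is reversed because the
    outermost derivative of the right fold is the first letter there, and the
    last letter in expfrac_word. *)
Definition mnm_word (m : mpoly.multinom r) : seq 'I_r :=
  rev (flatten [seq nseq (mpoly.fun_of_multinom m i) i | i <- enum 'I_r]).

Lemma prod_mnm_word m a : \prod_(i <- mnm_word m) a 0 i =
  \prod_(i < r) a 0 i ^+ mpoly.fun_of_multinom m i.
Proof.
rewrite (perm_big (flatten [seq nseq (mpoly.fun_of_multinom m i) i | i <- enum 'I_r])).
  rewrite big_flatten /= big_map big_enum /=; apply: eq_bigr => i _.
  by rewrite big_nseq iter_mulr mulr1.
by rewrite perm_rev.
Qed.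

(** The operator P(d_x) in place of a single derivative. *)
Definition op_residue (P : mpoly.mpoly r R) M a : R :=
  \sum_(m <- mpoly.msupp P) mpoly.mcoeff m P * word_residue (mnm_word m) M a.

Lemma polyfun_op_residue P M : polyfun (op_residue P M).
Proof.
apply: (@polyfun_sum R r _ _ (fun m a => mpoly.mcoeff m P * word_residue (mnm_word m) M a)) => m.
exact: (polyfunM (polyfun_cst _) (polyfun_word_residue _ _)).
Qed.

Lemma op_residue_line P M psi b : pairing psi E != 0 ->
  exists p : {poly R}, forall t, op_residue P (psi :: M) (b + t *: psi) = p.[t] /\
    op_residue P M (b + t *: psi) = p^`().[t].
Proof.
move=> e0; have /boolp.choice[h hE] := fun m => word_residue_line (mnm_word m) M b e0.
exists (\sum_(m <- mpoly.msupp P) mpoly.mcoeff m P *: h m) => t; split.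
  by rewrite horner_sum; apply: eq_bigr => m _; rewrite hornerZ (hE m t).1.
rewrite linear_sum horner_sum; apply: eq_bigr => m _.
by rewrite /= derivZ hornerZ (hE m t).2.
Qed.

Lemma op_residue_wall P M a : pairing a E = 0 -> (1 < size M)%N -> op_residue P M a = 0.
Proof. by move=> aE M1; rewrite /op_residue big1 // => m _; rewrite word_residue_wall ?mulr0. Qed.

Lemma op_residue_wall1 P psi a : pairing a E = 0 ->
  op_residue P [:: psi] a = peval P a / pairing psi E.
Proof.
move=> aE; rewrite /op_residue /peval mpoly.mevalE big_distrl /=.
by apply: eq_bigr => m _; rewrite word_residue_wall1 // prod_mnm_word mulrA.
Qed.

Lemma op_residue0 P a : op_residue P [::] a = 0.
Proof.
rewrite /op_residue big1 // => m _; elim: (mnm_word m) => [|i w IH] /=.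
  by rewrite !mul0r mulr0.
by rewrite big_nil subr0 mulrCA IH mulr0.
Qed.

End ResiduePolynomials.

(** * Derivatives and Laurent expansions *)

Section LineDerivative.
Variables (R : realType) (V : normedModType R).

(** Reduces directional derivatives to derivatives of functions of one real
    variable. *)
Lemma is_derive_line (f : V -> R) (x v : V) (c : R) :
  is_derive (0 : R) (1 : R) (fun h : R => f (h *: v + x)) c -> is_derive x v f c.
Proof.
have E : (fun h : R => h^-1 *: ((f \o shift x) (h *: v) - f x)) =
    (fun h : R => h^-1 *: (((fun k : R => f (k *: v + x)) \o shift (0 : R)) (h *: (1 : R)) -
       f (0 *: v + x))).
  by apply/funext => h; rewrite /= /shift scale0r add0r addr0 [h *: 1]mulr1.
move=> [df <-]; split; first by rewrite /derivable E.
by rewrite /derive E.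
Qed.

Lemma is_derive1_affine (k c h : R) : is_derive h (1 : R) (fun t : R => k + t * c) c.
Proof.
have := is_derive_poly (k%:P + c *: 'X) h.
rewrite derivD derivC add0r derivZ derivX !hornerE.
rewrite [X in is_derive _ _ X _](_ : _ = (fun t : R => k + t * c)) //.
by apply/funext => t; rewrite !hornerE mulrC.
Qed.

Lemma is_derive_affine (f : V -> R) (x v : V) (c : R) :
  (forall h : R, f (h *: v + x) = f x + h * c) -> is_derive x v f c.
Proof.
move=> fE; apply: is_derive_line; under eq_fun do rewrite fE.
exact: is_derive1_affine.
Qed.

Lemma is_derive_expR_affine (f : V -> R) (x v : V) (c : R) :
  (forall h : R, f (h *: v + x) = f x + h * c) ->
  is_derive x v (fun y => expR (f y)) (c * expR (f x)).
Proof.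
move=> fE; apply: is_derive_line; under eq_fun do rewrite fE.
have d1 := is_derive1_affine (f x) c 0.
have d2 := is_derive_expR (f x + 0 * c).
have := @is_derive1_comp R expR (fun t : R => f x + t * c) 0 _ _ d2 d1.
by rewrite mul0r addr0 mulrC.
Qed.

Lemma is_derive_inv (f : V -> R) (x v : V) (c : R) : f x != 0 -> is_derive x v f c ->
  is_derive x v (fun y => (f y)^-1) (- c / (f x) ^+ 2).
Proof.
move=> fx [df <-]; split; first exact: derivableV.
by rewrite deriveV // -[_ *: _]/(_ * _) mulNr mulrC mulNr.
Qed.

End LineDerivative.

Section ExpFraction.
Variables (R : realType) (r : nat) (a : 'rV[R]_r) (E : 'cV[R]_r) (z : R).
Implicit Types (x v : 'cV[R]_r) (psi : 'rV[R]_r) (M : seq 'rV[R]_r) (w : seq 'I_r).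

Definition expfrac M x : R :=
  expR (pairing a (x + z *: E)) / \prod_(psi <- M) pairing psi (x + z *: E).

(** The recursion of word_residue, before taking residues. *)
Fixpoint expfrac_word w M x : R :=
  match w with
  | [::] => expfrac M x
  | i :: w' => a 0 i * expfrac_word w' M x
      - \sum_(psi <- M) psi 0 i * expfrac_word w' (psi :: M) x
  end.

Definition regular M x := forall psi, psi \in M -> pairing psi (x + z *: E) != 0.

Lemma pairingDr psi x y : pairing psi (x + y) = pairing psi x + pairing psi y.
Proof. by rewrite /pairing mulmxDr mxE. Qed.

Lemma pairingZr psi k x : pairing psi (k *: x) = k * pairing psi x.
Proof. by rewrite /pairing -scalemxAr mxE. Qed.

Lemma pairing_delta psi i : pairing psi (delta_mx i 0) = psi 0 i.
Proof. by rewrite /pairing -colE mxE. Qed.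

Lemma pairing_line psi i x h :
  pairing psi (h *: delta_mx i 0 + x + z *: E) = pairing psi (x + z *: E) + h * psi 0 i.
Proof. by rewrite -addrA [LHS]pairingDr pairingZr pairing_delta [LHS]addrC. Qed.

Lemma expfrac_cons psi M x : expfrac (psi :: M) x = expfrac M x / pairing psi (x + z *: E).
Proof. by rewrite /expfrac big_cons invfM mulrAC -mulrA. Qed.

(** Product rule, one factor of the denominator at a time. *)
Lemma is_derive_expfrac M i x : regular M x ->
  is_derive x (delta_mx i 0) (expfrac M) (expfrac_word [:: i] M x).
Proof.
elim: M => [|psi M IH] reg.
  rewrite /= big_nil subr0.
  rewrite (_ : expfrac [::] = fun y => expR (pairing a (y + z *: E))).
    by apply: is_derive_expR_affine => h; exact: pairing_line.
  by apply/funext => y; rewrite /expfrac big_nil divr1.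
have p0 : pairing psi (x + z *: E) != 0 by apply: reg; rewrite mem_head.
have regM : regular M x by move=> chi Mchi; apply: reg; rewrite in_cons Mchi orbT.
have d1 := IH regM.
have d2 : is_derive x (delta_mx i 0) (fun y => pairing psi (y + z *: E)) (psi 0 i).
  by apply: is_derive_affine => h; exact: pairing_line.
have d3 := @is_derive_inv R _ (fun y : 'cV[R]_r => pairing psi (y + z *: E)) x _ _ p0 d2.
have := is_deriveM d1 d3.
rewrite (_ : _ * _ = expfrac (psi :: M)); last by apply/funext => y; rewrite expfrac_cons.
move=> d; apply: is_derive_eq; rewrite /= big_cons.
have -> : \sum_(chi <- M) chi 0 i * expfrac [:: chi, psi & M] x =
    (\sum_(chi <- M) chi 0 i * expfrac (chi :: M) x) / pairing psi (x + z *: E).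
  by rewrite big_distrl; apply: eq_bigr => chi _; rewrite !expfrac_cons /=; ring.
rewrite !expfrac_cons /GRing.scale /=.
by rewrite expr2 invfM; ring.
Qed.

Lemma is_derive_seq_sum (I : eqType) (s : seq I) (F : I -> 'cV[R]_r -> R) (dF : I -> R) x v :
  (forall i, i \in s -> is_derive x v (F i) (dF i)) ->
  is_derive x v (fun y => \sum_(i <- s) F i y) (\sum_(i <- s) dF i).
Proof.
elim: s => [|i s IH] h.
  under eq_fun do rewrite big_nil.
  by rewrite big_nil; exact: is_derive_cst.
under eq_fun do rewrite big_cons.
rewrite big_cons; apply: is_deriveD; first by apply: h; rewrite mem_head.
by apply: IH => j sj; apply: h; rewrite in_cons sj orbT.
Qed.

Lemma is_derive_expfrac_word w M i x : regular M x ->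
  is_derive x (delta_mx i 0) (expfrac_word w M) (expfrac_word (rcons w i) M x).
Proof.
elim: w M => [|j w IH] M reg; first exact: is_derive_expfrac.
rewrite rcons_cons /=.
apply: is_deriveB; first exact: (is_deriveZ (a 0 j) (IH M reg)).
apply: is_derive_seq_sum => psi Mpsi.
apply: (is_deriveZ (psi 0 j) (IH (psi :: M) _)) => chi.
by rewrite in_cons => /orP[/eqP ->|]; exact: reg.
Qed.

End ExpFraction.

Section ContinuousForms.
Variables (R : realType).

Lemma continuous_mulmx_entry m n p (A : 'M[R]_(m, n)) i j :
  continuous (fun B : 'M[R]_(n, p) => (A *m B) i j).
Proof.
rewrite (_ : (fun C => _) = fun C : 'M[R]_(n, p) => \sum_k A i k * C k j); last first.
  by apply/funext => C; rewrite mxE.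
apply: continuous_big => [|k _ B]; first exact: add_continuous.
by apply: continuousM; [exact: cst_continuous|exact: coord_continuous].
Qed.

Lemma continuous_mulmxr_entry m n p (B : 'M[R]_(n, p)) i j :
  continuous (fun A : 'M[R]_(m, n) => (A *m B) i j).
Proof.
rewrite (_ : (fun C => _) = fun C : 'M[R]_(m, n) => \sum_k C i k * B k j); last first.
  by apply/funext => C; rewrite mxE.
apply: continuous_big => [|k _ A]; first exact: add_continuous.
by apply: continuousM; [exact: coord_continuous|exact: cst_continuous].
Qed.

Lemma continuous_pairingr r (psi : 'rV[R]_r) : continuous (fun x : 'cV[R]_r => pairing psi x).
Proof. exact: continuous_mulmx_entry. Qed.

Lemma continuous_pairingr_shift r (psi : 'rV[R]_r) (c : 'cV[R]_r) :
  continuous (fun x : 'cV[R]_r => pairing psi (x + c)).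
Proof.
rewrite (_ : (fun x => _) = (fun x => pairing psi x + pairing psi c)); last first.
  by apply/funext => x; rewrite pairingDr.
by move=> x; apply: continuousD; [exact: continuous_pairingr|exact: cst_continuous].
Qed.

Lemma continuous_pairingl r (E : 'cV[R]_r) : continuous (fun a : 'rV[R]_r => pairing a E).
Proof. exact: continuous_mulmxr_entry. Qed.

End ContinuousForms.

Section DiffOp.
Variables (R : realType) (r : nat) (a : 'rV[R]_r) (E : 'cV[R]_r) (z : R).
Implicit Types (x : 'cV[R]_r) (M : seq 'rV[R]_r) (w : seq 'I_r).

(** The derivative formulas hold where the denominator does not vanish; they
    have to hold around x to be differentiated again. *)
Lemma near_regular M x : regular E z M x -> \forall y \near x, regular E z M y.
Proof.
elim: M => [|psi M IH] reg; first by near=> y => psi; rewrite in_nil.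
have regM : regular E z M x by move=> chi Mchi; apply: reg; rewrite in_cons Mchi orbT.
have p0 : pairing psi (x + z *: E) != 0 by apply: reg; rewrite mem_head.
have c := @continuous_pairingr_shift R r psi (z *: E) x.
near=> y => chi; rewrite in_cons => /orP[/eqP ->|].
  by near: y; exact: cvgr_neq0 c p0.
have : regular E z M y by near: y; exact: IH.
exact.
Unshelve. all: by end_near. Qed.

Lemma derive_expfrac_word M w x : regular E z M x ->
  foldr (fun i (h : 'cV[R]_r -> R) => 'D_(delta_mx i 0) h) (expfrac a E z M) w x =
  expfrac_word a E z (rev w) M x.
Proof.
elim: w x => [|i w IH] x reg //=.
rewrite rev_cons; have [_ <-] := is_derive_expfrac_word a (rev w) i reg.
apply: near_eq_derive; have := near_regular reg.
by apply: filterS => y; exact: IH.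
Qed.

Lemma diff_op_expfrac P M x : regular E z M x ->
  diff_op P (expfrac a E z M) x =
  \sum_(m <- mpoly.msupp P) mpoly.mcoeff m P * expfrac_word a E z (mnm_word m) M x.
Proof.
move=> reg; rewrite /diff_op; apply: eq_bigr => m _; congr (_ * _).
rewrite -derive_expfrac_word //; congr (_ x).
elim: (enum 'I_r) => //= i s IH; rewrite foldr_cat -IH.
by elim: (mpoly.fun_of_multinom m i) => //= n ->.
Qed.

End DiffOp.

Section Residue.
Variable R : realType.
Implicit Types (g : R -> R) (u v : nat -> R) (m : nat).

(** An expansion of g at 0 with a pole of order at most m + 1, as in the
    definition of residue. *)
Definition laurent m u g := \forall z \near (0 : R)^',
  (fun N => \sum_(0 <= n < N) u n * z ^+ n) @ \oo --> z ^+ m.+1 * g z.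

Definition is_residue g c := exists m u, u m = c /\ laurent m u g.

Lemma laurent_eq m u g h : (\forall z \near (0 : R)^', g z = h z) -> laurent m u g -> laurent m u h.
Proof. by move=> gh; apply: filterS2 gh => z ->. Qed.

(** Multiplication by z: it lets one expansion be read with a pole of higher
    order, so that two expansions can be compared term by term. *)
Definition raise u n : R := if n is n'.+1 then u n' else 0.

Lemma laurent_raise m u g : laurent m u g -> laurent m.+1 (raise u) g.
Proof.
apply: filterS => z uz; rewrite -cvg_shiftS exprS -mulrA /=.
rewrite (_ : (fun N => _) = fun N => z * \sum_(0 <= n < N) u n * z ^+ n).
  by apply: cvgM => //; exact: cvg_cst.
apply/funext => N; rewrite big_nat_recl //= mul0r add0r big_distrr /=.
by apply: eq_bigr => n _; rewrite exprS mulrCA.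
Qed.

Lemma laurent_raise_add k m u g : laurent m u g -> 
  exists2 v, v (k + m)%N = u m & laurent (k + m) v g.
Proof.
move=> h; elim: k => [|k [v vm hv]]; first by exists u.
by exists (raise v) => //; exact: laurent_raise.
Qed.

Lemma is_residue_common g h c d : is_residue g c -> is_residue h d ->
  exists m u v, [/\ u m = c, v m = d, laurent m u g & laurent m v h].
Proof.
move=> [m [u [<- hu]]] [n [v [<- hv]]].
have [u' um hu'] := laurent_raise_add n hu; have [v' vm hv'] := laurent_raise_add m hv.
by exists (n + m)%N, u', v'; split => //; rewrite addnC.
Qed.

Lemma is_residueD g h c d : is_residue g c -> is_residue h d ->
  is_residue (fun z => g z + h z) (c + d).
Proof.
move=> gc hd; have [m [u [v [um vm hu hv]]]] := is_residue_common gc hd.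
exists m, (fun n => u n + v n); split; first by rewrite um vm.
apply: filterS2 hu hv => z uz vz; rewrite mulrDr.
under eq_fun do under eq_bigr do rewrite mulrDl.
under eq_fun do rewrite big_split /=.
exact: cvgD.
Qed.

Lemma is_residueZ k g c : is_residue g c -> is_residue (fun z => k * g z) (k * c).
Proof.
move=> [m [u [<- hu]]]; exists m, (fun n => k * u n); split => //.
apply: filterS hu => z uz; rewrite mulrCA.
under eq_fun do under eq_bigr do rewrite -mulrA.
under eq_fun do rewrite -big_distrr /=.
by apply: cvgM => //; exact: cvg_cst.
Qed.

Lemma is_residue0 : is_residue (fun=> 0) 0.
Proof.
exists 0%N, (fun=> 0); split => //; near=> z; rewrite mulr0.
under eq_fun do under eq_bigr do rewrite mul0r.
by under eq_fun do rewrite big1 //; exact: cvg_cst.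
Unshelve. all: by end_near. Qed.

Lemma is_residue_sum (I : Type) (s : seq I) (g : I -> R -> R) (c : I -> R) :
  (forall i, is_residue (g i) (c i)) ->
  is_residue (fun z => \sum_(i <- s) g i z) (\sum_(i <- s) c i).
Proof.
move=> h; elim: s => [|i s IH].
  by under eq_fun do rewrite big_nil; rewrite big_nil; exact: is_residue0.
by under eq_fun do rewrite big_cons; rewrite big_cons; exact: is_residueD.
Qed.

Definition null_series u := \forall z \near (0 : R)^',
  (fun N => \sum_(0 <= n < N) u n * z ^+ n) @ \oo --> (0 : R).

Lemma sum_geometric_le2 (t : R) N : 0 <= t <= 1 / 2 -> \sum_(0 <= n < N) t ^+ n <= 2.
Proof.
move=> /andP[t0 t1]; elim: N => [|N IH]; first by rewrite big_geq.
rewrite big_nat_recl //= expr0 (eq_bigr (fun n => t * t ^+ n)); last first.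
  by move=> n _; rewrite exprS.
rewrite -big_distrr /=; have s0 : 0 <= \sum_(0 <= n < N) t ^+ n.
  by apply: sumr_ge0 => n _; exact: exprn_ge0.
by nra.
Qed.

(** The terms are bounded at z = e / 2, so that at smaller z the tail of the
    series is dominated by a geometric series and cannot compensate a nonzero
    constant term. *)
Lemma null_series0 u : null_series u -> u 0%N = 0.
Proof.
move=> /nbhs_ballP[e /= e0 he].
have e2 : 0 < e / 2 by rewrite divr_gt0.
have conv z : 0 < z -> z <= e / 2 ->
    (fun N => \sum_(0 <= n < N) u n * z ^+ n) @ \oo --> (0 : R).
  move=> z0 ze; apply: he; last by rewrite gt_eqF.
  by rewrite /ball /= sub0r normrN gtr0_norm // (le_lt_trans ze) // ltr_pdivrMr // ltr_pMr // ltr1n.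
have [C C0 uC] : exists2 C : R, 0 < C & forall n, `|u n * (e / 2) ^+ n| <= C.
  have /cvgP/cvg_series_cvg_0/cvgP/cvg_seq_bounded := conv _ e2 (lexx _).
  by move=> /pinfty_ex_gt0[C C0 hC]; exists C => // n; exact: hC.
apply/eqP; rewrite -normr_eq0; set d := `|u 0%N|.
rewrite eq_le normr_ge0 andbT leNgt; apply/negP => d0.
(* At z = t * e / 2 the terms of positive index add up to at most 2 C t, which
   is at most d / 2. *)
pose t := Num.min (1 / 2) (d / (4 * C)).
have t0 : 0 < t by rewrite lt_min divr_gt0 //= divr_gt0 // mulr_gt0.
have t1 : t <= 1 / 2 by rewrite ge_min lexx.
have tC : t * (4 * C) <= d by rewrite -ler_pdivlMr ?mulr_gt0// ge_min lexx orbT.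
have te : t * (e / 2) <= e / 2 by rewrite ler_piMl // ?ltW //; lra.
have /cvgr0Pnorm_lt/(_ (d / 2)) := conv _ (mulr_gt0 t0 e2) te.
rewrite divr_gt0 // => /(_ isT) [N _ /(_ N.+1 (leqnSn _))] /=.
rewrite big_nat_recl //= expr0 mulr1 => small.
have tail : `|\sum_(0 <= n < N) u n.+1 * (t * (e / 2)) ^+ n.+1| <= C * t * 2.
  apply: le_trans (ler_norm_sum _ _ _) _.
  apply: le_trans (_ : \sum_(0 <= n < N) C * t * t ^+ n <= _).
    apply: ler_sum => n _; rewrite exprMn mulrCA normrM mulrC -mulrA -exprS.
    by rewrite (ger0_norm (exprn_ge0 _ (ltW t0))) ler_wpM2r // exprn_ge0 // ltW.
  rewrite -big_distrr /= ler_wpM2l ?mulr_ge0 ?(ltW C0) ?(ltW t0)//.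
  by apply: sum_geometric_le2; rewrite (ltW t0).
have : d < d / 2 + C * t * 2.
  rewrite /d; set S := \sum_(_ <= _ < _) _ in small tail.
  have -> : u 0%N = (u 0%N + S) - S by rewrite addrK.
  rewrite (addrK S (u 0%N)) -{1}(addrK S (u 0%N)).
  by apply: le_lt_trans (ler_normB _ _) _; exact: ltr_leD.
by nra.
Qed.

Lemma null_series_eq0 u : null_series u -> forall n, u n = 0.
Proof.
move=> h n; elim: n u h => [|n IH] u h; first exact: null_series0.
apply: (IH (fun k => u k.+1)); have u0 := null_series0 h.
have n0 : \forall z \near (0 : R)^', z != 0 by exact: nbhs_dnbhs_neq.
apply: filterS2 n0 h => z z0; rewrite -cvg_shiftS /= => uz.
rewrite (_ : (fun N => _) = fun N => z^-1 * \sum_(0 <= n < N.+1) u n * z ^+ n).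
  rewrite -[X in _ --> X](mulr0 z^-1); apply: cvgM => //; exact: cvg_cst.
apply/funext => N; rewrite big_nat_recl //= u0 mul0r add0r big_distrr /=.
by apply: eq_bigr => k _; rewrite exprS mulrCA mulKf.
Qed.

(** The difference of two expansions is a power series with sum 0 around 0. *)
Lemma is_residue_unique g c d : is_residue g c -> is_residue g d -> c = d.
Proof.
move=> gc gd; have [m [u [v [um vm hu hv]]]] := is_residue_common gc gd.
suff : null_series (fun n => u n - v n).
  by move=> /null_series_eq0/(_ m)/eqP; rewrite um vm subr_eq0 => /eqP.
apply: filterS2 hu hv => z uz vz.
under eq_fun do under eq_bigr do rewrite mulrBl.
under eq_fun do rewrite sumrB.
by have h := cvgB uz vz; rewrite subrr in h; exact: h.
Qed.

Lemma residueE g c : is_residue g c -> residue g = c.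
Proof. by move=> h; apply: get_unique => // d /is_residue_unique/(_ h). Qed.

Lemma is_residue_exp (s c : R) k :
  is_residue (fun z => c * (expR (z * s) / z ^+ k)) (c * raise (fun n => s ^+ n / n`!%:R) k).
Proof.
apply: is_residueZ; exists k, (raise (fun n => s ^+ n / n`!%:R)); split => //.
have n0 : \forall z \near (0 : R)^', z != 0 by exact: nbhs_dnbhs_neq.
apply: filterS n0 => z z0; rewrite -cvg_shiftS.
have -> : z ^+ k.+1 * (expR (z * s) / z ^+ k) = z * expR (z * s).
  by rewrite exprS -mulrA [z ^+ k * _]mulrC divfK ?expf_neq0.
rewrite (_ : (fun N => _) = fun N => z * series (exp_coeff (z * s)) N).
  by apply: cvgM; [exact: cvg_cst|exact: is_cvg_series_exp_coeff].
apply/funext => N /=; rewrite big_nat_recl //= mul0r add0r big_distrr /=.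
by apply: eq_bigr => n _; rewrite /exp_coeff /= exprS exprMn; ring.
Qed.

End Residue.

Section PolE.
Variables (R : realType) (r : nat) (E : 'cV[R]_r).

(** At x = 0 the recursion is linear in the functions of z, and for the empty
    word the function is a multiple of exp(z <a, E>) / z ^ size M. *)
Lemma is_residue_expfrac_word (a : 'rV[R]_r) w (M : seq 'rV[R]_r) :
  is_residue (fun z => expfrac_word a E z w M 0) (word_residue E w M a).
Proof.
elim: w M => [|i w IH] M /=.
  rewrite (_ : (fun z => _) = fun z => (\prod_(psi <- M) pairing psi E)^-1 *
     (expR (z * pairing a E) / z ^+ size M)).
    rewrite (_ : _ / _ = (\prod_(psi <- M) pairing psi E)^-1 *
      raise (fun n => pairing a E ^+ n / n`!%:R) (size M)); first exact: is_residue_exp.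
    by rewrite mulrC; congr (_ * _); case: (size M) => [|n] /=; rewrite ?mul0r ?mul1r.
  apply/funext => z; rewrite /expfrac add0r pairingZr.
  under eq_bigr do rewrite pairingZr.
  rewrite big_split /= big_const_seq count_predT iter_mulr_1 invfM; ring.
apply: is_residueD; first exact: is_residueZ.
rewrite -sumrN; under eq_fun do rewrite -sumrN.
apply: is_residue_sum => psi; rewrite -mulN1r; under eq_fun do rewrite -mulN1r.
by do 2 apply: is_residueZ.
Qed.

(** For z <> 0 no factor of the denominator vanishes at x = 0, so that the
    derivatives in Pol are those computed by expfrac_word. *)
Lemma PolE P Psi a : (forall psi, psi \in Psi -> pairing psi E != 0) ->
  Pol P Psi E a = op_residue E P Psi a.
Proof.
move=> hE; apply: residueE.
have h : is_residue (fun z => \sum_(m <- mpoly.msupp P)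
    mpoly.mcoeff m P * expfrac_word a E z (mnm_word m) Psi 0) (op_residue E P Psi a).
  by apply: is_residue_sum => m; apply: is_residueZ; exact: is_residue_expfrac_word.
move: h => [m [u [um hu]]]; exists m, u; split => //; apply: laurent_eq hu.
have n0 : \forall z \near (0 : R)^', z != 0 by exact: nbhs_dnbhs_neq.
apply: filterS n0 => z z0; rewrite -diff_op_expfrac // => psi Mpsi.
by rewrite add0r pairingZr mulf_neq0 // hE.
Qed.

End PolE.

(** * Chambers near a wall *)

Section Topology.
Variables (R : realType) (V : normedModType R).

Definition convex_set (D : set V) := forall x y t, D x -> D y -> 0 <= t <= 1 ->
  D (x + t *: (y - x)).

Lemma continuous_segment (x v : V) : continuous (fun t : R => x + t *: v).
Proof.
move=> t; rewrite /continuous_at.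
by apply: cvgD; [exact: cvg_cst|apply: cvgZr_tmp; exact: cvg_id].
Qed.

Lemma convex_set_connected (D : set V) : convex_set D -> connected D.
Proof.
move=> cD; have [->|/set0P[x Dx]] := eqVneq D set0; first exact: connected0.
rewrite (_ : D = \bigcup_(y in D) ((fun t : R => x + t *: (y - x)) @` `[0, 1]%classic)).
  apply: bigcup_connected.
    exists x => y Dy; exists 0; first by rewrite /= in_itv /= lexx ler01.
    by rewrite scale0r addr0.
  move=> y Dy; apply: connected_continuous_connected; first exact: segment_connected.
  exact/continuous_subspaceT/continuous_segment.
apply/seteqP; split => [y Dy|z [y Dy [t + <-]]].
  exists y => //; exists 1; first by rewrite /= in_itv /= lexx ler01.
  by rewrite scale1r addrC subrK.
by rewrite /= in_itv /= => /cD; apply.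
Qed.

Definition nball (a : V) (e : R) : set V := [set b | `|a - b| < e].

Lemma convex_nball a e : convex_set (nball a e).
Proof.
move=> x y t; rewrite /nball /= => xa ya /andP[t0 t1].
have -> : a - (x + t *: (y - x)) = (1 - t) *: (a - x) + t *: (a - y).
  have e1 : (a - y) - (a - x) = x - y by rewrite opprB addrC addrA subrK.
  by rewrite scalerBl scale1r -addrA [- _ + _]addrC -scalerBr e1 opprD addrA -scalerN opprB.
apply: le_lt_trans (ler_normD _ _) _; rewrite !normrZ.
rewrite (ger0_norm t0) ger0_norm ?subr_ge0//.
have h (u v p : R) : 0 <= p -> u < v -> p * u <= p * v by move=> p0 uv; rewrite ler_wpM2l // ltW.
have [tl|tl] := ltP t 1.
  rewrite -[e](_ : (1 - t) * e + t * e = e); last by ring.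
  apply: ltr_leD; last exact: h.
  by rewrite ltr_pM2l // subr_gt0.
have -> : t = 1 by apply/eqP; rewrite eq_le t1.
by rewrite subrr mul0r add0r mul1r.
Qed.

Lemma nbhs_nballP a (P : set V) : nbhs a P -> exists2 e, 0 < e & nball a e `<=` P.
Proof. by move=> /nbhs_normP[e /= e0 h]; exists e. Qed.

Lemma nbhs_nball a e : 0 < e -> nbhs a (nball a e).
Proof. by move=> e0; apply/nbhs_normP; exists e. Qed.

Lemma nball_center a e : 0 < e -> nball a e a.
Proof. by rewrite /nball /= subrr normr0. Qed.

Lemma nball_nbhs (a b : V) e : nball a e b -> nbhs b (nball a e).
Proof.
move=> ab; apply: filterS (nbhs_nball b (_ : 0 < e - `|a - b|)); last by rewrite subr_gt0.
by move=> y; rewrite /nball /= ltrBrDl; exact: le_lt_trans (ler_distD _ _ _).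
Qed.

End Topology.

Section Subspaces.
Variables (R : realType) (r : nat).
Implicit Types (U W : {vspace 'rV[R]_r}) (a b : 'rV[R]_r).

Lemma near_notin_subspace U a : a \notin U -> \forall b \near a, b \notin U.
Proof.
move=> aU; pose g := (\1 - projv U)%VF.
have gE x : g x = x - projv U x by rewrite /g add_lfunE opp_lfunE id_lfunE.
have : g a != 0.
  apply: contraNneq aU => /eqP; rewrite gE subr_eq0 => /eqP ->; exact: memv_proj.
move=> /rV0Pn[i gai].
have c : continuous (fun x : 'rV[R]_r => g x 0 i).
  rewrite (_ : (fun x => _) = fun x : 'rV[R]_r => (x *m lin1_mx g) 0 i); last first.
    by apply/funext => x; rewrite mul_rV_lin1.
  exact: continuous_mulmxr_entry.
have : \forall b \near a, g b 0 i != 0 by exact: cvgr_neq0 (c a) gai.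
apply: filterS => b.
by apply: contra => bU; rewrite gE projv_id // subrr mxE.
Qed.

(** Each subspace meets W in a proper subspace, so it can be left by an
    arbitrarily small move along W which stays off the previous ones. *)
Lemma near_generic (W : {vspace 'rV[R]_r}) (Us : seq {vspace 'rV[R]_r}) a (Q : set 'rV[R]_r) :
  (forall U, U \in Us -> ~~ (W <= U)%VS) -> a \in W -> nbhs a Q ->
  exists b, [/\ b \in W, nbhs b Q & \forall c \near b, forall U, U \in Us -> c \notin U].
Proof.
elim: Us => [|U Us IH] hU aW aQ.
  by exists a; split => //; near=> c => U; rewrite in_nil.
have [b [bW bQ bU]] : exists b, [/\ b \in W, nbhs b Q &
    \forall c \near b, forall U, U \in Us -> c \notin U].
  by apply: IH => // U' U'Us; apply: hU; rewrite in_cons U'Us orbT.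
suff [b' [b'W b'U nb']] : exists b', [/\ b' \in W, b' \notin U &
    nbhs b' [set c | Q c /\ forall U, U \in Us -> c \notin U]].
  exists b'; split => //; first by apply: filterS nb' => c [].
  apply: filterS2 nb' (near_notin_subspace b'U) => c [_ h1] h2 U'.
  by rewrite in_cons => /orP[/eqP ->//|]; exact: h1.
have nb : nbhs b [set c | Q c /\ forall U, U \in Us -> c \notin U] by exact: filterI.
have [bU'|] := boolP (b \in U); last by exists b.
have : ~~ (W <= U)%VS by apply: hU; rewrite mem_head.
move=> /subvPn[d dW dU].
have cs : (fun t : R => b + t *: d) @ 0 --> b.
  by have := @continuous_segment R _ b d 0; rewrite /continuous_at scale0r addr0.
have /cs := near_join nb; rewrite nbhs_simpl /= => nt.
have n0 : \forall t \near (0 : R)^', t != 0 by exact: nbhs_dnbhs_neq.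
have n1 : \forall t \near (0 : R)^',
    nbhs (b + t *: d) [set c | Q c /\ forall U, U \in Us -> c \notin U].
  exact: nbhs_dnbhs.
have n01 := @filterI _ (0 : R)^' _ _ _ n0 n1; have [t [t0 ht]] := filter_ex (n01 _); exists (b + t *: d); split => //.
  by rewrite memvD // memvZ.
apply: contra dU => h; have : t^-1 *: ((b + t *: d) - b) \in U by rewrite memvZ // memvB.
by rewrite addrAC subrr add0r scalerK.
Unshelve. all: by end_near. Qed.

End Subspaces.

Section Chambers.
Variables (R : realType) (r : nat).
Implicit Types (F W U : {vspace 'rV[R]_r}) (X nu : seq 'rV[R]_r) (c D : set 'rV[R]_r).

Lemma cone_combf X a : cone X a <-> exists2 t : 'rV_(size X), orthant t & combf X t = a.
Proof.
by split=> [[t ht <-]|[t ht <-]]; exists t => //; rewrite combfE -comb_seqmx.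
Qed.

Lemma cone_span X a : cone X a -> a \in <<X>>%VS.
Proof. by move=> /cone_combf[t _ <-]; apply/combf_spanP; exists t. Qed.

Lemma cone_midpoint X a v : cone X (a + v) -> cone X (a - v) -> cone X a.
Proof.
move=> /cone_combf[x hx xE] /cone_combf[y hy yE]; apply/cone_combf.
exists (2^-1 *: (x + y)).
  by move=> i; rewrite !mxE mulr_ge0 ?invr_ge0 ?addr_ge0.
rewrite linearZ linearD /= xE yE addrACA subrr addr0 -mulr2n -[a *+ 2]scaler_nat scalerA.
by rewrite mulVf ?scale1r // pnatr_eq0.
Qed.

Lemma chamber_sub F X c : is_chamber F X c -> c `<=` [set` F] `\` sing F X.
Proof. by move=> [a _ ->]; exact: connected_component_sub. Qed.

(** A chamber is a connected component, so it swallows the connected sets that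
    it meets. *)
Lemma chamber_absorbs F X c D b : is_chamber F X c -> connected D ->
  D `<=` [set` F] `\` sing F X -> c b -> D b -> D `<=` c.
Proof.
move=> [a ha ->] cD sD cb Db; rewrite (same_connected_component cb).
exact: connected_component_max.
Qed.

Lemma chamber_meet F X c c' b : is_chamber F X c -> is_chamber F X c' -> c b -> c' b -> c = c'.
Proof.
move=> [a ha ->] [a' ha' ->] cb c'b.
by rewrite (same_connected_component cb) (same_connected_component c'b).
Qed.

(** If c is the exterior chamber, both sides vanish. *)
Lemma chamber_poly_vol F X (mu : set 'rV[R]_r -> \bar R) c v (b : 'rV[R]_r) :
  is_chamber_poly F X mu c v -> b \in F -> c b ->
  vol X mu b = (v b)%:E.
Proof.
move=> [_ hext hint] bF cb; have [cE|cE] := pselect (c = exterior F X).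
  rewrite (hext cE) // vol_out //; by move: cb; rewrite cE => -[].
by apply: hint => //; exact: subset_closure.
Qed.

Lemma nball_meets_closure c (a : 'rV[R]_r) e : closure c a -> 0 < e -> exists2 b, c b & nball a e b.
Proof. by move=> h e0; have [b [cb ab]] := h _ (nbhs_nball a e0); exists b. Qed.

End Chambers.

Section AdjacentChambers.
Variables (R : realType) (r : nat) (Phi : seq 'rV[R]_r) (W : {vspace 'rV[R]_r}).
Variables (E : 'cV[R]_r) (c1 c2 c12 : set 'rV[R]_r).
Let Phi0 := [seq phi <- Phi | phi \in W].
Hypothesis wallW : is_wall Phi W.
Hypothesis WE : forall a, a \in W <-> pairing a E = 0.
Hypothesis ch1 : is_chamber fullv Phi c1.
Hypothesis ch2 : is_chamber fullv Phi c2.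
Hypothesis adj : adjacent_along Phi W E c1 c2.
Hypothesis ch12 : is_chamber W Phi0 c12.
Hypothesis cl12 : closure c1 `&` closure c2 `&` [set` W] `<=` closure c12.

Lemma dim_wall : (\dim W).+1 = r.
Proof. by have [nu [_ sn fr ->]] := wallW; rewrite -[RHS]sn (eqnP fr). Qed.

Lemma dim_rows : \dim {:'rV[R]_r} = r.
Proof. by rewrite dimvf dim_matrix mul1r. Qed.

Lemma exists_positive : exists d : 'rV[R]_r, 0 < pairing d E.
Proof.
have : ~~ ({:'rV[R]_r} <= W)%VS.
  by apply/negP => /dimvS; rewrite dim_rows -[X in (X <= _)%N]dim_wall ltnn.
move=> /subvPn[d _ dW]; have d0 : pairing d E != 0 by apply: contra dW => /eqP /WE.
have [h|h|h] := ltgtP 0 (pairing d E); [by exists d| |by rewrite -h eqxx in d0].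
by exists (- d); rewrite pairingN oppr_gt0.
Qed.

(** These cut W in proper subspaces. A point of W outside all of them is
    singular for no reason other than being in W. *)
Definition small_spans : seq {vspace 'rV[R]_r} :=
  [seq U <- [seq <<mask (m : (size Phi).-tuple bool) Phi>>%VS | m <- enum {: (size Phi).-tuple bool}]
    | ~~ (W <= U)%VS].

Lemma small_spansP nu : subseq nu Phi -> ~~ (W <= <<nu>>)%VS -> <<nu>>%VS \in small_spans.
Proof.
move=> /subseqP[m /eqP sm ->] h; rewrite mem_filter h /=.
by apply/mapP; exists (Tuple sm); rewrite ?mem_enum.
Qed.

Lemma generic_point : exists a e, [/\ a \in W, 0 < e, closure c1 a, closure c2 a &
  forall b, nball a e b -> (b \in W -> closure c1 b /\ closure c2 b) /\
    forall U, U \in small_spans -> b \notin U].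
Proof.
have [_ _ _ [a0 a0W near0]] := adj.
have hU U : U \in small_spans -> ~~ (W <= U)%VS by rewrite mem_filter => /andP[].
have [a [aW na nU]] := near_generic hU a0W near0.
have [e e0 he] := nbhs_nballP (filterI na nU).
have [ha _] := he _ (nball_center a e0); have [ha1 ha2] := ha aW.
exists a, e; split => // b /he[h1 h2]; split => // bW; exact: h1 bW.
Qed.

(** Near a generic point of the common face, a singular point lies in the span
    of fewer than r vectors of Phi, and this span contains W, hence is W. So
    the two open halves of a small ball, and its intersection with W, are
    convex sets without singular points: each lies in one chamber. It remains
    to see that the chamber of each is the expected one. *)
Lemma local_structure : exists a e, [/\ a \in W, 0 < e &
  forall b, nball a e b -> [/\ 0 < pairing b E -> c1 b, pairing b E < 0 -> c2 b &
    b \in W -> c12 b]].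
Proof.
have [a [e [aW e0 cl1 cl2 near_a]]] := generic_point.
have [c1c2 pos1 neg2 _] := adj.
exists a, e; split => //.
have singW b : nball a e b -> sing fullv Phi b -> b \in W.
  move=> ab [nu [sub_nu size_nu /cone_span bnu]].
  have [_ /(_ <<nu>>%VS)] := near_a b ab.
  have [Wnu|Wnu] := boolP (W <= <<nu>>)%VS; last first.
    by move=> /(_ (small_spansP sub_nu Wnu)); rewrite bnu.
  move=> _; suff /eqP -> : W == <<nu>>%VS by [].
  rewrite eqEdim Wnu /= (leq_trans (dim_span nu)) // -ltnS dim_wall.
  by move: size_nu; rewrite dim_rows.
have sing0 b : nball a e b -> ~ sing W Phi0 b.
  move=> ab [nu [sub_nu size_nu /cone_span bnu]].
  have Wnu : ~~ (W <= <<nu>>)%VS.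
    by apply/negP => /dimvS; rewrite leqNgt (leq_ltn_trans (dim_span nu)).
  have sub_nu' := subseq_trans sub_nu (filter_subseq _ _).
  have [_ /(_ _ (small_spansP sub_nu' Wnu))] := near_a b ab.
  by rewrite bnu.
pose Bp : set 'rV[R]_r := [set b | nball a e b /\ 0 < pairing b E].
pose Bm : set 'rV[R]_r := [set b | nball a e b /\ pairing b E < 0].
pose B0 : set 'rV[R]_r := [set b | nball a e b /\ b \in W].
have pseg b b' t : pairing (b + t *: (b' - b)) E = (1 - t) * pairing b E + t * pairing b' E.
  by rewrite pairingD pairingZ pairingB; ring.
have cBp : connected Bp.
  apply: convex_set_connected => x y t [x1 x2] [y1 y2] ht; split; first exact: convex_nball.
  by rewrite pseg; move/andP: ht => [t0 t1]; nra.
have cBm : connected Bm.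
  apply: convex_set_connected => x y t [x1 x2] [y1 y2] ht; split; first exact: convex_nball.
  by rewrite pseg; move/andP: ht => [t0 t1]; nra.
have cB0 : connected B0.
  apply: convex_set_connected => x y t [x1 x2] [y1 y2] ht; split; first exact: convex_nball.
  by rewrite memvD // memvZ // memvB.
have sBp : Bp `<=` [set` fullv] `\` sing fullv Phi.
  move=> b [ab b0]; split; first by rewrite /= memvf.
  by move=> /(singW _ ab)/WE bE; rewrite bE ltxx in b0.
have sBm : Bm `<=` [set` fullv] `\` sing fullv Phi.
  move=> b [ab b0]; split; first by rewrite /= memvf.
  by move=> /(singW _ ab)/WE bE; rewrite bE ltxx in b0.
have sB0 : B0 `<=` [set` W] `\` sing W Phi0 by move=> b [ab bW]; split => //; exact: sing0.
have Bp1 : Bp `<=` c1.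
  have [b cb ab] := nball_meets_closure cl1 e0.
  by apply: (chamber_absorbs ch1 cBp sBp cb); split => //; exact: pos1.
have B012 : B0 `<=` c12.
  have [b cb ab] := nball_meets_closure (cl12 (conj (conj cl1 cl2) aW)) e0.
  apply: (chamber_absorbs ch12 cB0 sB0 cb); split => //.
  by have [] := chamber_sub ch12 cb.
have Bm2 : Bm `<=` c2.
  have [b cb ab] := nball_meets_closure cl2 e0.
  have [bneg|c2ext] := neg2.
    by apply: (chamber_absorbs ch2 cBm sBm cb); split => //; exact: bneg.
  (* Otherwise the exterior c2 meets neither half of the ball, since the upper
     half lies in c1. Both halves then lie in the cone, hence so does any
     point of c2 in the ball, as a midpoint of two points of the halves: this
     is absurd. *)
  have [[x [Bx cx]]|none] := pselect (exists x, Bm x /\ c2 x).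
    exact: (chamber_absorbs ch2 cBm sBm cx).
  have nBp x : Bp x -> ~ c2 x.
    by move=> Bx cx; apply: c1c2; exact: chamber_meet ch1 ch2 (Bp1 _ Bx) cx.
  have nBm x : Bm x -> ~ c2 x by move=> Bx cx; apply: none; exists x.
  have in_cone x : ~ c2 x -> cone Phi x.
    by rewrite c2ext => h; apply: contrapT => h'; apply: h; split; rewrite //= memvf.
  have bE : pairing b E = 0.
    apply/eqP; have [h|h|//] := ltgtP (pairing b E) 0.
      by have := nBm b (conj ab h).
    by have := nBp b (conj ab h).
  have [d d0] := exists_positive.
  have nb : nbhs b (nball a e) by exact: nball_nbhs.
  have nt : \forall t \near (0 : R), nball a e (b + t *: d).
    have := @continuous_segment R _ b d 0.
    by rewrite /continuous_at scale0r addr0 => /(_ _ nb).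
  have [s s0 hs] := nbhs_nballP nt.
  have hs2 t : `|t| < s -> nball a e (b + t *: d).
    by move=> ts; apply: hs; rewrite /nball /= sub0r normrN.
  have s2 : 0 < s / 2 by rewrite divr_gt0.
  have s2s : `|s / 2| < s by rewrite gtr0_norm // ltr_pdivrMr // ltr_pMr // ltr1n.
  have : ~ cone Phi b by move: cb; rewrite c2ext => -[].
  case; apply: (@cone_midpoint _ _ _ b ((s / 2) *: d)); apply: in_cone.
    by apply: nBp; split; [exact: hs2|rewrite pairingD bE add0r pairingZ mulr_gt0].
  rewrite -scaleNr; apply: nBm; split; first by apply: hs2; rewrite normrN.
  by rewrite pairingD bE add0r pairingZ mulNr oppr_lt0 mulr_gt0.
by move=> b ab; split => [b0|b0|bW]; [exact: Bp1|exact: Bm2|exact: B012].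
Qed.

End AdjacentChambers.

(** * Integrals of truncated polynomials *)

Section HasIntegral.
Variable R : realType.
Local Notation mu := (@lebesgue_measure R).
Implicit Types (a b m v w : R) (k : R -> R).

(** On the open interval, where the values of a truncated function at the
    endpoints do not matter. *)
Definition has_integral a b k v :=
  mu.-integrable `]a, b[%classic (EFin \o k) /\
  (\int[mu]_(t in `]a, b[%classic) (k t)%:E = v%:E)%E.

Lemma eq_has_integral a b k k' v : (forall t, a < t < b -> k t = k' t) ->
  has_integral a b k v -> has_integral a b k' v.
Proof.
move=> kk' [ik jk]; have e : {in `]a, b[%classic, EFin \o k =1 EFin \o k'}.
  by move=> t; rewrite inE /= in_itv /= => /kk' ->.
split; first by apply: (@eq_integrable _ _ _ mu _ _ _ _ e ik); exact: measurable_itv.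
by rewrite -jk; apply/esym/eq_integral.
Qed.

Lemma has_integral0 a b : has_integral a b (fun=> 0) 0.
Proof. by split; [exact: integrable0|rewrite integral0]. Qed.

Lemma has_integralB a b k k' v w : has_integral a b k v -> has_integral a b k' w ->
  has_integral a b (fun t => k t - k' t) (v - w).
Proof.
move=> [ik jk] [ik' jk']; split.
  by apply: (@integrableB _ _ _ mu _ _ _ _ ik ik'); exact: measurable_itv.
by rewrite EFinB -jk -jk' -integralB_EFin.
Qed.

Lemma has_integral_cat a m b k v w : a < m -> m < b ->
  has_integral a m k v -> has_integral m b k w -> has_integral a b k (v + w).
Proof.
move=> am mb [ik jk] [ik' jk'].
have abE : `]a, b[%classic = `]a, m]%classic `|` `]m, b[%classic.
  apply/seteqP; split => t; rewrite /= !in_itv /=.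
    by move=> /andP[-> ->]; rewrite andbT /=; have [|] := leP t m; [left|right].
  move=> [/andP[-> tm]|/andP[mt ->]]; first by rewrite (le_lt_trans tm).
  by rewrite (lt_trans am).
have mk := measurable_int mu ik; have mk' := measurable_int mu ik'.
have mkc : measurable_fun `]a, m]%classic (EFin \o k) by apply/emeasurable_fun_itv_bndo_bndcP.
have mab : measurable_fun (`]a, m]%classic `|` `]m, b[%classic) (EFin \o k).
  by apply/measurable_funU; [exact: measurable_itv|exact: measurable_itv|].
have dis : [disjoint `]a, m] & `]m, b[]%classic.
  apply/disj_setPLR => t; rewrite /= !in_itv /= => /andP[_ tm].
  by rewrite ltNge tm.
split.
  rewrite abE; apply/integrableP; split => //.
  have mabs D : measurable_fun D (EFin \o k) -> measurable_fun D (fun t => `|k t|%:E).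
    by move=> mD; rewrite (_ : (fun t => _) = abse \o (EFin \o k)) //; apply: measurableT_comp.
  rewrite ge0_integral_setU //=; last exact: mabs.
  rewrite -integral_itv_bndo_bndc; last exact: mabs.
  by apply: lte_add_pinfty; [have /integrableP[_] := ik|have /integrableP[_] := ik'].
rewrite abE integral_setU //= -integral_itv_bndo_bndc //.
by rewrite jk jk'.
Qed.

Lemma has_integral_poly a b (p : {poly R}) : a < b ->
  has_integral a b (fun t => p^`().[t]) (p.[b] - p.[a]).
Proof.
move=> ab; have cp (q : {poly R}) : continuous (fun t => q.[t]) by exact: continuous_horner.
have ik : mu.-integrable `[a, b]%classic (EFin \o (fun t => p^`().[t])).
  apply: continuous_compact_integrable; first exact: segment_compact.
  exact: continuous_subspaceT.
split.
  apply: (integrableS _ _ _ ik); [exact: measurable_itv|exact: measurable_itv|].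
  exact: subset_itvW.
rewrite -(integral_itv_bndoo true false); last first.
  apply: (measurable_funS _ _ (measurable_int mu ik)); first exact: measurable_itv.
  exact: subset_itvW.
rewrite (@continuous_FTC2 R (fun t => p^`().[t]) (fun t => p.[t]) a b ab) //.
- exact: continuous_subspaceT.
- split; first by move=> t _; have hp := is_derive_poly p t; exact: ex_derive.
    exact: cvg_at_right_filter (cp p a).
  exact: cvg_at_left_filter (cp p b).
- by move=> t _; have hp := is_derive_poly p t; rewrite derive1E; exact: derive_val.
Qed.

(** The truncated primitive does not jump at tau, where q vanishes, so the
    fundamental theorem of calculus survives the truncation. *)
Lemma has_integral_cut a b (q : {poly R}) (th : R -> bool) e tau : a < b -> e != 0 ->
  (forall s, 0 < s -> th s) -> (forall s, s < 0 -> ~~ th s) -> q.[tau] = 0 ->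
  let cut (p : {poly R}) t := if th (e * (tau - t)) then p.[t] else 0 in
  has_integral a b (cut q^`()) (cut q b - cut q a).
Proof.
move=> ab e0 thp thn qtau cut.
have cutp t : 0 <= e * (tau - t) -> cut q t = q.[t].
  rewrite le_eqVlt => /orP[/eqP/esym/eqP|/thp h]; last by rewrite /cut h.
  rewrite mulf_eq0 (negbTE e0) subr_eq0 /= => /eqP <-.
  by rewrite /cut qtau if_same.
have cutn t : e * (tau - t) <= 0 -> cut q t = 0.
  rewrite le_eqVlt => /orP[/eqP/eqP|/thn/negbTE h]; last by rewrite /cut h.
  rewrite mulf_eq0 (negbTE e0) subr_eq0 /= => /eqP <-.
  by rewrite /cut qtau if_same.
have pos x y : x < y -> (forall t, x < t < y -> 0 < e * (tau - t)) ->
    0 <= e * (tau - x) -> 0 <= e * (tau - y) -> has_integral x y (cut q^`()) (cut q y - cut q x).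
  move=> xy h hx hy; rewrite !cutp//.
  by apply: eq_has_integral (has_integral_poly q xy) => t /h/thp; rewrite /cut => ->.
have neg x y : x < y -> (forall t, x < t < y -> e * (tau - t) < 0) ->
    e * (tau - x) <= 0 -> e * (tau - y) <= 0 -> has_integral x y (cut q^`()) (cut q y - cut q x).
  move=> xy h hx hy; rewrite !cutn// subrr.
  by apply: eq_has_integral (has_integral0 x y) => t /h/thn/negbTE; rewrite /cut => ->.
have piece x y : x < y -> y <= tau \/ tau <= x ->
    has_integral x y (cut q^`()) (cut q y - cut q x).
  move=> xy; have [ep|en|] := ltgtP 0 e; last by move/esym/eqP; rewrite (negbTE e0).
    move=> [h|h]; [apply: pos => //; last 2 first|apply: neg => //; last 2 first].
    - by nra.
    - by nra.
    - by move=> t /andP[? ?]; rewrite mulr_gt0 // subr_gt0; lra.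
    - by nra.
    - by nra.
    - by move=> t /andP[? ?]; rewrite pmulr_rlt0 // subr_lt0; lra.
  move=> [h|h]; [apply: neg => //; last 2 first|apply: pos => //; last 2 first].
  - by nra.
  - by nra.
  - by move=> t /andP[? ?]; rewrite nmulr_rlt0 // subr_gt0; lra.
  - by nra.
  - by nra.
  - by move=> t /andP[? ?]; rewrite nmulr_rgt0 // subr_lt0; lra.
have [tau_a|a_tau] := leP tau a; first by apply: piece => //; right.
have [b_tau|tau_b] := leP b tau; first by apply: piece => //; left.
rewrite (_ : _ - _ = (cut q tau - cut q a) + (cut q b - cut q tau)); last by ring.
apply: (has_integral_cat a_tau tau_b); apply: piece => //; [by left|by right].
Qed.

End HasIntegral.

(** * Finite differences and boxes *)

Section FiniteDifferences.
Variables (R : realType) (r : nat) (eps : R).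
Implicit Types (M N : seq 'rV[R]_r) (h g : 'rV[R]_r -> R) (Q : 'rV[R]_r -> Prop).
Implicit Types (b v : 'rV[R]_r).

(** The alternating sum of h over the vertices b - eps (sum of a subfamily of
    M). *)
Fixpoint fdiff M h b : R :=
  if M is psi :: M' then fdiff M' h b - fdiff M' h (b - eps *: psi) else h b.

(** Identities for fdiff only need to hold at these vertices. *)
Fixpoint on_vertices M Q b : Prop :=
  if M is psi :: M' then on_vertices M' Q b /\ on_vertices M' Q (b - eps *: psi) else Q b.

Lemma on_vertices_impl M Q Q' b : (forall c, Q c -> Q' c) ->
  on_vertices M Q b -> on_vertices M Q' b.
Proof.
move=> QQ'; elim: M b => [|psi M IH] b /=; first exact: QQ'.
by move=> [h1 h2]; split; exact: IH.
Qed.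

Lemma on_vertices_and M Q Q' b : on_vertices M Q b -> on_vertices M Q' b ->
  on_vertices M (fun c => Q c /\ Q' c) b.
Proof.
by elim: M b => [|psi M IH] b //= [h1 h2] [h1' h2']; split; apply: IH.
Qed.

Lemma eq_fdiff M h g b : on_vertices M (fun c => h c = g c) b -> fdiff M h b = fdiff M g b.
Proof. by elim: M b => [|psi M IH] b //= [h1 h2]; rewrite !IH. Qed.

Lemma fdiffD M h g b : fdiff M (fun c => h c + g c) b = fdiff M h b + fdiff M g b.
Proof. by elim: M b => [|psi M IH] b //=; rewrite !IH; ring. Qed.

Lemma fdiffB M h g b : fdiff M (fun c => h c - g c) b = fdiff M h b - fdiff M g b.
Proof. by elim: M b => [|psi M IH] b //=; rewrite !IH; ring. Qed.

Lemma fdiff0 M b : fdiff M (fun=> 0) b = 0.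
Proof. by elim: M b => [|psi M IH] b //=; rewrite !IH subrr. Qed.

Lemma fdiff_shift M h v b : fdiff M (fun c => h (c + v)) b = fdiff M h (b + v).
Proof. by elim: M b => [|psi M IH] b //=; rewrite !IH addrAC. Qed.

Lemma polyfun_fdiff M h : polyfun h -> polyfun (fdiff M h).
Proof.
move=> ph; elim: M => [|psi M IH] //=.
exact: (polyfunB IH (polyfun_shift (- (eps *: psi)) IH)).
Qed.

Lemma on_vertices_nball M a b rho C : 0 <= eps -> (forall psi, psi \in M -> `|psi| <= C) ->
  `|a - b| + (size M)%:R * (eps * C) < rho -> on_vertices M (nball a rho) b.
Proof.
move=> eps0; elim: M b => [|psi M IH] b hC; first by rewrite /= mul0r addr0.
have hC' chi : chi \in M -> `|chi| <= C by move=> h; apply: hC; rewrite in_cons h orbT.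
have psiC : `|psi| <= C by apply: hC; rewrite mem_head.
have eC : 0 <= eps * C by rewrite mulr_ge0 // (le_trans _ psiC).
rewrite /= -natr1 mulrDl mul1r => hb; split; apply: IH => //; first lra.
have := ler_normD (a - b) (eps *: psi); rewrite normrZ (ger0_norm eps0) opprB addrCA [eps *: psi + _]addrC => h.
have := ler_wpM2l eps0 psiC; lra.
Qed.

Lemma has_integral_fdiff N g h psi b :
  (forall c, has_integral 0 eps (fun t => g (c - t *: psi)) (h c)) ->
  has_integral 0 eps (fun t => fdiff N g (b - t *: psi)) (fdiff N h b).
Proof.
move=> gh; elim: N b => [|chi N IH] b /=; first exact: gh.
apply: has_integralB; first exact: IH.
by apply: eq_has_integral (IH (b - eps *: chi)) => t _; rewrite addrAC.
Qed.

End FiniteDifferences.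

Section Boxes.
Variables (R : realType) (eps : R).
Hypothesis eps_gt0 : 0 < eps.

(** Only the coordinates of index at least m and less than k are bounded
    above, so that the bounds can be introduced one by one. *)
Definition boxset n (m k : nat) : set 'rV[R]_n :=
  [set y | forall i : 'I_n, 0 <= y 0 i /\ ((m <= i < k)%N -> y 0 i < eps)].

Lemma measurable_boxset n m k : measurable (@boxset n m k).
Proof.
pose I (i : 'I_n) : set R := if (m <= i < k)%N then `[0, eps[%classic else `[0, +oo[%classic.
rewrite (_ : boxset m k = [set y | forall i, I i (y 0 i)]).
  by apply: measurable_box => i; rewrite /I; case: ifP => _; exact: measurable_itv.
apply/seteqP; split => y /= h i; have := h i; rewrite /I; case: ifP => hi;
  rewrite /= in_itv /=.
- by move=> [-> ->].
- by move=> [-> _].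
- by move=> /andP[].
- by rewrite andbT.
Qed.

Lemma boxset_orthant n m : @boxset n m m = @orthant R n.
Proof.
apply/seteqP; split => y h i; first by have [] := h i.
by split => [|/andP[mi]]; [exact: h|rewrite ltnNge mi].
Qed.

Lemma boxset_rvcons n k t : [set y : 'rV[R]_n | boxset 0 k.+1 (rvcons t y)] =
  if 0 <= t < eps then boxset 0 k else set0.
Proof.
case: ifP => ht; apply/seteqP; split => y //=.
- by move=> h i; have := h (lift 0 i); rewrite rvconsS lift0.
- move=> h i; case: (unliftP 0 i) => [j ->|->]; first by rewrite rvconsS lift0; exact: h.
  by rewrite rvcons0; move/andP: ht => [].
- by move=> h; have := h 0; rewrite rvcons0 => -[t0 /(_ isT) te]; rewrite t0 te in ht.
Qed.

(** Among the points without the bound on the coordinate m, those with this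
    coordinate at least eps form a translate of the whole. *)
Lemma boxset_step n m k (mn : (m < n)%N) : (m < k)%N ->
  @boxset n m k = boxset m.+1 k `\` [set y | boxset m.+1 k (y + (- eps) *: delta_mx 0 (Ordinal mn))].
Proof.
move=> mk.
have E (y : 'rV[R]_n) (i : 'I_n) : (y + (- eps) *: delta_mx 0 (Ordinal mn)) 0 i =
    y 0 i - (i == m :> nat)%:R * eps by rewrite !mxE mulNr mulrC.
apply/seteqP; split => y /=.
  move=> h; split=> [i|/(_ (Ordinal mn))[]].
    by have [y0 hy] := h i; split => // /andP[mi ik]; apply: hy; rewrite (ltnW mi).
  rewrite E eqxx mul1r subr_ge0 => + _; have [_ /=] := h (Ordinal mn).
  by rewrite leqnn mk => /(_ isT); rewrite ltNge => /negP.
move=> [h h'] i; have [y0 hy] := h i; split => //.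
rewrite leq_eqVlt => /andP[/orP[/eqP mi|mi] ik]; last by apply: hy; rewrite mi.
have {}mi : i = Ordinal mn by apply/val_inj.
rewrite mi ltNge; apply/negP => ey; apply: h' => j; rewrite E.
have [yj hj] := h j; have [jm|jm] := eqVneq (j : nat) m.
  have -> : j = Ordinal mn by exact/val_inj.
  by rewrite mul1r subr_ge0; split => //=; rewrite ltnn.
by rewrite mul0r subr0.
Qed.

End Boxes.

(** * The volume of a box in two ways *)

Section BoxVolumes.
Variables (R : realType) (r : nat) (eps : R).
Hypothesis eps_gt0 : 0 < eps.
Local Notation mu := (@lebesgue_measure R).

(** Each bound removes a translate (boxset_step), whose fibre lies over a
    point translated by - eps times the corresponding vector. *)
Lemma fvol_boxset (L : seq 'rV[R]_r) nu k j m x : image_scales (combf L) nu ->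
  (k <= size L)%N -> (m + j)%N = k ->
  on_vertices eps (take j (drop m L)) (fun b => @fvol R r L nu b (@orthant R _) \is a fin_num)
    (combf L x) ->
  @fvol R r L nu (combf L x) (boxset eps m k) =
  (fdiff eps (take j (drop m L)) (fun b => fine (@fvol R r L nu b (@orthant R _))) (combf L x))%:E.
Proof.
move=> hnu kL; elim: j m x => [|j IH] m x mk.
  rewrite take0 /= => hfin.
  by rewrite -mk addn0 boxset_orthant fineK.
have mL : (m < size L)%N by rewrite (leq_trans _ kL) // -mk addnS ltnS leq_addr.
rewrite (drop_nth 0 mL) /= => -[h1 h2].
rewrite (boxset_step eps mL); last by rewrite -mk addnS ltnS leq_addr.
have mS : (m.+1 + j)%N = k by rewrite addSnnS.
have xS : combf L (x + (- eps) *: delta_mx 0 (Ordinal mL)) = combf L x - eps *: L`_m.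
  rewrite linearD linearZ /= scaleNr; congr (_ - _ *: _).
  by rewrite combfE -rowE rowK.
rewrite /fvol fibre_volD //=.
- rewrite fibre_vol_translate //; last exact: measurable_boxset.
  by rewrite -!/(@fvol R r L _ _ _) !IH ?xS // EFinB.
- exact: measurable_boxset.
- by apply: (@measurable_preimage_add _ _ (- eps *: delta_mx 0 (Ordinal mL)) (boxset eps m.+1 k)); exact: measurable_boxset.
- move=> y /= h i; have := h i; rewrite !mxE /= => -[yi hi].
  have ei : 0 <= eps * (i == Ordinal mL)%:R by rewrite mulr_ge0 // ltW.
  split; first by rewrite mulNr in yi; lra.
  move=> /[dup] /andP[mi _] /hi; case: (eqVneq i (Ordinal mL)) mi => [->|_].
    by rewrite /= ltnn.
  by rewrite mulr0 addr0.
by rewrite -/(@fvol R r L _ _ _) IH.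
Qed.

Variables (E : 'cV[R]_r) (P : mpoly.mpoly r R) (Phi0 : seq 'rV[R]_r).
Variables (c : R) (da : set 'rV[R]_r -> \bar R).
Hypothesis c_gt0 : 0 < c.
Hypothesis daE : forall A, da A = (c%:E * leb A)%E.
Hypothesis Phi0E : forall a, a \in <<Phi0>>%VS <-> pairing a E = 0.

(** The indicator of the positive side. Its value on the wall is chosen so
    that, for s = e t, the difference between its values at e t and e (t -
    eps) is, up to the sign of e, the indicator of 0 <= t < eps at every t. *)
Definition halfline (e s : R) := if 0 < e then 0 <= s else 0 < s.

Lemma halfline_gt0 e s : 0 < s -> halfline e s.
Proof. by rewrite /halfline; case: ifP => // _ /ltW. Qed.

Lemma halfline_lt0 e s : s < 0 -> ~~ halfline e s.
Proof.
by rewrite /halfline => s0; case: ifP => _; [rewrite -ltNge|rewrite -leNgt ltW].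
Qed.

Definition cutoff e (g : 'rV[R]_r -> R) b := if halfline e (pairing b E) then g b else 0.

Lemma poly_deriv0 (p : {poly R}) : (forall t, p^`().[t] = 0) -> forall x y, p.[x] = p.[y].
Proof.
move=> p0.
have h x y : x < y -> p.[x] = p.[y].
  move=> xy; have [_ h1] := has_integral_poly p xy.
  have [_] := eq_has_integral (fun t _ => esym (p0 t)) (has_integral0 x y).
  by rewrite h1 => -[]; lra.
by move=> x y; have [/h|/h|->] := ltgtP x y.
Qed.

(** The residue polynomial of psi alone is constant along psi, so it takes its
    value where the line through b meets the wall; this point contributes
    exactly if the coordinate of b along psi is in [0, eps[. *)
Lemma fvol_box1 psi b : pairing psi E != 0 ->
  let t0 := pairing b E / pairing psi E in
  (0 <= t0 < eps ->
    @fvol R r Phi0 (wall_measure da E) (b - t0 *: psi) (@orthant R _) =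
    (peval P (b - t0 *: psi))%:E) ->
  @fvol R r (psi :: Phi0) da b (boxset eps 0 1) =
  (fdiff eps [:: psi] (cutoff (pairing psi E) (op_residue E P [:: psi])) b)%:E.
Proof.
move=> e0 t0 hw; have mB : measurable (@boxset R eps (size (psi :: Phi0)) 0 1) by exact: measurable_boxset.
rewrite (fvol_cons_off_wall c_gt0 daE Phi0E e0 _ mB) -/t0 boxset_rvcons.
have bE : pairing b E = pairing psi E * t0 by rewrite mulrC divfK.
clearbody t0.
have wE : pairing (b - t0 *: psi) E = 0 by rewrite pairingB pairingZ bE mulrC subrr.
have [p pE] := op_residue_line P [::] b e0.
have pc t : op_residue E P [:: psi] (b + t *: psi) = peval P (b - t0 *: psi) / pairing psi E.
  rewrite -(op_residue_wall1 P psi wE) -scaleNr (pE _).1 (pE _).1.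
  by apply: poly_deriv0 => u; rewrite -(pE u).2 op_residue0.
have h0 := pc 0; rewrite scale0r addr0 in h0.
have h1 := pc (- eps); rewrite scaleNr in h1.
have sE : pairing psi E * t0 - eps * pairing psi E = pairing psi E * (t0 - eps) by ring.
rewrite /= /cutoff h0 h1 pairingB pairingZ bE sE.
rewrite /halfline.
move: hw; case: ifP => ht hw.
  rewrite boxset_orthant hw // -EFinM; congr (_%:E); move/andP: ht => [ht0 hte].
  have [ep|en|] := ltgtP 0 (pairing psi E); last by move/esym/eqP; rewrite (negbTE e0).
    rewrite pmulr_rge0 // ht0 pmulr_rge0 // subr_ge0 leNgt hte /= subr0.
    by rewrite gtr0_norm // mulrC.
  rewrite nmulr_rgt0 // ltNge ht0 /= nmulr_rgt0 // subr_lt0 hte.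
  by rewrite ltr0_norm // invrN sub0r mulNr mulrC.
rewrite /fvol fibre_vol0 mule0; congr (_%:E).
have [ep|en|] := ltgtP 0 (pairing psi E); last by move/esym/eqP; rewrite (negbTE e0).
  rewrite 2?pmulr_rge0 // subr_ge0.
  move/negbT: ht; rewrite negb_and -ltNge -leNgt => /orP[h|h].
    by rewrite !ifN ?subrr // -ltNge // (lt_trans h).

  by rewrite !ifT ?subrr // (le_trans _ h) // ltW.
rewrite 2?nmulr_rgt0 // subr_lt0.
move/negbT: ht; rewrite negb_and -ltNge -leNgt => /orP[h|h].
  by rewrite !ifT ?subrr // (lt_trans h).
by rewrite !ifN ?subrr // -leNgt // (le_trans _ h) // ltW.
Qed.

End BoxVolumes.
Arguments cutoff {R r} E e g b.

Section BoxVolumeFormula.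
Variables (R : realType) (r : nat) (eps : R).
Hypothesis eps_gt0 : 0 < eps.
Local Notation mu := (@lebesgue_measure R).
Variables (E : 'cV[R]_r) (P : mpoly.mpoly r R) (Phi0 : seq 'rV[R]_r).
Variables (c : R) (da : set 'rV[R]_r -> \bar R).
Hypothesis c_gt0 : 0 < c.
Hypothesis daE : forall A, da A = (c%:E * leb A)%E.
Hypothesis Phi0E : forall a, a \in <<Phi0>>%VS <-> pairing a E = 0.

(** The residue polynomial of psi :: M is a primitive along psi, and vanishes
    where the line crosses the wall. *)
Lemma has_integral_cut_op_residue M psi e b : (0 < size M)%N -> pairing psi E != 0 ->
  let G := cutoff E e (op_residue E P (psi :: M)) in
  has_integral 0 eps (fun t => cutoff E e (op_residue E P M) (b - t *: psi))
    (G b - G (b - eps *: psi)).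
Proof.
move=> M0 e0 G; have [p pE] := op_residue_line P M b e0.
pose q := - (p \Po (- 'X)).
have qE t : q.[t] = - op_residue E P (psi :: M) (b - t *: psi).
  by rewrite -scaleNr (pE _).1 /q hornerN horner_comp !hornerE.
have qE' t : q^`().[t] = op_residue E P M (b - t *: psi).
  rewrite -scaleNr (pE _).2 /q derivN deriv_comp derivN derivX.
  by rewrite hornerN hornerM horner_comp !hornerE; ring.
pose tau := pairing b E / pairing psi E.
have sE t : pairing (b - t *: psi) E = pairing psi E * (tau - t).
  by rewrite pairingB pairingZ /tau mulrBr [_ * (_ / _)]mulrC divfK // [_ * t]mulrC.
have q0 : q.[tau] = 0.
  by rewrite qE op_residue_wall ?oppr0 // sE subrr mulr0.
have := has_integral_cut eps_gt0 e0 (@halfline_gt0 R e) (@halfline_lt0 R e) q0.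
rewrite /= !qE -!sE scale0r subr0 => h.
have -> : G b - G (b - eps *: psi) =
    (if halfline e (pairing (b - eps *: psi) E) then - op_residue E P (psi :: M) (b - eps *: psi) else 0) -
    (if halfline e (pairing b E) then - op_residue E P (psi :: M) b else 0).
  by rewrite /G /cutoff; case: ifP; case: ifP => _ _; ring.
by apply: eq_has_integral h => t _; rewrite qE' -sE.
Qed.

(** The last vector is treated by fvol_box1. Each further vector adds an
    integration over [0, eps[, which is a difference of primitives and
    commutes with the differences already taken. *)
Lemma fvol_box M psi0 a rho C b :
  (forall psi, psi \in rcons M psi0 -> pairing psi E != 0) ->
  (forall psi, psi \in rcons M psi0 -> `|psi| <= C) ->
  (forall w, nball a rho w -> pairing w E = 0 ->
    @fvol R r Phi0 (wall_measure da E) w (@orthant R _) = (peval P w)%:E) ->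
  `|a - b| + (size (rcons M psi0))%:R * (eps * C) < rho ->
  @fvol R r (rcons M psi0 ++ Phi0) da b (boxset eps 0 (size (rcons M psi0))) =
  (fdiff eps (rcons M psi0) (cutoff E (pairing psi0 E) (op_residue E P (rcons M psi0))) b)%:E.
Proof.
move=> + + hW; elim: M b => [|psi M IH] b hE hC hb.
  have e0 : pairing psi0 E != 0 by apply: hE; rewrite mem_head.
  have C0 : `|psi0| <= C by apply: hC; rewrite mem_head.
  apply: (fvol_box1 eps_gt0 c_gt0 daE Phi0E) => // /andP[t0 te]; apply: hW; last first.
    by rewrite pairingB pairingZ divfK // subrr.
  set t := _ / _ in t0 te *; move: hb; rewrite mul1r /nball /= => hb.
  have := ler_normD (a - b) (t *: psi0); rewrite normrZ (ger0_norm t0).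
  rewrite [a - (b - _)](_ : _ = a - b + t *: psi0); last by rewrite opprB addrCA addrC.
  have : t * `|psi0| <= eps * C by rewrite ler_pM // ltW.
  lra.
set N := rcons M psi0; set X := N ++ Phi0.
have e0 : pairing psi0 E != 0 by apply: hE; rewrite mem_rcons mem_head.
have eE : pairing psi E != 0 by apply: hE; rewrite mem_head.
have psiC : `|psi| <= C by apply: hC; rewrite mem_head.
have Xfull : <<X>>%VS = fullv.
  apply/eqP; rewrite eqEsubv subvf -(span_cons_full Phi0E e0) /=; apply: sub_span => v.
  rewrite in_cons mem_cat mem_rcons in_cons => /orP[->//|->]; by rewrite orbT.
have pXfull : <<psi :: X>>%VS = fullv.
  by apply/eqP; rewrite eqEsubv subvf -Xfull; apply: sub_span => v; rewrite in_cons => ->; rewrite orbT.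
have mB : measurable (@boxset R eps (size X).+1 0 (size N).+1) by exact: measurable_boxset.
rewrite (@fvol_cons_in_span R r X psi da b _ _ _ (image_scales_full c_gt0 daE Xfull)
  (image_scales_full c_gt0 daE pXfull) mB) ?Xfull ?memvf //.
pose G := cutoff E (pairing psi0 E) (op_residue E P (psi :: N)).
pose g t := fdiff eps N (cutoff E (pairing psi0 E) (op_residue E P N)) (b - t *: psi).
have [ig jg] : has_integral 0 eps g (fdiff eps (psi :: N) G b).
  rewrite /= -fdiff_shift -fdiffB; apply: has_integral_fdiff => v.
  by apply: has_integral_cut_op_residue => //; rewrite size_rcons.
rewrite -jg -(integral_itv_bndoo true true); last exact: measurable_int ig.
rewrite [RHS]integral_mkcond; apply: eq_integral => t _.
rewrite patchE; case: ifPn; rewrite (boxset_rvcons _ (size X)).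
  rewrite inE /= in_itv /= => ht; rewrite ht; apply: IH.
  - by move=> chi h; apply: hE; rewrite in_cons h orbT.
  - by move=> chi h; apply: hC; rewrite in_cons h orbT.
  move: hb; rewrite /= -natr1 mulrDl mul1r.
  have /andP[t0 te] := ht; have := ler_normD (a - b) (t *: psi); rewrite normrZ (ger0_norm t0).
  rewrite [a - (b - _)](_ : _ = a - b + t *: psi); last by rewrite opprB addrCA addrC.
  have : t * `|psi| <= eps * C by rewrite ler_pM // ltW.
  lra.
rewrite notin_setE /= in_itv /= => /negP/negbTE ->.
exact: fibre_vol0.
Qed.

End BoxVolumeFormula.

(** * Isolating one vertex *)

Section IsolatedVertex.
Variables (R : realType) (r : nat) (eps : R) (E : 'cV[R]_r).
Hypothesis eps_gt0 : 0 < eps.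
Implicit Types (M : seq 'rV[R]_r) (b : 'rV[R]_r).

(** The vertices over b + eps * negsum M are obtained from b by moves which
    all lower the pairing with E: adding eps psi for psi negative on E, or
    subtracting it for the others. So b is the highest vertex. *)
Definition negsum M : 'rV[R]_r := \sum_(psi <- M | pairing psi E < 0) psi.

Lemma negsum_norm M C : (forall psi, psi \in M -> `|psi| <= C) ->
  `|negsum M| <= (size M)%:R * C.
Proof.
elim: M => [|psi M IH] hC; first by rewrite /negsum big_nil normr0 mul0r.
have hpsi := hC psi (mem_head _ _).
have {}IH : `|negsum M| <= (size M)%:R * C.
  by apply: IH => chi h; apply: hC; rewrite in_cons h orbT.
have := normr_ge0 psi; rewrite /negsum big_cons /= -natr1 mulrDl mul1r; case: ifP => _ nn.
  by have := ler_normD psi (negsum M); rewrite /negsum in IH *; lra.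
by rewrite /negsum in IH; lra.
Qed.

Lemma negsum_cons psi M b : b + eps *: negsum (psi :: M) =
  (b + (if pairing psi E < 0 then eps *: psi else 0)) + eps *: negsum M.
Proof.
by rewrite /negsum big_cons; case: ifP => _; rewrite ?addr0 // scalerDr addrA.
Qed.

Lemma on_vertices_negsum_lt0 M b : pairing b E < 0 ->
  on_vertices eps M (fun v => pairing v E < 0) (b + eps *: negsum M).
Proof.
have e0 := eps_gt0; elim: M b => [|psi M IH] b b0; first by rewrite /negsum /= big_nil scaler0 addr0.
rewrite /= negsum_cons; case: ifP => psi0.
  split; first by apply: IH; rewrite pairingD pairingZ; nra.
  by rewrite addrAC addrK; exact: IH.
rewrite addr0; split; first exact: IH.
rewrite addrAC; apply: IH; rewrite pairingB pairingZ.
by move/negbT: psi0; rewrite -leNgt; nra.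
Qed.

Lemma on_vertices_negsum_neq0 M b : 0 < pairing b E ->
  (forall psi, psi \in M -> pairing b E < eps * `|pairing psi E|) ->
  on_vertices eps M (fun v => pairing v E != 0) (b + eps *: negsum M).
Proof.
have e0 := eps_gt0; have weak v : pairing v E < 0 -> pairing v E != 0 by move/lt_eqF ->.
elim: M => [|psi M IH] b0 hb; first by rewrite /negsum /= big_nil scaler0 addr0 gt_eqF.
have hpsi := hb psi (mem_head _ _).
have {}IH : on_vertices eps M (fun v => pairing v E != 0) (b + eps *: negsum M).
  by apply: IH => // chi h; apply: hb; rewrite in_cons h orbT.
rewrite /= negsum_cons; case: ifP => psi0.
  split; last by rewrite addrAC addrK.
  apply: on_vertices_impl weak _; apply: on_vertices_negsum_lt0.
  by rewrite pairingD pairingZ; rewrite ltr0_norm // in hpsi; nra.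
rewrite addr0; split=> //; rewrite addrAC.
apply: on_vertices_impl weak _; apply: on_vertices_negsum_lt0.
move/negbT: psi0; rewrite -leNgt => psi0; rewrite ger0_norm // in hpsi.
by rewrite pairingB pairingZ; nra.
Qed.

Definition upper (q : 'rV[R]_r -> R) v := if 0 < pairing v E then q v else 0.

Lemma fdiff_upper_lt0 M q b : pairing b E < 0 -> fdiff eps M (upper q) (b + eps *: negsum M) = 0.
Proof.
move=> b0; rewrite -(fdiff0 eps M (b + eps *: negsum M)); apply: eq_fdiff.
apply: on_vertices_impl (on_vertices_negsum_lt0 M b0) => v v0.
by rewrite /upper ltNge (ltW v0).
Qed.

(** Any other vertex is lower than b by at least one eps * |<psi, E>|, hence
    on the negative side. The sign of the remaining term depends on the parity
    of the number of vectors in negsum M. *)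
Lemma fdiff_upper_isolated M q b : 0 < pairing b E ->
  (forall psi, psi \in M -> pairing b E < eps * `|pairing psi E|) ->
  `|fdiff eps M (upper q) (b + eps *: negsum M)| = `|q b|.
Proof.
have e0 := eps_gt0; move=> b0; elim: M => [|psi M IH] hb.
  by rewrite /negsum /= big_nil scaler0 addr0 /upper b0.
have hpsi := hb psi (mem_head _ _).
have {}IH : `|fdiff eps M (upper q) (b + eps *: negsum M)| = `|q b|.
  by apply: IH => chi h; apply: hb; rewrite in_cons h orbT.
rewrite /= negsum_cons; case: ifP => psi0.
  rewrite fdiff_upper_lt0 ?sub0r ?normrN; last first.
    by rewrite pairingD pairingZ; rewrite ltr0_norm // in hpsi; nra.
  by rewrite addrAC addrK.
rewrite addr0 [b + _ - _]addrAC [X in `|_ - X|]fdiff_upper_lt0 ?subr0 //.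
move/negbT: psi0; rewrite -leNgt => psi0; rewrite ger0_norm // in hpsi.
by rewrite pairingB pairingZ; nra.
Qed.

Lemma near_slab (a d : 'rV[R]_r) rho x y : pairing a E = 0 -> 0 < pairing d E ->
  0 < rho -> x <= 0 -> 0 <= y -> x < y ->
  exists b0 : 'rV[R]_r, \forall b \near b0, nball a rho b /\ x < pairing b E < y.
Proof.
move=> aE d0 rho0 x0 y0 xy.
pose u := (x + y) / 2; pose D := (u / pairing d E) *: d.
(* Scaling by k <= 1 keeps <D, E> strictly between x and y, because x <= 0 <=
   y. *)
pose k := rho / (rho + `|D|).
have nD := normr_ge0 D.
have den : 0 < rho + `|D| by lra.
have k0 : 0 < k by rewrite divr_gt0.
have kE : k * (rho + `|D|) = rho by rewrite divfK // gt_eqF.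
have k1 : k <= 1 by nra.
have kD : k * `|D| < rho by nra.
have DE : pairing D E = u by rewrite pairingZ divfK // gt_eqF.
exists (a + k *: D).
have hb : nball a rho (a + k *: D).
  by rewrite /nball /= opprD addrA subrr sub0r normrN normrZ (gtr0_norm k0).
have hs : x < pairing (a + k *: D) E < y.
  rewrite pairingD aE add0r pairingZ DE /u; have h1 : x < (x + y) / 2 by lra.
  have h2 : (x + y) / 2 < y by lra.
  by apply/andP; split; nra.
have cE := @continuous_pairingl R r E (a + k *: D).
have n1 := nball_nbhs hb.
have /andP[hs1 hs2] := hs.
have n2 : \forall b \near a + k *: D, x < pairing b E by exact: cvgr_gt cE _ hs1.
have n3 : \forall b \near a + k *: D, pairing b E < y by exact: cvgr_lt cE _ hs2.
by apply: filterS3 n1 n2 n3 => b ? -> ->.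
Qed.

End IsolatedVertex.

(** * The wall_jump across the wall *)

Section WallJump.
Variables (R : realType) (r : nat) (dx : set 'cV[R]_r -> \bar R).
Variables (Phi : seq 'rV[R]_r) (W : {vspace 'rV[R]_r}) (E : 'cV[R]_r).

Lemma dual_measureE : is_lebesgue dx ->
  exists2 c : R, 0 < c & forall A, dual_measure dx A = (c%:E * leb A)%E.
Proof.
move=> [k k0 dxE]; exists k^-1; rewrite ?invr_gt0 // => A.
rewrite /dual_measure dxE (_ : [set y | _] = @cube R r).
  by rewrite leb_cube mule1.
by apply/seteqP; split => y /= h i; have := h i; rewrite mxE.
Qed.

Lemma span_wall : is_wall Phi W -> <<[seq phi <- Phi | phi \in W]>>%VS = W.
Proof.
move=> [nu [nuPhi _ _ WE]]; apply/eqP; rewrite eqEsubv; apply/andP; split.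
  by apply/span_subvP => phi; rewrite mem_filter => /andP[].
rewrite {1}WE; apply: sub_span => phi h; rewrite mem_filter nuPhi // andbT WE.
exact: memv_span.
Qed.

Lemma mem_seq_bound (M : seq 'rV[R]_r) :
  exists2 C : R, 0 <= C & forall psi, psi \in M -> `|psi| <= C.
Proof.
exists (\sum_(psi <- M) `|psi|); first by rewrite sumr_ge0.
by move=> psi h; rewrite (big_rem psi h) /= lerDl sumr_ge0.
Qed.

Lemma pairing_bound (M : seq 'rV[R]_r) : (forall psi, psi \in M -> pairing psi E != 0) ->
  exists2 eta : R, 0 < eta & forall psi, psi \in M -> eta <= `|pairing psi E|.
Proof.
elim: M => [|psi M IH] hE; first by exists 1.
have [eta eta0 heta] : exists2 eta : R, 0 < eta & forall psi, psi \in M -> eta <= `|pairing psi E|.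
  by apply: IH => chi h; apply: hE; rewrite in_cons h orbT.
have e0 : 0 < `|pairing psi E| by rewrite normr_gt0 hE ?mem_head.
exists (Num.min eta `|pairing psi E|); first by rewrite lt_min eta0.
move=> chi; rewrite in_cons ge_min => /orP[/eqP ->|/heta ->] //.
by rewrite lexx orbT.
Qed.

Lemma vol_perm_fvol L da (b : 'rV[R]_r) : perm_eq Phi L -> <<Phi>>%VS = fullv ->
  image_scales (combf L) da -> @fvol R r L da b (@orthant R _) = vol Phi da b.
Proof.
move=> PL full hda.
have : b \in <<L>>%VS by rewrite -(eq_span (perm_mem PL)) full memvf.
move=> /combf_spanP[x <-]; rewrite -vol_fvol (vol_perm PL hda) //.
by rewrite full memvf.
Qed.

Lemma polyfun_on_full (v : 'rV[R]_r -> R) : is_polynomial_on fullv v -> polyfun v.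
Proof.
move=> [Q vQ]; rewrite (_ : v = peval Q); first exact: polyfun_peval.
by apply/funext => a; rewrite vQ ?memvf.
Qed.

Variables (c1 c2 c12 : set 'rV[R]_r) (v1 v2 v12 : 'rV[R]_r -> R) (P : mpoly.mpoly r R).
Let Phi0 := [seq phi <- Phi | phi \in W].
Let Psi := [seq phi <- Phi | phi \notin W].
Let da := dual_measure dx.
Let dw := wall_measure da E.
Hypothesis dxL : is_lebesgue dx.
Hypothesis Phi_full : <<Phi>>%VS = fullv.
Hypothesis wallW : is_wall Phi W.
Hypothesis WE : forall a, a \in W <-> pairing a E = 0.
Hypothesis ch1 : is_chamber fullv Phi c1.
Hypothesis ch2 : is_chamber fullv Phi c2.
Hypothesis adj : adjacent_along Phi W E c1 c2.
Hypothesis ch12 : is_chamber W Phi0 c12.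
Hypothesis cl12 : closure c1 `&` closure c2 `&` [set` W] `<=` closure c12.
Hypothesis poly1 : is_chamber_poly fullv Phi da c1 v1.
Hypothesis poly2 : is_chamber_poly fullv Phi da c2 v2.
Hypothesis poly12 : is_chamber_poly W Phi0 dw c12 v12.
Hypothesis PW : forall a, a \in W -> peval P a = v12 a.

Lemma Psi_pairing psi : psi \in Psi -> pairing psi E != 0.
Proof. by rewrite mem_filter => /andP[psiW _]; apply: contra psiW => /eqP/WE. Qed.

Lemma Psi_neq0 : Psi != [::].
Proof.
apply/eqP => Psi0; have [d d0] := exists_positive wallW WE.
have : d \in W.
  have : d \in <<Phi>>%VS by rewrite Phi_full memvf.
  apply/subvP/span_subvP => phi phiPhi; have := in_nil phi.
  by rewrite -Psi0 mem_filter phiPhi andbT => /negbFE.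
by move=> /WE dE; rewrite dE ltxx in d0.
Qed.

(** Both computations of the volume of the box, fvol_boxset and fvol_box,
    applied at b. The vertices are kept off the wall, where the volume of Phi
    is not known. *)
Lemma local_difference_identity : exists a rho, [/\ pairing a E = 0, 0 < rho &
  forall eps C b, 0 < eps -> (forall psi, psi \in Psi -> `|psi| <= C) ->
    `|a - b| + (size Psi)%:R * (eps * C) < rho ->
    on_vertices eps Psi (fun v => pairing v E != 0) b ->
    fdiff eps Psi v2 b + fdiff eps Psi (upper E (fun v => v1 v - v2 v - op_residue E P Psi v)) b = 0].
Proof.
have [c c0 daE] := dual_measureE dxL.
have [a [rho [aW rho0 loc]]] := local_structure wallW WE ch1 ch2 adj ch12 cl12.
exists a, rho; split => //; first exact/WE.
move=> eps C b eps0 hC hb off.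
have Phi0E v : v \in <<Phi0>>%VS <-> pairing v E = 0 by rewrite span_wall.
pose L := Psi ++ Phi0.
have PL : perm_eq Phi L by rewrite perm_sym perm_catC; exact/permPl/perm_filterC.
have L_full : <<L>>%VS = fullv by rewrite -(eq_span (perm_mem PL)).
have hda : image_scales (combf L) da := image_scales_full c0 daE L_full.
have inball : on_vertices eps Psi (nball a rho) b by apply: on_vertices_nball hb => //; exact: ltW.
pose h v := @fvol R r L da v (@orthant R _).
have hv v : nball a rho v /\ pairing v E != 0 ->
    h v = (v2 v + upper E (fun u => v1 u - v2 u) v)%:E.
  move=> [/loc[l1 l2 _] v0]; rewrite /h vol_perm_fvol // /upper.
  have [p|n|z] := ltgtP 0 (pairing v E); last by rewrite -z eqxx in v0.
    by rewrite addrC subrK; apply: chamber_poly_vol poly1 (memvf _) (l1 p).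
  by rewrite addr0; apply: chamber_poly_vol poly2 (memvf _) (l2 n).
have good := on_vertices_and inball off.
have hW w : nball a rho w -> pairing w E = 0 ->
    @fvol R r Phi0 (wall_measure da E) w (@orthant R _) = (peval P w)%:E.
  move=> /loc[_ _ l0] /WE wW; have /Phi0E/combf_spanP[x xE] := (proj1 (WE w) wW).
  rewrite -{1}xE -vol_fvol xE PW //.
  exact: chamber_poly_vol poly12 wW (l0 wW).
have [M [psi0 PsiE]] : exists M psi0, Psi = rcons M psi0.
  by case: (lastP Psi) Psi_neq0 => // M psi0 _; exists M, psi0.
have e0 : pairing psi0 E != 0 by apply: Psi_pairing; rewrite PsiE mem_rcons mem_head.
have : fdiff eps Psi (fine \o h) b =
    fdiff eps Psi (cutoff E (pairing psi0 E) (op_residue E P Psi)) b.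
  have /combf_spanP[x xE] : b \in <<L>>%VS by rewrite L_full memvf.
  have kL : (size Psi <= size L)%N by rewrite size_cat leq_addr.
  have H := @fvol_boxset R r eps eps0 L da (size Psi) (size Psi) 0 x hda kL (add0n _).
  rewrite drop0 take_size_cat // xE in H.
  have box : @fvol R r L da b (boxset eps 0 (size Psi)) =
      (fdiff eps Psi (cutoff E (pairing psi0 E) (op_residue E P Psi)) b)%:E.
    have hE := Psi_pairing; rewrite /L; move: hC hb hE; rewrite PsiE => hC' hb' hE.
    exact: (fvol_box eps0 c0 daE Phi0E hE hC' hW hb').
  move: box; rewrite H; first by move=> [].
  by apply: on_vertices_impl good => v /hv; rewrite /h => ->.
have -> : fdiff eps Psi (fine \o h) b = fdiff eps Psi (fun v => v2 v + upper E (fun u => v1 u - v2 u) v) b.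
  by apply: eq_fdiff; apply: on_vertices_impl good => v /hv /= ->.
have -> : fdiff eps Psi (cutoff E (pairing psi0 E) (op_residue E P Psi)) b =
    fdiff eps Psi (upper E (op_residue E P Psi)) b.
  apply: eq_fdiff; apply: on_vertices_impl off => v v0; rewrite /cutoff /upper.
  have [p|n|z] := ltgtP 0 (pairing v E); last by rewrite -z eqxx in v0.
    by rewrite halfline_gt0.
  by rewrite (negbTE (halfline_lt0 _ n)).
rewrite fdiffD => eqn.
have -> : upper E (fun v => v1 v - v2 v - op_residue E P Psi v) =
    fun v => upper E (fun u => v1 u - v2 u) v - upper E (op_residue E P Psi) v.
  by apply/funext => v; rewrite /upper; case: ifP => _; rewrite ?subr0.
by rewrite fdiffB addrA eqn subrr.
Qed.

(** Two choices of the vertices, first all on the negative side and then all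
    but one, separate the two terms of local_difference_identity; each is a
    polynomial that vanishes on an open set. *)
Lemma wall_jump a : v1 a - v2 a = op_residue E P Psi a.
Proof.
have [a0 [rho [a0E rho0 ident]]] := local_difference_identity.
have [C C0 hC] := mem_seq_bound Psi.
have [eta eta0 heta] := pairing_bound Psi_pairing.
have [d d0] := exists_positive wallW WE.
pose k : R := (size Psi)%:R.
have k0 : 0 <= k by exact: ler0n.
(* Starting at distance less than rho / 2 from a0, moving by N and then along
   Psi costs at most 2 * eps * k * C, which is less than rho / 2. *)
pose eps := rho / (4 * (k * C + 1)).
have kC0 : 0 <= k * C by rewrite mulr_ge0.
have den0 : 0 < 4 * (k * C + 1) by lra.
have eps0 : 0 < eps by rewrite divr_gt0.
have epsE : eps * (4 * (k * C + 1)) = rho by rewrite divfK // gt_eqF.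
pose N := eps *: negsum E Psi.
have close b : nball a0 (rho / 2) b -> `|a0 - (b + N)| + k * (eps * C) < rho.
  rewrite /nball /= => hb; have h1 := ler_normB (a0 - b) N.
  have h2 : `|N| <= eps * (k * C).
    by rewrite normrZ (gtr0_norm eps0) ler_wpM2l ?(ltW eps0) // negsum_norm.
  by rewrite opprD addrA; lra.
have ident' b : nball a0 (rho / 2) b -> on_vertices eps Psi (fun v => pairing v E != 0) (b + N) ->
    fdiff eps Psi v2 (b + N) +
    fdiff eps Psi (upper E (fun v => v1 v - v2 v - op_residue E P Psi v)) (b + N) = 0.
  by move=> hb; apply: (ident eps C) => //; exact: close.
have rho2 : 0 < rho / 2 by lra.
have pv1 : polyfun v1 by case: poly1 => /polyfun_on_full.
have pv2 : polyfun v2 by case: poly2 => /polyfun_on_full.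
(* Below the wall, all vertices are on the negative side. *)
have d2 : forall b, fdiff eps Psi v2 (b + N) = 0.
  have [b0 nb0] := near_slab a0E d0 rho2 (lerN10 R) (lexx 0) (ltrN10 R).
  apply: (polyfun_eq0 (polyfun_shift N (polyfun_fdiff eps Psi pv2))).
  apply: filterS nb0 => b [hb /andP[_ bE]].
  rewrite -[LHS]addr0 -[X in _ + X](fdiff_upper_lt0 eps0 Psi (fun v => v1 v - v2 v - op_residue E P Psi v) bE).
  apply: ident' => //; apply: on_vertices_impl (on_vertices_negsum_lt0 eps0 Psi bE) => v.
  by move/lt_eqF ->.
suff q0 : forall b, v1 b - v2 b - op_residue E P Psi b = 0 by apply/eqP; rewrite -subr_eq0 q0.
have ee0 : 0 < eps * eta by rewrite mulr_gt0.
(* Less than eps * eta above the wall, b is the only vertex on the positive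
   side. *)
have [b0 nb0] := near_slab a0E d0 rho2 (lexx 0) (ltW ee0) ee0.
apply: (polyfun_eq0 (polyfunB (polyfunB pv1 pv2) (polyfun_op_residue E P Psi))).
apply: filterS nb0 => b [hb /andP[bE1 bE2]].
have small psi : psi \in Psi -> pairing b E < eps * `|pairing psi E|.
  by move=> /heta h; rewrite (lt_le_trans bE2) // ler_wpM2l // ltW.
have := ident' b hb (on_vertices_negsum_neq0 eps0 bE1 small); rewrite d2 add0r => z.
apply/normr0_eq0.
by rewrite -(@fdiff_upper_isolated R r eps E eps0 Psi (fun v => v1 v - v2 v - op_residue E P Psi v)) // z normr0.
Qed.

End WallJump.

Theorem theorem23 (R : realType) (r : nat) (dx : set 'cV[R]_r -> \bar R)
    (Phi : seq 'rV[R]_r) (W : {vspace 'rV[R]_r}) (E : 'cV[R]_r)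
    (c1 c2 c12 : set 'rV[R]_r) (v1 v2 v12 : 'rV[R]_r -> R)
    (P : mpoly.mpoly r R) :
  let Phi0 := [seq phi <- Phi | phi \in W] in
  let Psi := [seq phi <- Phi | phi \notin W] in
  let da := dual_measure dx in
  let dw := wall_measure da E in
  is_lebesgue dx ->
  0 \notin Phi ->
  <<Phi>>%VS = fullv ->
  (exists x : 'cV[R]_r, forall phi, phi \in Phi -> 0 < pairing phi x) ->
  is_wall Phi W ->
  (forall a, a \in W <-> pairing a E = 0) ->
  is_chamber fullv Phi c1 ->
  is_chamber fullv Phi c2 ->
  adjacent_along Phi W E c1 c2 ->
  is_chamber W Phi0 c12 ->
  closure c1 `&` closure c2 `&` [set` W] `<=` closure c12 ->
  is_chamber_poly fullv Phi da c1 v1 ->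
  is_chamber_poly fullv Phi da c2 v2 ->
  is_chamber_poly W Phi0 dw c12 v12 ->
  (forall a, a \in W -> peval P a = v12 a) ->
  forall a : 'rV[R]_r, v1 a - v2 a = Pol P Psi E a.
Proof.
move=> Phi0 Psi da dw dxL _ full _ wallW WE ch1 ch2 adj ch12 cl12 p1 p2 p12 PW a.
rewrite (wall_jump dxL full wallW WE ch1 ch2 adj ch12 cl12 p1 p2 p12 PW).
by rewrite PolE //; exact: Psi_pairing WE.
Qed.
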